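(* Let $\alpha,\beta>-1$, $\eta(x)=1-x^2$ and $\gamma(x)=-(\alpha+\beta+2)x+\beta-\alpha$. There exist finite constants $K_1,K_2$ depending only on $\alpha$ and $\beta$ such that (P) $\|g_h'\|_\infty\le K_1\|h'\|_\infty$ for every Lipschitz continuous $h:\mathbb{R}\to\mathbb{R}$, and $\|g_h''\|_\infty\le K_2(\|h'\|_\infty+\|h''\|_\infty)$ for every twice differentiable $h:\mathbb{R}\to\mathbb{R}$ with bounded first and second derivative, where $g_h$ is the solution of the Stein equation for $\mu_{\alpha,\beta}$ given in the context. For any such constants the following holds. Let $W,W'$ be identically distributed real-valued random variables on a common probability space satisfying $$E[W'-W\mid W]=\lambda\gamma(W)+R$$ for some constant $\lambda>0$ and a random variable $R$. Then for each twice differentiable function $h:\mathbb{R}\to\mathbb{R}$ with bounded first and second derivative and with $E[|h(W)|]<\infty$, $$\bigl|E[h(W)]-\mu_{\alpha,\beta}(h)\bigr|\le K_1\|h'\|_\infty E\Bigl[\Bigl|\eta(W)-\tfrac{1}{2\lambda}E[(W'-W)^2\mid W]\Bigr|\Bigr]+\frac{K_2(\|h'\|_\infty+\|h''\|_\infty)}{6\lambda}E\bigl[|W'-W|^3\bigr]+\frac{\|h'\|_\infty}{(\alpha+\beta+2)\lambda}E[|R|].$$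
   Context: $\mu_{\alpha,\beta}$ is the Beta distribution on $[-1,1]$ with density $p(x)=C(\alpha,\beta)(1-x)^\alpha(1+x)^\beta1_{(-1,1)}(x)$, $C(\alpha,\beta)=\frac{\Gamma(\alpha+\beta+2)}{2^{\alpha+\beta+1}\Gamma(\alpha+1)\Gamma(\beta+1)}$; $\mu_{\alpha,\beta}(h)=\int h\,d\mu_{\alpha,\beta}$. The Stein equation is $(1-x^2)g'(x)+[-(\alpha+\beta+2)x+\beta-\alpha]g(x)=\tilde h(x)$, $\tilde h:=h-\mu_{\alpha,\beta}(h)$. Its solution $g_h:\mathbb{R}\to\mathbb{R}$ is $g_h(x)=\frac1{(1-x^2)p(x)}\int_{-1}^x\tilde h(t)p(t)dt$ for $-1<x<1$; $g_h(x)=\frac{1}{(1-x)^{\alpha+1}(-1-x)^{\beta+1}}\int_x^{-1}\tilde h(t)(1-t)^\alpha(-1-t)^\beta dt$ for $x<-1$; $g_h(x)=-\frac{1}{(x-1)^{\alpha+1}(1+x)^{\beta+1}}\int_1^x\tilde h(t)(t-1)^\alpha(1+t)^\beta dt$ for $x>1$; $g_h(-1)=\frac{\tilde h(-1)}{2\beta+2}$, $g_h(1)=-\frac{\tilde h(1)}{2\alpha+2}$. $\|\cdot\|_\infty$ is the essential supremum norm on $\mathbb{R}$ (Lebesgue measure); for Lipschitz $h$, $\|h'\|_\infty$ is the minimal Lipschitz constant. The regression identity presupposes that $W'-W$ is integrable; the right-hand side of the bound may be $+\infty$ (in which case nothing is asserted). *)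

(* Defs.v *)
From HB Require Import structures.
From mathcomp Require Export all_boot all_order all_algebra.
From mathcomp Require Export all_classical all_reals all_analysis.
From mathcomp Require Export measurable_realfun.
Export Order.TTheory GRing.Theory Num.Theory.
Export numFieldNormedType.Exports.

Set Implicit Arguments.
Unset Strict Implicit.
Unset Printing Implicit Defensive.

Local Open Scope classical_set_scope.
Local Open Scope ring_scope.

Definition Gamma {R : realType} (s : R) : R :=
  \int[lebesgue_measure]_(t in `]0, +oo[) (t `^ (s - 1) * expR (- t)).

Definition beta_const {R : realType} (a b : R) : R :=
  Gamma (a + b + 2) / (2 `^ (a + b + 1) * Gamma (a + 1) * Gamma (b + 1)).

Definition beta_density {R : realType} (a b x : R) : R :=
  beta_const a b * (1 - x) `^ a * (1 + x) `^ b * \1_`]-1, 1[ x.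

Section density_facts.
Context {R : realType} (a b : R).

Lemma Gamma_ge0 (s : R) : 0 <= Gamma s.
Proof.
by apply: Rintegral_ge0 => t _; rewrite mulr_ge0 ?powR_ge0 ?expR_ge0.
Qed.

Lemma beta_density_ge0 x : 0 <= beta_density a b x.
Proof.
rewrite /beta_density /beta_const indicE.
by rewrite !(mulr_ge0, invr_ge0, powR_ge0, Gamma_ge0, ler0n).
Qed.

Lemma measurable_beta_density : measurable_fun setT (beta_density a b).
Proof.
have m1 : measurable_fun setT (fun x : R => (1 - x) `^ a).
  have := measurableT_comp (@measurable_powR R a).
  by apply; exact: measurable_funB.
have m2 : measurable_fun setT (fun x : R => (1 + x) `^ b).
  have := measurableT_comp (@measurable_powR R b).
  by apply; exact: measurable_funD.
by do 3! apply: measurable_funM => //.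
Qed.

End density_facts.

Definition beta_law {R : realType} (a b : R) (A : set R) : \bar R :=
  (\int[lebesgue_measure]_(x in A) (beta_density a b x)%:E)%E.

Section beta_law_measure.
Context {R : realType} (a b : R).

Let beta_law0 : beta_law a b set0 = 0%E.
Proof. by rewrite /beta_law integral_set0. Qed.

Let beta_law_ge0 A : (0 <= beta_law a b A)%E.
Proof.
by apply: integral_ge0 => x _; rewrite lee_fin beta_density_ge0.
Qed.

Let beta_law_sigma_additive : semi_sigma_additive (beta_law a b).
Proof.
move=> /= F mF tF mUF; rewrite /beta_law; apply: cvg_toP.
  apply: ereal_nondecreasing_is_cvgn => m n mn.
  apply: lee_sum_nneg_natr => // k _ _; apply: integral_ge0 => /= x _.
  by rewrite lee_fin beta_density_ge0.
rewrite ge0_integral_bigcup//=.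
- apply/measurable_funTS/measurableT_comp => //.
  exact: measurable_beta_density.
- by move=> x _; rewrite lee_fin beta_density_ge0.
Qed.

HB.instance Definition _ := isMeasure.Build _ _ _
  (beta_law a b) beta_law0 beta_law_ge0 beta_law_sigma_additive.

End beta_law_measure.

Definition beta_mean {R : realType} (a b : R) (h : R -> R) : R :=
  \int[beta_law a b]_x h x.

Definition beta_center {R : realType} (a b : R) (h : R -> R) (x : R) : R :=
  h x - beta_mean a b h.

Definition stein_eta {R : realType} (x : R) : R := 1 - x ^+ 2.

Definition stein_gamma {R : realType} (a b x : R) : R :=
  - (a + b + 2) * x + b - a.

Definition stein_sol {R : realType} (a b : R) (h : R -> R) (x : R) : R :=
  let ht := beta_center a b h in
  if x < -1 then
    ((1 - x) `^ (a + 1) * (-1 - x) `^ (b + 1))^-1 *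
    \int[lebesgue_measure]_(t in `[x, -1])
      (ht t * (1 - t) `^ a * (-1 - t) `^ b)
  else if x == -1 then ht (-1) / (2 * b + 2)
  else if x < 1 then
    ((1 - x ^+ 2) * beta_density a b x)^-1 *
    \int[lebesgue_measure]_(t in `[-1, x]) (ht t * beta_density a b t)
  else if x == 1 then - (ht 1 / (2 * a + 2))
  else
    - (((x - 1) `^ (a + 1) * (1 + x) `^ (b + 1))^-1 *
       \int[lebesgue_measure]_(t in `[1, x])
         (ht t * (t - 1) `^ a * (1 + t) `^ b)).

Definition supnorm {R : realType} (f : R -> R) : \bar R :=
  ('N[lebesgue_measure]_+oo[EFin \o f])%E.

(* The norm of h' for a Lipschitz h, which need not be differentiable. *)
Definition lipnorm {R : realType} (h : R -> R) : \bar R :=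
  ereal_inf [set k%:E | k in [set k : R | k.-lipschitz h]].

Definition twice_derivable_at {R : realType} (f : R -> R) (x : R) : Prop :=
  (\forall y \near x, derivable f y 1) /\ derivable f^`()%classic x 1.

Definition bounded_D2 {R : realType} (h : R -> R) : Prop :=
  [/\ forall x, twice_derivable_at h x,
      bounded_fun h^`()%classic & bounded_fun h^`(2)%classic].

(* The operators f^`() and f^`(2) return a default value where the derivative
   does not exist, so a bound on their essential supremum only bounds the
   derivative together with its existence almost everywhere. *)
Definition stein_bounds {R : realType} (a b K1 K2 : R) : Prop :=
  (forall h : R -> R, lipschitz h ->
     {ae lebesgue_measure, forall x, derivable (stein_sol a b h) x 1} /\
     (supnorm (stein_sol a b h)^`()%classic <= K1%:E * lipnorm h)%E) /\
  (forall h : R -> R, bounded_D2 h ->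
     {ae lebesgue_measure, forall x, twice_derivable_at (stein_sol a b h) x} /\
     (supnorm (stein_sol a b h)^`(2)%classic
        <= K2%:E * (lipnorm h + supnorm h^`(2)%classic))%E).

(* Z is a version of E[X | W].  Values in \bar R are allowed so that a
   nonnegative X need not be integrable. *)
Definition is_cond_exp {d} {T : measurableType d} {R : realType}
    (P : probability T R) (X : T -> \bar R) (W : T -> R) (Z : T -> \bar R) :
    Prop :=
  measurable_fun setT (Z : g_sigma_algebra_preimageType W -> \bar R) /\
  forall A : set T, g_sigma_algebra_preimage W A ->
    (\int[P]_(w in A) Z w = \int[P]_(w in A) X w)%E.

(* Main.v *)
Require Import Defs.
From mathcomp Require Import ring lra ess_sup_inf.

Set Implicit Arguments.
Unset Strict Implicit.
Unset Printing Implicit Defensive.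

Local Open Scope classical_set_scope.
Local Open Scope ring_scope.

(** Write g for the explicit solution attached to h, f for the centred function,
eta(x) = 1 - x^2 and gamma for the affine coefficient, so that
eta g' + gamma g = f.

The bounds on g rest on three features of this equation.  The constant k
solves it with right-hand side k gamma, so y |-> s y + k acts on solutions
([solves_affine]); the reflection x |-> - x exchanges the two parameters, so
only the singular point 1 has to be studied; and with the weight
w(x) = |1 - x|^(a+1) (1 + x)^(b+1) one has (w y)' = w f / eta, where w y
vanishes at 1 for the solution at hand.  The last point yields a comparison
principle: if f >= 0 between x0 and 1, on whichever side of 1, then
y(x0) <= 0 ([stein_le0]).  Shifting a Lipschitz f by a multiple of gamma makes
it monotone, which gives |y| <= K / (a + b + 2) ([solves_lip_le]); shifting it
so that it vanishes at the point x under consideration makes it of size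
K |1 - x| between x and 1, which near 1 compensates the division by eta and
gives |y'| <= C K ([solves_deriv_near]).  Away from 1 and -1 the equation
itself bounds y'.  Differentiating the equation produces the same equation
with parameters a + 1 and b + 1 and right-hand side f' + (a + b + 2) y, again
Lipschitz, so the estimate on y' applied once more bounds y''
([stein_solution_deriv_lip]).  That g satisfies the boundary condition at 1
from both sides means that the integral of f against the Beta density is 0
([integral_beta_center]); this uses that the density has mass 1, obtained from
the identity expressing a product of Gamma integrals through a Beta integral
([gamma_int_mul]).  Altogether [stein_solP] and [stein_bounds_ex].

For the second part the assumed constants only bound essential suprema of
derivatives; since g and g' are already known to be Lipschitz, such bounds are
Lipschitz constants ([ae_deriv_le_lip]) and hold everywhere.  Let G be a
primitive of g.  As W and W' have the same law, E[G(W') - G(W)] = 0.  Taylor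
expansion of G at W has a linear term E[g(W) (W' - W)], equal to
lambda E[gamma(W) g(W)] + E[g(W) R] by the regression identity, a quadratic
term E[g'(W) (W' - W)^2] / 2, which only involves E[(W' - W)^2 | W], and a
remainder of order E|W' - W|^3.  Replacing gamma g by f - eta g' gives the
three terms of the bound ([pair_bound_smooth]).  The expectations on the right
may be infinite, which is harmless unless they are multiplied by 0: if h' = 0
then g = 0, and if the second Lipschitz constant is 0 then g' = 0 because g is
bounded, and the linear term alone is exact ([pair_bound_affine]). *)

(** * Comparison for the Stein equation on one side of -1 *)

Section Comparison.
Context {R : realType}.
Implicit Types (a b x : R) (f y : R -> R).

(** The limit at 1 singles out one solution among those differing by a
multiple of the inverse of the weight.  Left and right of 1 are treated
together: the punctured neighbourhood in the limit covers both sides. *)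
Definition solves_right a b f y : Prop :=
  (forall x, -1 < x -> x != 1 -> derivable y x 1 /\
     stein_eta x * y^`()%classic x + stein_gamma a b x * y x = f x) /\
  (`|1 - x| `^ (a + 1) * y x @[x --> (1 : R)^'] --> (0 : R)).

(** Integrating factor of the Stein equation; the absolute value lets one
formula serve on both sides of 1. *)
Definition weight a b x : R := `|1 - x| `^ (a + 1) * (1 + x) `^ (b + 1).

Lemma is_derive_powR_affine (c p q x : R) : 0 < p + q * x ->
  is_derive x 1 (fun t : R => (p + q * t) `^ c) (c * (p + q * x) `^ (c - 1) * q).
Proof.
move=> pq0.
have H1 : is_derive x 1 (fun t : R => p + q * t) q.
  have -> : (fun t : R => p + q * t) = (cst p + q \*: (@id R)).
    by apply/funext => t /=.
  by apply: is_derive_eq; rewrite add0r /GRing.scale /= mulr1.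
have H2 := is_derive1_powR c pq0.
have := @is_derive1_comp _ (fun u : R => u `^ c) (fun t => p + q * t) x _ _ H2 H1.
by [].
Qed.

Lemma powRB1 (c u : R) : 0 < u -> u `^ (c - 1) = u `^ c / u.
Proof.
by move=> u0; rewrite powRB ?(gt_eqF u0) ?implybT// powRr1 ?ltW.
Qed.

Lemma stein_etaE x : stein_eta x = (1 - x) * (1 + x).
Proof. by rewrite /stein_eta; ring. Qed.

Lemma stein_eta_neq0 x : -1 < x -> x != 1 -> stein_eta x != 0.
Proof.
move=> x1 x2; rewrite stein_etaE mulf_neq0//; last by apply: lt0r_neq0; lra.
by rewrite subr_eq0 eq_sym.
Qed.

Lemma weight_gt0 a b x : -1 < x -> x != 1 -> 0 < weight a b x.
Proof.
move=> x1 x2; apply: mulr_gt0; apply: powR_gt0; last by lra.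
by rewrite normr_gt0 subr_eq0 eq_sym.
Qed.

(** The logarithmic derivative of the weight is gamma / eta, which is what
turns the equation into (weight * y)' = weight * f / eta. *)
Lemma is_derive_weight a b x : -1 < x -> x != 1 ->
  is_derive x 1 (weight a b)
    (weight a b x * (stein_gamma a b x / stein_eta x)).
Proof.
move=> x1 x2.
pose s : R := Num.sg (1 - x).
have s_neq0 : s != 0 by rewrite sgr_eq0 subr_eq0 eq_sym.
have E0 : s + (- s) * x = `|1 - x| by rewrite normrEsg /s; ring.
have sx : 0 < s + (- s) * x by rewrite E0 normr_gt0 subr_eq0 eq_sym.
have x1' : 0 < 1 + 1 * x by lra.
have D1 := is_derive_powR_affine (a + 1) sx.
have D2 := is_derive_powR_affine (b + 1) x1'.
have D := is_deriveM D1 D2.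
have -> : weight a b x * (stein_gamma a b x / stein_eta x) =
  ((s + - s * x) `^ (a + 1)) *: ((b + 1) * (1 + 1 * x) `^ (b + 1 - 1) * 1)
  + ((1 + 1 * x) `^ (b + 1)) *: ((a + 1) * (s + - s * x) `^ (a + 1 - 1) * - s).
  rewrite /GRing.scale /= !powRB1// mul1r /weight /stein_gamma stein_etaE E0.
  have -> : `|1 - x| = s * (1 - x) by rewrite normrEsg.
  field.
  rewrite s_neq0 subr_eq0 eq_sym x2 /= lt0r_neq0//; lra.
apply: near_eq_is_derive D.
have near_s : \forall t \near x, `|1 - t| = s + - s * t.
  have [xlt|xgt] := ltP x 1.
  - have -> : s = 1 by rewrite /s gtr0_sg// subr_gt0.
    near=> t; rewrite ger0_norm ?mulN1r// subr_ge0 ltW//.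
    by near: t; exact: lt_nbhsl.
  - have {}xgt : 1 < x by rewrite lt_neqAle eq_sym x2.
    have -> : s = -1 by rewrite /s ltr0_sg// subr_lt0.
    near=> t; rewrite ltr0_norm; first by ring.
    by rewrite subr_lt0; near: t; exact: lt_nbhsr.
near=> t.
transitivity ((s + - s * t) `^ (a + 1) * (1 + 1 * t) `^ (b + 1)); first by [].
rewrite /weight mul1r; congr (_ `^ _ * _).
by apply/esym; near: t.
Unshelve. all: by end_near.
Qed.

(** The function w := weight * y tends to 0 at 1 and has derivative
weight * f / eta, where eta > 0 on the left of 1 and eta < 0 on its right.  In
both cases w increases from x0 towards 1, so a positive value at x0 would
contradict the limit. *)
Lemma stein_le0 a b f y x0 : -1 < a -> -1 < b -> solves_right a b f y ->
  -1 < x0 -> x0 != 1 ->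
  (forall t, (x0 <= t < 1) || (1 < t <= x0) -> 0 <= f t) -> y x0 <= 0.
Proof.
move=> a1 b1 [ode lim0] x0N1 x0n1 f0; rewrite leNgt; apply/negP => y0.
pose w : R -> R := weight a b * y.
have w_der (t : R) : -1 < t -> t != 1 ->
    is_derive t 1 w (weight a b t * f t / stein_eta t).
  move=> t1 t2; have [dy <-] := ode t t1 t2.
  have Dy : is_derive t 1 y (y^`()%classic t) by rewrite derive1E; exact/derivableP.
  have := is_deriveM (is_derive_weight a b t1 t2) Dy.
  move=> H; apply: is_derive_eq H _.
  rewrite /GRing.scale /=; field.
  exact: stein_eta_neq0.
have wE (t : R) : -1 < t -> t != 1 ->
    derivable w t 1 /\ w^`()%classic t = weight a b t * f t / stein_eta t.
  by move=> t1 t2; have D := w_der t t1 t2; split; rewrite ?derive1E //; exact: derive_val.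
have w_mono (t : R) : (x0 <= t < 1) || (1 < t <= x0) -> w x0 <= w t.
  move=> /orP[/andP[x0t t1]|/andP[t1 x0t]].
  - apply: (@ger0_derive1_le_cc _ w x0 t) => //.
    + move=> u; rewrite in_itv /= => /andP[? ?].
      by have [] := wE u ltac:(lra) ltac:(rewrite lt_eqF//; lra).
    + move=> u; rewrite in_itv /= => /andP[? ?].
      have u1 : -1 < u by lra. have un1 : u != 1 by rewrite lt_eqF//; lra.
      have [_ ->] := wE u u1 un1.
      have fu : 0 <= f u.
        by apply: f0; apply/orP; left; apply/andP; split; lra.
      rewrite divr_ge0 ?(mulr_ge0 (ltW (weight_gt0 a b u1 un1)) fu)//.
      by rewrite stein_etaE mulr_ge0; lra.
    + apply: derivable_within_continuous => u; rewrite in_itv /= => /andP[? ?].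
      by have [] := wE u ltac:(lra) ltac:(rewrite lt_eqF//; lra).
    + by rewrite in_itv /= lexx.
    + by rewrite in_itv /= lexx x0t.
  - apply: (@ler0_derive1_le_cc _ w t x0) => //.
    + move=> u; rewrite in_itv /= => /andP[? ?].
      by have [] := wE u ltac:(lra) ltac:(rewrite gt_eqF//; lra).
    + move=> u; rewrite in_itv /= => /andP[? ?].
      have u1 : -1 < u by lra. have un1 : u != 1 by rewrite gt_eqF//; lra.
      have [_ ->] := wE u u1 un1.
      have fu : 0 <= f u.
        by apply: f0; apply/orP; right; apply/andP; split; lra.
      rewrite mulr_ge0_le0 ?(mulr_ge0 (ltW (weight_gt0 a b u1 un1)) fu)//.
      by rewrite invr_le0 stein_etaE mulr_le0_ge0; lra.
    + apply: derivable_within_continuous => u; rewrite in_itv /= => /andP[? ?].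
      by have [] := wE u ltac:(lra) ltac:(rewrite gt_eqF//; lra).
    + by rewrite in_itv /= lexx x0t.
    + by rewrite in_itv /= lexx.
(* An upper bound for the regular factor of the weight between x0 and 1. *)
pose M : R := (2 + `|x0|) `^ (b + 1).
have M0 : 0 < M by rewrite powR_gt0// ltr_wpDr.
have w0 : 0 < w x0 by rewrite mulr_gt0// weight_gt0.
have e0 : 0 < w x0 / M by rewrite divr_gt0.
have /cvgrPdist_lt/(_ _ e0) limr := cvg_dnbhs_at_right lim0.
have /cvgrPdist_lt/(_ _ e0) liml := cvg_dnbhs_at_left lim0.
suff [t [tb]] : exists t, (x0 <= t < 1) || (1 < t <= x0) /\
     `|0 - `|1 - t| `^ (a + 1) * y t| < w x0 / M.
  apply/negP; rewrite -leNgt sub0r normrN ler_pdivrMr//.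
  have tN1 : -1 < t by case/orP: tb => /andP[]; lra.
  apply: (le_trans (w_mono t tb)).
  have -> : w t = (`|1 - t| `^ (a + 1) * y t) * (1 + t) `^ (b + 1).
    by rewrite /w mulrfctE /weight; ring.
  apply: (le_trans (ler_norm _)); rewrite normrM ler_wpM2l//.
  rewrite ger0_norm ?powR_ge0//; apply: ge0_ler_powR; rewrite ?nnegrE.
  - by lra.
  - by lra.
  - by rewrite addr_ge0.
  - have := ler_norm x0; case/orP: tb => /andP[? ?]; have := normr_ge0 x0; lra.
have [x01|x01] := ltP x0 1.
  near (1 : R)^'- => t; exists t; split; last by near: t.
  apply/orP; left; apply/andP; split.
    by near: t; exact: nbhs_left_ge.
  by near: t; exact: nbhs_left_lt.
have {}x01 : 1 < x0 by rewrite lt_neqAle eq_sym x0n1.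
near (1 : R)^'+ => t; exists t; split; last by near: t.
apply/orP; right; apply/andP; split.
  by near: t; exact: nbhs_right_gt.
by near: t; exact: nbhs_right_le.
Unshelve. all: by end_near.
Qed.
End Comparison.

(** * Solutions on the whole line *)

Section SolutionsOnLine.
Context {R : realType}.
Implicit Types (a b x : R) (f y : R -> R).

(** The condition at -1 is the condition at 1 for the reflected equation, in
which the two parameters are exchanged. *)
Definition solves a b f y : Prop :=
  solves_right a b f y /\
  solves_right b a (fun x => - f (- x)) (fun x => y (- x)).

Lemma solves_sym a b f y :
  solves a b f y -> solves b a (fun x => - f (- x)) (fun x => y (- x)).
Proof.
move=> [sr sl]; split=> //.
have -> : (fun x => - - f (- - x)) = f by apply/funext => x; rewrite !opprK.
by have -> : (fun x => y (- - x)) = y by apply/funext => x; rewrite opprK.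
Qed.

Lemma stein_gammaE a b x :
  stein_gamma a b x = (b + 1) * (1 - x) - (a + 1) * (1 + x).
Proof. by rewrite /stein_gamma; ring. Qed.

Lemma stein_gammaN a b x : stein_gamma a b (- x) = - stein_gamma b a x.
Proof. by rewrite !stein_gammaE; ring. Qed.

Lemma eq_fun_cvg (T : Type) (F : set_system T) (f g : T -> R) (l : R) :
  f =1 g -> f t @[t --> F] --> l -> g t @[t --> F] --> l.
Proof. by move=> /funext ->. Qed.

Lemma cvg_lin (F : set_system R) {FF : Filter F} (f g : R -> R) (l m s k : R) :
  f t @[t --> F] --> l -> g t @[t --> F] --> m ->
  (s * f t + k * g t) @[t --> F] --> (s * l + k * m : R).
Proof. by move=> fl gm; apply: cvgD; apply: cvgMl_tmp. Qed.

Lemma cvg_powR_dist (c : R) : 0 < c -> `|1 - x| `^ c @[x --> (1 : R)^'] --> (0 : R).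
Proof.
move=> c0; apply/cvgrPdist_le => e e0.
have d0 : 0 < e `^ c^-1 by rewrite powR_gt0.
have near_lt : \forall x \near (1 : R)^', `|1 - x| < e `^ c^-1.
  apply: nbhs_dnbhs; exact: (nbhsx_ballx (1 : R) (e `^ c^-1)).
apply: filterS near_lt => x xlt.
rewrite sub0r normrN ger0_norm ?powR_ge0//.
have -> : e = (e `^ c^-1) `^ c by rewrite -powRrM mulVf ?gt_eqF// powRr1 ?ltW.
by apply: ge0_ler_powR; rewrite ?nnegrE ?powR_ge0 ?(ltW xlt) ?(ltW c0).
Qed.

(** A constant k solves the equation with right-hand side k gamma.  All
estimates below choose s = 1 or s = -1 and a suitable k before comparing. *)
Lemma solves_right_affine a b f y (s k : R) : -1 < a ->
  solves_right a b f y ->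
  solves_right a b (fun x => s * f x + k * stein_gamma a b x)
    (fun x => s * y x + k).
Proof.
move=> a1 [ode lim]; split.
  move=> x x1 x2; have [dy <-] := ode x x1 x2.
  have Dy : is_derive x 1 y (y^`()%classic x).
    by rewrite derive1E; exact/derivableP.
  have D : is_derive x 1 (fun x => s * y x + k) (s * y^`()%classic x).
    have := is_deriveD (is_deriveZ s Dy) (is_derive_cst k x 1).
    by rewrite addr0.
  split; first exact: ex_derive.
  by rewrite derive1E (derive_val (is_derive := D)); ring.
have a10 : 0 < a + 1 by lra.
have := cvg_lin (s := s) (k := k) lim (cvg_powR_dist a10).
rewrite !mulr0 addr0 => /(_ _) H; apply: (eq_fun_cvg _ H) => x; ring.
Qed.

Lemma solves_affine a b f y (s k : R) : -1 < a -> -1 < b ->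
  solves a b f y ->
  solves a b (fun x => s * f x + k * stein_gamma a b x)
    (fun x => s * y x + k).
Proof.
move=> a1 b1 [sr sl]; split; first exact: solves_right_affine.
have := solves_right_affine s k b1 sl.
congr solves_right; apply/funext => x.
by rewrite stein_gammaN; ring.
Qed.

(** For x at least 1 minus this width, gamma is at most - (a + 1) (1 + x) / 2,
hence bounded away from 0; the width is less than 1/2, so that the region
stays away from -1. *)
Definition near_width a b : R := (a + 1) / (2 * (a + b + 2)).

Lemma near_width_gt0 a b : -1 < a -> -1 < b -> 0 < near_width a b.
Proof. by move=> a1 b1; rewrite divr_gt0//; lra. Qed.

Lemma near_width_lt a b : -1 < a -> -1 < b -> near_width a b < 1 / 2.
Proof. by move=> a1 b1; rewrite ltr_pdivrMr; lra. Qed.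

Lemma stein_gamma_near a b x : -1 < a -> -1 < b -> 1 - near_width a b <= x ->
  stein_gamma a b x <= - ((a + 1) * (1 + x) / 2).
Proof.
move=> a1 b1 x1; rewrite stein_gammaE.
have w_lt := near_width_lt a1 b1.
have wE : near_width a b * (a + b + 2) = (a + 1) / 2.
  by rewrite /near_width; field; lra.
have : (b + 1) * (1 - x) <= (b + 1) * near_width a b by rewrite ler_wpM2l//; lra.
have : (b + 1) * near_width a b <= (a + b + 2) * near_width a b.
  by rewrite ler_wpM2r ?(ltW (near_width_gt0 a1 b1))//; lra.
rewrite [(a + b + 2) * _]mulrC wE => h1 h2.
have : (a + 1) * (1 / 2) <= (a + 1) * x by rewrite ler_wpM2l//; lra.
lra.
Qed.

(** Near 1 a constant is a supersolution: gamma is at most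
- (a + 1) (1 + x) / 2, so comparing with the constant 2 H / (a + 1) bounds y
by the sup of f between x0 and 1 alone. *)
Lemma solves_right_le a b f y x0 H : -1 < a -> -1 < b -> solves_right a b f y ->
  1 - near_width a b <= x0 -> x0 != 1 ->
  (forall t, (x0 <= t < 1) || (1 < t <= x0) -> `|f t| <= H) ->
  `|y x0| <= 2 * H / (a + 1).
Proof.
move=> a1 b1 sol x01 x0n1 fH.
have w_lt := near_width_lt a1 b1; have w_gt0 := near_width_gt0 a1 b1.
pose k := 2 * H / (a + 1).
have H0 : 0 <= H.
  apply: le_trans (fH x0 _) => //.
  by case: ltgtP x0n1 => //=; rewrite lexx ?orbT.
have sgn (s : R) : `|s| = 1 -> s * y x0 - k <= 0.
  move=> s1; apply: (stein_le0 a1 b1 (solves_right_affine s (- k) a1 sol)) => //.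
    by lra.
  move=> t tb; have t1 : 1 - near_width a b <= t by case/orP: tb => /andP[]; lra.
  have := stein_gamma_near a1 b1 t1.
  have : - H <= s * f t.
    have := fH t tb; rewrite -[`|f t|]mul1r -s1 -normrM => /(le_trans (ler_norm _)).
    have := ler_norm (- (s * f t)); rewrite normrN => h1 h2.
    have := fH t tb; rewrite -[`|f t|]mul1r -s1 -normrM; lra.
  have kE : k * (a + 1) = 2 * H by rewrite /k divfK//; lra.
  have k0 : 0 <= k by rewrite divr_ge0 ?mulr_ge0//; lra.
  move=> h1 h2.
  have : k * stein_gamma a b t <= k * - ((a + 1) * (1 + t) / 2).
    by rewrite ler_wpM2l.
  have -> : k * - ((a + 1) * (1 + t) / 2) = - ((k * (a + 1)) * (1 + t) / 2) by ring.
  rewrite kE => h3.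
  have : 0 <= H * t by rewrite mulr_ge0//; lra.
  lra.
rewrite ler_norml -/k; apply/andP; split.
  by have := sgn (-1) ltac:(by rewrite normrN1); lra.
by have := sgn 1 ltac:(by rewrite normr1); lra.
Qed.

Lemma continuous_stein_gamma a b : continuous (stein_gamma a b).
Proof.
move=> x; apply: (@continuousB _ _ _ (fun x => - (a + b + 2) * x + b) (cst a)).
  apply: (@continuousD _ _ _ (fun x => - (a + b + 2) * x) (cst b)).
    exact: mulrl_continuous.
  exact: cvg_cst.
exact: cvg_cst.
Qed.

(** After subtracting the constant that makes the right-hand side vanish at
1, the local bound shows that the solution tends to 0. *)
Lemma solves_right_cvg a b f y (f1 : R) : -1 < a -> -1 < b -> solves_right a b f y ->
  f x @[x --> (1 : R)^'] --> f1 ->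
  y x @[x --> (1 : R)^'] --> - f1 / (2 * a + 2).
Proof.
move=> a1 b1 sol f1lim.
pose k : R := f1 / (2 * a + 2).
have sol' := solves_right_affine 1 k a1 sol.
have lim' : 1 * f x + k * stein_gamma a b x @[x --> (1 : R)^'] --> (0 : R).
  have gcont : stein_gamma a b x @[x --> (1 : R)^'] --> - (2 * a + 2).
    apply: (@cvg_trans _ (stein_gamma a b x @[x --> (1 : R)])).
      exact: cvg_within_filter.
    have -> : - (2 * a + 2) = stein_gamma a b 1 by rewrite /stein_gamma; ring.
    exact: continuous_stein_gamma.
  have := cvg_lin (s := 1) (k := k) f1lim gcont => /(_ _).
  by have -> : 1 * f1 + k * - (2 * a + 2) = 0 by rewrite /k; field; lra.
apply/cvgrPdist_le => e e0.
have e1 : 0 < e * (a + 1) / 2 by rewrite divr_gt0 ?mulr_gt0//; lra.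
move/cvgrPdist_le/(_ _ e1) : lim' => -[d /= d0 dP].
have : \forall x \near (1 : R)^', x != 1 /\ ball (1 : R) (Num.min d (near_width a b)) x.
  near=> x; split; first by near: x; exact: nbhs_dnbhs_neq.
  near: x; apply: nbhs_dnbhs; apply: nbhsx_ballx.
  by rewrite lt_min d0 near_width_gt0.
apply: filterS => x [x1 xb].
rewrite /ball /= in xb.
move: xb; rewrite lt_min => /andP[xd xw].
have xw' : 1 - near_width a b <= x by move: xw; rewrite ltr_norml; lra.
have := solves_right_le (H := e * (a + 1) / 2) a1 b1 sol' xw' x1.
have -> : 2 * (e * (a + 1) / 2) / (a + 1) = e by field; lra.
have -> : - f1 / (2 * a + 2) - y x = - (1 * y x + k) by rewrite /k; ring.
rewrite normrN; apply => t tb.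
have tn : t != 1.
  by case/orP: tb => /andP[? ?]; [rewrite lt_eqF|rewrite gt_eqF].
have := dP t _ tn; rewrite sub0r normrN; apply.
move: xd; rewrite /ball /= !ltr_norml; case/orP: tb => /andP[? ?]; lra.
Unshelve. all: by end_near.
Qed.

(** To the left of -1 the equation is the reflected equation at - x. *)
Lemma stein_eq a b f y x : solves a b f y -> x != -1 -> x != 1 ->
  derivable y x 1 /\ stein_eta x * y^`()%classic x + stein_gamma a b x * y x = f x.
Proof.
move=> [[sr _] [sl _]] xN1 x1.
have [xgt|xlt] := ltP (-1) x; first exact: sr.
have Nx1 : -1 < - x by lra.
have Nxn1 : - x != 1 by rewrite eqr_oppLR.
have [dyN] := sl _ Nx1 Nxn1.
have yE : y = (fun t => y (- t)) \o -%R by apply/funext => t /=; rewrite opprK.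
have DN : is_derive (- x) 1 (fun t => y (- t)) ((fun t => y (- t))^`()%classic (- x)).
  by rewrite derive1E; exact/derivableP.
have D : is_derive x 1 y (- (fun t => y (- t))^`()%classic (- x)).
  rewrite {1}yE -mulrN1.
  by apply: is_derive1_comp.
have -> : y^`()%classic x = - (fun t => y (- t))^`()%classic (- x).
  by rewrite derive1E (derive_val (is_derive := D)).
rewrite stein_gammaN /stein_eta !opprK sqrrN => E; split; first exact: ex_derive.
lra.
Qed.

(** If f were negative on all of ]-1, 1[, comparing from both end points would
give y <= 0 and y >= 0 there, so that f = 0, a contradiction.  This replaces
the fact that f has mean zero. *)
Lemma solves_ex_ge0 a b f y : -1 < a -> -1 < b -> solves a b f y ->
  exists2 x, -1 < x < 1 & 0 <= f x.
Proof.
move=> a1 b1 sol; apply: contrapT => nex.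
have fneg x : -1 < x < 1 -> f x < 0.
  by move=> x1; rewrite ltNge; apply/negP => fx; apply: nex; exists x.
have y0 x : -1 < x < 1 -> y x = 0.
  move=> /andP[xN1 x1]; apply/eqP; rewrite eq_le; apply/andP; split.
  - have [_ sl] := sol.
    have : y (- - x) <= 0.
      apply: (stein_le0 b1 a1 sl); [lra|rewrite lt_eqF//; lra|].
      move=> t /orP[/andP[? ?]|/andP[? ?]]; last by lra.
      by have := fneg (- t) ltac:(apply/andP; split; lra); lra.
    by rewrite opprK.
  - have [sr _] := sol.
    have := stein_le0 a1 b1 (solves_right_affine (-1) 0 a1 sr) xN1.
    move/(_ ltac:(by rewrite lt_eqF)); rewrite mulN1r addr0 oppr_le0; apply.
    move=> t /orP[/andP[? ?]|/andP[? ?]]; last by lra.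
    by have := fneg t ltac:(apply/andP; split; lra); lra.
have [d0 E] := stein_eq sol (x := 0) ltac:(rewrite gt_eqF//; lra) ltac:(rewrite lt_eqF//; lra).
have y'0 : y^`()%classic 0 = 0.
  rewrite derive1E (@near_eq_derive _ _ _ _ (cst 0)) ?derive_cst//.
  near=> t; apply: y0; apply/andP; split.
    by near: t; apply: lt_nbhsr; lra.
  by near: t; apply: lt_nbhsl; lra.
have := fneg 0 ltac:(apply/andP; split; lra).
by rewrite -E y'0 y0 ?mulr0 ?addr0 ?ltxx//; apply/andP; split; lra.
Unshelve. all: by end_near.
Qed.

Lemma solves_ex_le0 a b f y : -1 < a -> -1 < b -> solves a b f y ->
  exists2 x, -1 < x < 1 & f x <= 0.
Proof.
move=> a1 b1 /(solves_affine (-1) 0 a1 b1) /(solves_ex_ge0 a1 b1)[x x1 fx].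
by exists x => //; lra.
Qed.

(** For a nondecreasing f the comparison applies from the side on which f is
nonnegative; outside [-1, 1] the sign of f follows from the existence of points
in ]-1, 1[ where f >= 0 and f <= 0. *)
Lemma solves_nondecreasing a b f y x : -1 < a -> -1 < b -> solves a b f y ->
  {homo f : s t / s <= t} -> x != -1 -> x != 1 -> y x <= 0.
Proof.
have right_side : forall a b f y x, -1 < a -> -1 < b -> solves a b f y ->
    {homo f : s t / s <= t} -> -1 < x -> x != 1 -> (x < 1 -> 0 <= f x) ->
    y x <= 0.
  move=> {}a {}b {}f {}y {}x a1 b1 sol fhomo xN1 x1 fx.
  have [sr _] := sol; apply: (stein_le0 a1 b1 sr) => // t.
  move=> /orP[/andP[xt t1]|/andP[? _]].
    by apply: le_trans (fx (le_lt_trans xt t1)) _; exact: fhomo.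
  have [x2 /andP[? ?] fx2] := solves_ex_ge0 a1 b1 sol.
  by apply: le_trans fx2 _; apply: fhomo; lra.
move=> a1 b1 sol fhomo xN1 x1.
have sol' := solves_sym sol.
have fhomo' : {homo (fun t => - f (- t)) : s t / s <= t}.
  by move=> s t st; rewrite lerN2; apply: fhomo; rewrite lerN2.
have Nx1 : - x != 1 by rewrite eqr_oppLR.
rewrite -[x]opprK.
have [xgt|xlt] := ltP (-1) x; last first.
  apply: right_side sol' fhomo' _ Nx1 _ => //; last by lra.
  by rewrite ltrNr opprK (le_lt_trans xlt)//; lra.
have [fx|fx] := leP 0 (f x).
  by rewrite opprK; apply: right_side sol fhomo _ x1 _ => //.
have [xlt1|xge1] := ltP x 1.
  apply: right_side sol' fhomo' _ Nx1 _ => //; first by lra.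
  by rewrite opprK; lra.
rewrite opprK; apply: right_side sol fhomo xgt x1 _ => //; lra.
Qed.

(** K.-lipschitz stated for two points, so that it applies directly as a
bound. *)
Definition lip (K : R) f := forall s t, `|f s - f t| <= K * `|s - t|.

Lemma lip_ge0 K f : lip K f -> 0 <= K.
Proof.
move=> /(_ 1 0); rewrite subr0 normr1 mulr1; exact: le_trans.
Qed.

(** The slope of gamma is - (a + b + 2), so s f - k gamma is nondecreasing for
k = K / (a + b + 2) and s = 1 or -1, and s y - k is nonpositive. *)
Lemma solves_lip_le a b f y K x : -1 < a -> -1 < b -> solves a b f y ->
  lip K f -> x != -1 -> x != 1 -> `|y x| <= K / (a + b + 2).
Proof.
move=> a1 b1 sol lf xN1 x1.
have K0 := lip_ge0 lf.
pose k := K / (a + b + 2).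
have kE : k * (a + b + 2) = K by rewrite /k divfK//; lra.
have sgn (s : R) : `|s| = 1 -> s * y x - k <= 0.
  move=> s1.
  apply: (solves_nondecreasing a1 b1 (solves_affine s (- k) a1 b1 sol)) => //.
  move=> u v uv; rewrite -subr_ge0.
  have -> : s * f v + - k * stein_gamma a b v - (s * f u + - k * stein_gamma a b u) =
     s * (f v - f u) + k * (a + b + 2) * (v - u) by rewrite /stein_gamma; ring.
  have := lf v u; rewrite kE (ger0_norm (x := v - u)) ?subr_ge0//.
  rewrite -[X in X <= _]mul1r -s1 -normrM => h.
  have := ler_norm (- (s * (f v - f u))); rewrite normrN; lra.
rewrite ler_norml -/k; apply/andP; split.
  by have := sgn (-1) ltac:(by rewrite normrN1); lra.
by have := sgn 1 ltac:(by rewrite normr1); lra.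
Qed.

(** A right-hand side of a solvable equation takes both signs on ]-1, 1[, so
its size is controlled by its Lipschitz constant. *)
Lemma solves_lip_rhs a b f y K x : -1 < a -> -1 < b -> solves a b f y ->
  lip K f -> `|f x| <= K * (`|x| + 1).
Proof.
move=> a1 b1 sol lf; have K0 := lip_ge0 lf.
have dist u : -1 < u < 1 -> K * `|x - u| <= K * (`|x| + 1).
  move=> u1; apply: ler_wpM2l => //; apply: (le_trans (ler_normB _ _)).
  by rewrite lerD2l ltW// ltr_norml.
have [u /dist hu fu] := solves_ex_ge0 a1 b1 sol.
have [v /dist hv fv] := solves_ex_le0 a1 b1 sol.
have := le_trans (lf x u) hu; have := le_trans (lf x v) hv.
by rewrite !ler_norml => /andP[? ?] /andP[? ?]; apply/andP; split; lra.
Qed.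

(** The constant of the derivative bound near 1, on either side of it. *)
Definition near_cst a b : R :=
  let r := 2 * (a + b + 2) / (a + 1) in r * (1 + r).

(** The sum covers the neighbourhoods of 1, of -1, and the rest of ]-1, 1[,
where eta is at least the product of the two widths. *)
Definition stein_cst a b : R :=
  near_cst a b + near_cst b a + 4 / (near_width a b * near_width b a).

Lemma near_cst_ge0 a b : -1 < a -> -1 < b -> 0 <= near_cst a b.
Proof.
by move=> a1 b1; rewrite /near_cst mulr_ge0 ?addr_ge0 ?divr_ge0//; lra.
Qed.

End SolutionsOnLine.

(** * Bound on the first derivative *)

Section FirstDerivative.
Context {R : realType}.
Implicit Types (a b x : R) (f y : R -> R).

(** Fix x and put k := f x / gamma x.  Then y - k solves the equation for
f - k gamma, which vanishes at x and is Lipschitz, hence is of order |1 - x|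
between x and 1; so is y - k by the local bound.  Since
eta(x) y'(x) = - gamma(x) (y(x) - k), dividing by eta loses nothing. *)
Lemma solves_deriv_near a b f y K x : -1 < a -> -1 < b -> solves a b f y ->
  lip K f -> 1 - near_width a b <= x -> x != 1 ->
  `|y^`()%classic x| <= near_cst a b * K.
Proof.
move=> a1 b1 sol lf xw x1; have K0 := lip_ge0 lf.
have w_lt := near_width_lt a1 b1; have w_gt0 := near_width_gt0 a1 b1.
have xN1 : x != -1 by rewrite gt_eqF//; lra.
have gx := stein_gamma_near a1 b1 xw.
have gneg : stein_gamma a b x < 0.
  by apply: le_lt_trans gx _; rewrite oppr_lt0 divr_gt0// mulr_gt0//; lra.
pose k := f x / stein_gamma a b x.
have kle : `|k| <= 2 * K / (a + 1).
  rewrite /k normrM normfV ler_pdivrMr ?normr_gt0 ?lt_eqF//.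
  apply: le_trans (solves_lip_rhs x a1 b1 sol lf) _.
  rewrite (ler0_norm (ltW gneg)) (ger0_norm (x := x)); last by lra.
  have : 2 * K / (a + 1) * ((a + 1) * (1 + x) / 2) <= 2 * K / (a + 1) * - stein_gamma a b x.
    apply: ler_wpM2l; last by lra.
    by rewrite divr_ge0 ?mulr_ge0//; lra.
  have -> : 2 * K / (a + 1) * ((a + 1) * (1 + x) / 2) = K * (1 + x) by field; lra.
  by rewrite [x + 1]addrC.
(* The slope of k * gamma is at most K * r. *)
pose r := 2 * (a + b + 2) / (a + 1).
have r0 : 0 <= r by rewrite divr_ge0//; lra.
pose K' := K * (1 + r).
have lf' t : `|1 * f t + - k * stein_gamma a b t| <= K' * `|t - x|.
  have -> : 1 * f t + - k * stein_gamma a b t = (f t - f x) + k * (a + b + 2) * (t - x).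
    have fxE : f x = k * stein_gamma a b x by rewrite /k divfK// lt_eqF.
    by rewrite fxE /stein_gamma; ring.
  apply: le_trans (ler_normD _ _) _.
  have -> : K' * `|t - x| = K * `|t - x| + K * r * `|t - x| by rewrite /K'; ring.
  apply: lerD; first exact: lf.
  rewrite (normrM (k * _)) (normrM k) ler_wpM2r//.
  rewrite (ger0_norm (x := a + b + 2)); last by lra.
  have -> : K * r = 2 * K / (a + 1) * (a + b + 2) by rewrite /r; field; lra.
  by apply: ler_wpM2r => //; lra.
have ux := solves_right_le (H := K' * `|1 - x|) a1 b1
  (solves_right_affine 1 (- k) a1 sol.1) xw x1.
have {}ux : `|1 * y x - k| <= 2 * (K' * `|1 - x|) / (a + 1).
  apply: ux => t tb; apply: le_trans (lf' t) _; apply: ler_wpM2l.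
    by rewrite mulr_ge0// addr_ge0.
  case/orP: tb => /andP[? ?].
    by rewrite !ger0_norm; lra.
  by rewrite !ler0_norm; lra.
have [dy E] := stein_eq sol xN1 x1.
have etaE : `|stein_eta x| = `|1 - x| * (1 + x).
  by rewrite stein_etaE normrM (ger0_norm (x := 1 + x))//; lra.
have d0 : 0 < `|1 - x| by rewrite normr_gt0 subr_eq0 eq_sym.
have yE : stein_eta x * y^`()%classic x = - stein_gamma a b x * (1 * y x - k).
  have -> : - stein_gamma a b x * (1 * y x - k) =
     k * stein_gamma a b x - stein_gamma a b x * y x by ring.
  by rewrite /k divfK ?lt_eqF// -E; ring.
have gle : `|stein_gamma a b x| <= (a + b + 2) * (1 + x).
  rewrite ler0_norm ?(ltW gneg)// stein_gammaE.
  have : (b + 1) * (- (1 - x)) <= (b + 1) * (1 + x) by rewrite ler_wpM2l; lra.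
  by lra.
have px : 0 < `|1 - x| * (1 + x) by rewrite mulr_gt0//; lra.
rewrite -(ler_pM2l px) -etaE -normrM yE normrM normrN.
apply: (le_trans (ler_pM (normr_ge0 _) (normr_ge0 _) gle ux)).
rewrite etaE /K' /near_cst -/r le_eqVlt; apply/orP; left; apply/eqP.
by rewrite /r; field; lra.
Qed.

(** The local bound covers ]-oo, -1 + d'] and [1 - d, +oo[; in between the
equation is solved for y' and eta is bounded below. *)
Lemma solves_deriv_bound a b f y K x : -1 < a -> -1 < b -> solves a b f y ->
  lip K f -> x != -1 -> x != 1 -> `|y^`()%classic x| <= stein_cst a b * K.
Proof.
move=> a1 b1 sol lf xN1 x1; have K0 := lip_ge0 lf.
have w_gt0 := near_width_gt0 a1 b1; have w'_gt0 := near_width_gt0 b1 a1.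
have w_lt := near_width_lt a1 b1; have w'_lt := near_width_lt b1 a1.
have c1 : 0 <= near_cst a b * K by rewrite mulr_ge0// near_cst_ge0.
have c2 : 0 <= near_cst b a * K by rewrite mulr_ge0// near_cst_ge0.
have c3 : 0 <= 4 / (near_width a b * near_width b a) * K.
  by rewrite mulr_ge0// divr_ge0// mulr_ge0// ltW.
rewrite /stein_cst !mulrDl.
have [xr|xr] := leP (1 - near_width a b) x.
  by have := solves_deriv_near a1 b1 sol lf xr x1; lra.
have [dy E] := stein_eq sol xN1 x1.
have [xl|xl] := leP (1 - near_width b a) (- x).
  have sol' := solves_sym sol.
  have lf' : lip K (fun t => - f (- t)).
    by move=> s t; rewrite -opprD normrN (le_trans (lf _ _))// -opprD normrN.
  have Nx1 : - x != 1 by rewrite eqr_oppLR.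
  have := solves_deriv_near b1 a1 sol' lf' xl Nx1.
  have -> : (fun t => y (- t))^`()%classic (- x) = - y^`()%classic x.
    have Dy : is_derive (- - x) 1 y (y^`()%classic x).
      by rewrite opprK derive1E; exact/derivableP.
    have D : is_derive (- x) 1 (y \o -%R) (y^`()%classic x * -1).
      exact: is_derive1_comp.
    by rewrite derive1E (derive_val (is_derive := D)) mulrN1.
  by rewrite normrN; lra.
have eta_ge : near_width a b * near_width b a <= stein_eta x.
  by rewrite stein_etaE; apply: ler_pM; lra.
have eta_gt0 : 0 < stein_eta x by apply: lt_le_trans eta_ge; rewrite mulr_gt0.
have -> : y^`()%classic x = (f x - stein_gamma a b x * y x) / stein_eta x.
  by rewrite -E; field; rewrite gt_eqF.
rewrite normrM normfV (gtr0_norm eta_gt0).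
have : `|f x - stein_gamma a b x * y x| <= 4 * K.
  apply: (le_trans (ler_normB _ _)).
  have xle : `|x| <= 1 by rewrite ler_norml; apply/andP; split; lra.
  have : K * (`|x| + 1) <= K * 2 by rewrite ler_wpM2l//; lra.
  have := solves_lip_rhs x a1 b1 sol lf.
  have ysup := solves_lip_le a1 b1 sol lf xN1 x1.
  have gle : `|stein_gamma a b x| <= 2 * (a + b + 2).
    rewrite stein_gammaE ler_norml; move: xle; rewrite ler_norml => /andP[? ?].
    have : 0 <= (b + 1) * (1 - x) by rewrite mulr_ge0; lra.
    have : 0 <= (a + 1) * (1 + x) by rewrite mulr_ge0; lra.
    have : (b + 1) * (1 - x) <= (b + 1) * 2 by rewrite ler_wpM2l; lra.
    have : (a + 1) * (1 + x) <= (a + 1) * 2 by rewrite ler_wpM2l; lra.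
    by move=> *; apply/andP; split; lra.
  have := ler_pM (normr_ge0 _) (normr_ge0 _) gle ysup.
  have -> : 2 * (a + b + 2) * (K / (a + b + 2)) = 2 * K by field; lra.
  by rewrite normrM; lra.
move=> num.
have : `|f x - stein_gamma a b x * y x| / stein_eta x <= 4 * K / (near_width a b * near_width b a).
  apply: ler_pM => //; first by rewrite invr_ge0 ltW.
  by rewrite lef_pV2// posrE// mulr_gt0.
have cE : 4 / (near_width a b * near_width b a) * K =
    4 * K / (near_width a b * near_width b a) by ring.
by rewrite cE in c3 *; lra.
Qed.
End FirstDerivative.

(** * Lipschitz constants and derivatives across exceptional points *)

Section LipschitzEstimates.
Context {R : realType}.
Implicit Types (a b x : R) (f y : R -> R).

Lemma segment_lip f (C s t : R) : s <= t ->
  {within `[s, t], continuous f} ->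
  (forall x, s < x < t -> derivable f x 1 /\ `|f^`()%classic x| <= C) ->
  `|f t - f s| <= C * (t - s).
Proof.
move=> st cf df.
have Df x : x \in `]s, t[%R -> is_derive x 1 f (f^`()%classic x).
  by rewrite in_itv /= => /df[? _]; rewrite derive1E; exact/derivableP.
move: st; rewrite le_eqVlt => /predU1P[->|st]; first by rewrite !subrr normr0 mulr0.
have [c] := MVT st Df cf.
rewrite in_itv /= => /df[_ fc] ->.
have ts : 0 <= t - s by rewrite subr_ge0 ltW.
by rewrite normrM (ger0_norm ts) ler_wpM2r.
Qed.

(** A continuous function does not feel two exceptional points: split the
segment at -1 and 1 and apply the mean value theorem to each piece. *)
Lemma punctured_lip f (C : R) : continuous f ->
  (forall x, x != -1 -> x != 1 -> derivable f x 1 /\ `|f^`()%classic x| <= C) ->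
  lip C f.
Proof.
move=> cf df.
have inc s t : s <= t -> `|f t - f s| <= C * (t - s).
  move=> st.
  (* The truncations to [s, t] of -1 and 1. *)
  pose u := Num.max s (Num.min t (-1)); pose v := Num.max u (Num.min t 1).
  have su : s <= u by rewrite le_max lexx.
  have uv : u <= v by rewrite le_max lexx.
  have ut : u <= t by rewrite ge_max st ge_min lexx.
  have vt : v <= t by rewrite ge_max ut ge_min lexx.
  have piece p q : p <= q -> ~ (p < -1 < q) -> ~ (p < 1 < q) ->
      `|f q - f p| <= C * (q - p).
    move=> pq n1 n2; apply: segment_lip => //; first exact: continuous_subspaceT.
    move=> x xpq; apply: df; apply/eqP => xE; [apply: n1|apply: n2]; by rewrite -xE.
  have p1 : `|f u - f s| <= C * (u - s).
    by apply: piece => //; move=> /andP[h1]; rewrite /u lt_max lt_min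
      => /orP[?|/andP[? ?]]; lra.
  have p2 : `|f v - f u| <= C * (v - u).
    apply: piece => //; move=> /andP[h1 h2].
      move: h1; rewrite /u gt_max gt_min => /andP[h3 /orP[h4|]]; last by rewrite ltxx.
      by have := lt_le_trans h2 vt; lra.
    by move: h2; rewrite /v lt_max lt_min ltxx andbF orbF; lra.
  have p3 : `|f t - f v| <= C * (t - v).
    apply: piece => //; move=> /andP[h1 h2].
      move: h1; rewrite /v /u !gt_max !gt_min ltxx => /andP[/andP[h3 /orP[h4|//]] _].
      lra.
    move: h1; rewrite /v gt_max gt_min ltxx => /andP[h3 /orP[h4|//]]; lra.
  have -> : f t - f s = (f t - f v) + (f v - f u) + (f u - f s) by ring.
  apply: le_trans (ler_normD _ _) _.
  have := ler_normD (f t - f v) (f v - f u); lra.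
move=> s t; case: (leP s t) => st.
  by rewrite distrC (distrC s) (ger0_norm (x := t - s)) ?subr_ge0// inc.
by rewrite (ger0_norm (x := s - t)) ?subr_ge0 ?(ltW st)// inc// ltW.
Qed.

Lemma lip_continuous (K : R) f : lip K f -> continuous f.
Proof.
move=> lf x; apply/cvgrPdist_lt => e e0.
have K0 := lip_ge0 lf.
have d0 : 0 < e / (K + 1) by rewrite divr_gt0//; lra.
near=> t; apply: le_lt_trans (lf x t) _.
have : `|x - t| < e / (K + 1).
  by near: t; exact: (nbhsx_ballx x (e / (K + 1))).
rewrite ltr_pdivlMr; last by lra.
by have := normr_ge0 (x - t); nra.
Unshelve. all: by end_near.
Qed.

(** By the mean value theorem a difference quotient at p is a value of the
derivative at a nearby point different from p. *)
Lemma is_derive_limit f (p l : R) : {for p, continuous f} ->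
  (\forall x \near p^', derivable f x 1) ->
  f^`()%classic x @[x --> p^'] --> l -> is_derive p 1 f l.
Proof.
move=> cf df lim.
suff dl : h^-1 *: (f (h *: 1 + p) - f p) @[h --> (0 : R)^'] --> l.
  apply: DeriveDef; first by apply/cvg_ex; exists l.
  exact/cvg_lim.
apply/cvgrPdist_le => e e0.
have [d /= d0 dP] : exists2 d : R, 0 < d & forall x, `|p - x| < d -> x != p ->
    derivable f x 1 /\ `|l - f^`()%classic x| <= e.
  move/cvgrPdist_le/(_ _ e0) : lim => lim.
  have : \forall x \near p^', derivable f x 1 /\ `|l - f^`()%classic x| <= e.
    by near=> x; split; near: x.
  by move=> [d /= d0 dP]; exists d => // x xd xp; apply: (dP x).
have cfx x : `|p - x| < d -> {for x, continuous f}.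
  have [->//|xp xd] := eqVneq x p.
  apply: differentiable_continuous; apply/derivable1_diffP.
  by have [] := dP x xd xp.
have quot s t : s < t -> (forall x, s <= x <= t -> `|p - x| < d) -> (s = p \/ t = p) ->
    `|l - (f t - f s) / (t - s)| <= e.
  move=> st std sp.
  have xp x : s < x < t -> x != p.
    by move=> /andP[? ?]; case: sp => <-; [rewrite gt_eqF|rewrite lt_eqF].
  have Df x : x \in `]s, t[%R -> is_derive x 1 f (f^`()%classic x).
    rewrite in_itv /= => xst; have [] := dP x _ (xp x xst).
      by apply: std; case/andP: xst => ? ?; apply/andP; split; exact: ltW.
    by move=> ? _; rewrite derive1E; exact/derivableP.
  have cf' : {within `[s, t], continuous f}.
    apply: continuous_in_subspaceT => x; rewrite inE /= in_itv /= => xst.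
    exact/cfx/std.
  have [c] := MVT st Df cf'; rewrite in_itv /= => cst ->.
  rewrite mulfK ?subr_eq0 ?gt_eqF//.
  have [] := dP c _ (xp c cst) => //.
  by apply: std; case/andP: cst => ? ?; apply/andP; split; exact: ltW.
have near_d : \forall h \near (0 : R)^', h != 0 /\ `|h| < d.
  near=> h; split; first by near: h; exact: nbhs_dnbhs_neq.
  by near: h; exact: dnbhs0_lt.
apply: filterS near_d => h [h0 hd].
rewrite /GRing.scale /= mulr1.
have [hlt|hge] := ltP h 0.
  have := quot (h + p) p ltac:(lra) _ ltac:(by right).
  have -> : (f p - f (h + p)) / (p - (h + p)) = h^-1 * (f (h + p) - f p) by field; lra.
  apply=> x /andP[? ?]; move: hd; rewrite ltr0_norm// => ?.
  by rewrite ger0_norm; lra.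
have hgt : 0 < h by rewrite lt_neqAle eq_sym h0.
have := quot p (h + p) ltac:(lra) _ ltac:(by left).
have -> : (f (h + p) - f p) / (h + p - p) = h^-1 * (f (h + p) - f p) by field; lra.
apply=> x /andP[? ?]; move: hd; rewrite gtr0_norm// => ?.
by rewrite ler0_norm; lra.
Unshelve. all: by end_near.
Qed.
End LipschitzEstimates.

(** * The differentiated Stein equation *)

Section DifferentiatedEquation.
Context {R : realType}.
Implicit Types (a b x : R) (f y : R -> R).

Lemma is_derive_stein_eta x : is_derive x 1 (@stein_eta R) (- 2 * x).
Proof.
have D : is_derive x 1 (cst 1 - (@id R) ^+ 2) (0 - (2 * x)).
  by apply: is_derive_eq; rewrite /GRing.scale /= mulr1 expr1 mulrC -mulr_natl; ring.
have -> : @stein_eta R = cst 1 - (@id R) ^+ 2 by apply/funext => t.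
by apply: is_derive_eq; rewrite sub0r mulNr.
Qed.

Lemma is_derive_stein_gamma a b x : is_derive x 1 (stein_gamma a b) (- (a + b + 2)).
Proof.
have -> : stein_gamma a b = (- (a + b + 2)) \*: (@id R) + cst (b - a).
  by apply/funext => t; rewrite /stein_gamma -addrA.
by apply: is_derive_eq; rewrite addr0 /GRing.scale /= mulr1.
Qed.

Lemma near_punctured x : -1 < x -> x != 1 ->
  \forall t \near x, -1 < t /\ t != 1.
Proof.
move=> xN1 x1; have [xlt|xgt|xE] := ltgtP x 1; last by rewrite xE eqxx in x1.
  near=> t; split; first by near: t; exact: lt_nbhsr.
  by apply: negbT; apply: lt_eqF; near: t; exact: lt_nbhsl.
near=> t; split; first by near: t; exact: lt_nbhsr.
by apply: negbT; apply: gt_eqF; near: t; exact: lt_nbhsr.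
Unshelve. all: by end_near.
Qed.

Lemma continuous_stein_eta : continuous (@stein_eta R).
Proof.
move=> x; apply: differentiable_continuous; apply/derivable1_diffP.
exact: (ex_derive (is_derive := is_derive_stein_eta x)).
Qed.

(** Differentiating eta y' + gamma y = f, and using that eta' + gamma is the
coefficient gamma for the parameters a + 1 and b + 1.  The boundary condition
for y' follows from the one for y because eta y' = f - gamma y. *)
Lemma solves_right_deriv a b f y : -1 < a -> -1 < b -> solves_right a b f y ->
  (forall x, -1 < x -> derivable f x 1) ->
  solves_right (a + 1) (b + 1)
    (fun x => f^`()%classic x + (a + b + 2) * y x) (y^`()%classic).
Proof.
move=> a1 b1 [ode lim] df.
have y'E x : -1 < x -> x != 1 ->
    y^`()%classic x = (f x - stein_gamma a b x * y x) * (stein_eta x)^-1.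
  move=> xN1 x1; have [_ <-] := ode x xN1 x1.
  by field; exact: stein_eta_neq0.
split.
  move=> x xN1 x1; have [dy _] := ode x xN1 x1.
  have Dy : is_derive x 1 y (y^`()%classic x) by rewrite derive1E; exact/derivableP.
  have Df : is_derive x 1 f (f^`()%classic x).
    by rewrite derive1E; exact/derivableP/df.
  have eta0 := stein_eta_neq0 xN1 x1.
  have Dg := is_derive_stein_gamma a b x.
  have De := is_deriveV eta0 (is_derive_stein_eta x).
  have D := is_deriveM (is_deriveB Df (is_deriveM Dg Dy)) De.
  have {}D : is_derive x 1 (y^`()%classic)
    ((f^`()%classic x + (a + b + 2) * y x -
       stein_gamma (a + 1) (b + 1) x * y^`()%classic x) / stein_eta x).
    apply: (@near_eq_is_derive _ _ _
      (fun t => (f t - stein_gamma a b t * y t) * (stein_eta t)^-1)).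
      near=> t; apply/esym; apply: y'E; near: t.
        by apply: filterS (near_punctured xN1 x1) => t [].
      by apply: filterS (near_punctured xN1 x1) => t [].
    apply: is_derive_eq D _.
    rewrite /GRing.scale /= (y'E x xN1 x1) !fctE /stein_gamma /stein_eta.
    by field.
  split; first exact: ex_derive.
  rewrite [(y^`()%classic)^`()%classic x]derive1E (derive_val (is_derive := D)).
  by field.
have cf1 : f x @[x --> (1 : R)^'] --> f 1.
  apply: cvg_within_filter.
  by apply: differentiable_continuous; apply/derivable1_diffP; apply: df; lra.
have a10 : 0 < a + 1 by lra.
have cg1 : stein_gamma a b x @[x --> (1 : R)^'] --> stein_gamma a b 1.
  by apply: cvg_within_filter; exact: continuous_stein_gamma.
have L : `|1 - x| `^ (a + 1) * f x - stein_gamma a b x * (`|1 - x| `^ (a + 1) * y x)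
    @[x --> (1 : R)^'] --> (0 : R).
  have -> : 0 = 0 * f 1 - stein_gamma a b 1 * 0 :> R by ring.
  apply: cvgB; apply: cvgM => //; exact: cvg_powR_dist.
apply/cvgrPdist_le => e e0.
move/cvgrPdist_le/(_ _ e0) : L => L.
near=> x.
have x0 : 0 < x by near: x; apply: nbhs_dnbhs; apply: lt_nbhsr; lra.
have x1 : x != 1 by near: x; exact: nbhs_dnbhs_neq.
have xN1 : -1 < x by lra.
have Lx : `|0 - (`|1 - x| `^ (a + 1) * f x - stein_gamma a b x * (`|1 - x| `^ (a + 1) * y x))| <= e by near: x.
rewrite sub0r normrN in Lx; rewrite sub0r normrN.
apply: le_trans Lx.
have d0 : 0 < `|1 - x| by rewrite normr_gt0 subr_eq0 eq_sym.
rewrite (y'E x xN1 x1).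
have -> : `|1 - x| `^ (a + 1) * f x - stein_gamma a b x * (`|1 - x| `^ (a + 1) * y x) = `|1 - x| `^ (a + 1) * (f x - stein_gamma a b x * y x) by ring.
have -> : `|1 - x| `^ (a + 1 + 1) = `|1 - x| `^ (a + 1) * `|1 - x|.
  by rewrite powRD ?powRr1//; rewrite (gt_eqF d0) implybT.
rewrite !normrM normr_id normfV stein_etaE normrM -!mulrA ler_wpM2l//.
rewrite mulrCA invfM mulVKf ?gt_eqF//.
rewrite ler_piMr// invf_le1 ?normr_gt0//; last by apply: lt0r_neq0; lra.
by rewrite ger0_norm; lra.
Unshelve. all: by end_near.
Qed.

Lemma solves_right_continuous1 a b f y : -1 < a -> -1 < b -> solves_right a b f y ->
  continuous f -> y 1 = - f 1 / (2 * a + 2) -> {for 1, continuous y}.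
Proof.
move=> a1 b1 sr cf y1; apply/continuous_withinNx; rewrite y1.
apply: solves_right_cvg sr _ => //.
by apply/continuous_withinNx; exact: cf.
Qed.

(** At 1 and -1 the coefficient eta vanishes and the equation forces the
values of y; with them the solution is continuous on the line. *)
Definition stein_solution a b f y : Prop :=
  [/\ solves a b f y, y 1 = - f 1 / (2 * a + 2) & y (-1) = f (-1) / (2 * b + 2)].

Lemma stein_solution_sym a b f y : stein_solution a b f y ->
  stein_solution b a (fun x => - f (- x)) (fun x => y (- x)).
Proof.
by move=> [s1 s2 s3]; split; [exact: solves_sym|rewrite s3 opprK|rewrite opprK s2].
Qed.

Lemma stein_solution_continuous a b f y : -1 < a -> -1 < b ->
  stein_solution a b f y -> continuous f -> continuous y.
Proof.
move=> a1 b1 sol cf x; have [s1 s2 s3] := sol.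
have [->|x1] := eqVneq x 1.
  exact: solves_right_continuous1 s1.1 cf s2.
have [->|xN1] := eqVneq x (-1).
  have [s1' s2' _] := stein_solution_sym sol.
  have cf' : continuous (fun x => - f (- x)).
    by move=> t; apply: continuousN; apply: continuous_comp; [exact: continuousN|exact: cf].
  have c1 := solves_right_continuous1 b1 a1 s1'.1 cf' s2'.
  have -> : y = (fun t => y (- t)) \o -%R by apply/funext => t /=; rewrite opprK.
  by apply: continuous_comp; [exact: continuousN|rewrite opprK].
have [dy _] := stein_eq s1 xN1 x1.
by apply: differentiable_continuous; apply/derivable1_diffP.
Qed.

Lemma stein_solution_eq a b f y x : -1 < a -> -1 < b -> stein_solution a b f y ->
  stein_eta x * y^`()%classic x + stein_gamma a b x * y x = f x.
Proof.
move=> a1 b1 [s1 s2 s3].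
have [->|x1] := eqVneq x 1.
  by rewrite s2 /stein_eta /stein_gamma; field; lra.
have [->|xN1] := eqVneq x (-1); last by have [] := stein_eq s1 xN1 x1.
by rewrite s3 /stein_eta /stein_gamma; field; lra.
Qed.

Lemma stein_solution_lip a b f y K : -1 < a -> -1 < b -> stein_solution a b f y ->
  lip K f -> lip (stein_cst a b * K) y.
Proof.
move=> a1 b1 sol lf; have [s1 _ _] := sol; apply: punctured_lip.
  exact: stein_solution_continuous sol (lip_continuous lf).
move=> x xN1 x1; split; first by have [] := stein_eq s1 xN1 x1.
exact: solves_deriv_bound s1 lf xN1 x1.
Qed.

Lemma near_dnbhs_neq x (c : R) : \forall t \near x^', t != c.
Proof.
have [->|xc] := eqVneq x c; first exact: nbhs_dnbhs_neq.
apply: nbhs_dnbhs; have : \forall t \near x, `|x - t| < `|x - c|.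
  by apply: (nbhsx_ballx x `|x - c|); rewrite normr_gt0 subr_eq0.
by apply: filterS => t; apply: contraTneq => ->; rewrite ltxx.
Qed.

Lemma stein_solution_le a b f y K x : -1 < a -> -1 < b -> stein_solution a b f y ->
  lip K f -> `|y x| <= K / (a + b + 2).
Proof.
move=> a1 b1 sol lf; have [s1 _ _] := sol.
have cy := stein_solution_continuous a1 b1 sol (lip_continuous lf).
have cyx : `|y t| @[t --> x^'] --> `|y x|.
  by apply: cvg_norm; apply/continuous_withinNx; exact: cy.
apply: (cvgr_to_le cyx).
near=> t; apply: solves_lip_le s1 lf _ _ => //; near: t; exact: near_dnbhs_neq.
Unshelve. all: by end_near.
Qed.

Lemma derive1_opp_arg y x : derivable y (- x) 1 ->
  derivable (fun t => y (- t)) x 1 /\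
  (fun t => y (- t))^`()%classic x = - y^`()%classic (- x).
Proof.
move=> dy; have Dy : is_derive (- x) 1 y (y^`()%classic (- x)).
  by rewrite derive1E; exact/derivableP.
have D : is_derive x 1 (y \o -%R) (y^`()%classic (- x) * -1).
  exact: is_derive1_comp.
split; first exact: (ex_derive (is_derive := D)).
by rewrite derive1E (derive_val (is_derive := D)) mulrN1.
Qed.

Lemma derive1_reflect f x : derivable f (- x) 1 ->
  derivable (fun t => - f (- t)) x 1 /\
  (fun t => - f (- t))^`()%classic x = f^`()%classic (- x).
Proof.
move=> df; have [d1 d2] := derive1_opp_arg df.
have Df : is_derive x 1 (fun u => f (- u)) (- f^`()%classic (- x)).
  by rewrite -d2 derive1E; exact/derivableP.
have D := is_deriveN Df; split; first exact: (ex_derive (is_derive := D)).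
by rewrite derive1E (derive_val (is_derive := D)) opprK.
Qed.

(** The derivative solves the differentiated equation off 1 and -1, so it has
a limit at 1, and a limit of derivatives is a derivative. *)
Lemma stein_solution_derive1 a b f y : -1 < a -> -1 < b ->
  stein_solution a b f y -> (forall x, derivable f x 1) -> continuous f^`()%classic ->
  is_derive (1 : R) 1 y (- (f^`()%classic 1 + (a + b + 2) * y 1) / (2 * (a + 1) + 2)).
Proof.
move=> a1 b1 sol df cf'; have [s1 _ _] := sol.
have cf : continuous f.
  by move=> x; apply: differentiable_continuous; apply/derivable1_diffP.
have cy := stein_solution_continuous a1 b1 sol cf.
apply: is_derive_limit; first exact: cy.
  have : \forall x \near (1 : R)^', -1 < x /\ x != 1.
    near=> x; split; last by near: x; exact: nbhs_dnbhs_neq.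
    by near: x; apply: nbhs_dnbhs; apply: lt_nbhsr; lra.
  by apply: filterS => x [xN1 x1]; have [] := s1.1.1 x xN1 x1.
apply: (solves_right_cvg (a := a + 1) (b := b + 1)
  (f := fun x => f^`()%classic x + (a + b + 2) * y x)); try lra.
  by apply: solves_right_deriv s1.1 _.
apply/continuous_withinNx; apply: cvgD; first exact: cf'.
by apply: cvgMl_tmp; exact: cy.
Unshelve. all: by end_near.
Qed.

Lemma stein_solution_derivable a b f y x : -1 < a -> -1 < b ->
  stein_solution a b f y -> (forall x, derivable f x 1) -> continuous f^`()%classic ->
  derivable y x 1.
Proof.
move=> a1 b1 sol df cf'; have [s1 _ _] := sol.
have [->|x1] := eqVneq x 1.
  exact: (ex_derive (is_derive := stein_solution_derive1 a1 b1 sol df cf')).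
have [->|xN1] := eqVneq x (-1); last by have [] := stein_eq s1 xN1 x1.
pose f' := fun t => - f (- t); pose y' := fun t => y (- t).
have sol' : stein_solution b a f' y' := stein_solution_sym sol.
have f'E t : derivable f' t 1 /\ f'^`()%classic t = f^`()%classic (- t).
  exact: derive1_reflect.
have cf'' : continuous f'^`()%classic.
  have -> : f'^`()%classic = f^`()%classic \o -%R.
    by apply/funext => t; have [_ ->] := f'E t.
  by move=> t; apply: continuous_comp; [exact: continuousN|exact: cf'].
have D1 := stein_solution_derive1 b1 a1 sol' (fun t => (f'E t).1) cf''.
have dy' : derivable y' (- -1) 1 by rewrite opprK; exact: (ex_derive (is_derive := D1)).
have [] := derive1_opp_arg dy'.
by have -> : (fun t => y' (- t)) = y by apply/funext => t; rewrite /y' opprK.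
Qed.

Lemma stein_solution_deriv a b f y : -1 < a -> -1 < b ->
  stein_solution a b f y -> (forall x, derivable f x 1) -> continuous f^`()%classic ->
  stein_solution (a + 1) (b + 1)
    (fun x => f^`()%classic x + (a + b + 2) * y x) (y^`()%classic).
Proof.
move=> a1 b1 sol df cf'.
have dy x : derivable y x 1 by exact: stein_solution_derivable a1 b1 sol df cf'.
pose f' := fun t => - f (- t); pose y' := fun t => y (- t).
have sol' : stein_solution b a f' y' := stein_solution_sym sol.
have f'E t : derivable f' t 1 /\ f'^`()%classic t = f^`()%classic (- t).
  exact: derive1_reflect.
have cf'' : continuous f'^`()%classic.
  have -> : f'^`()%classic = f^`()%classic \o -%R.
    by apply/funext => t; have [_ ->] := f'E t.
  by move=> t; apply: continuous_comp; [exact: continuousN|exact: cf'].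
have D1 := stein_solution_derive1 a1 b1 sol df cf'.
have D1' := stein_solution_derive1 b1 a1 sol' (fun t => (f'E t).1) cf''.
have y'E t : y'^`()%classic t = - y^`()%classic (- t).
  by have [] := derive1_opp_arg (dy (- t)).
have [s1 _ _] := sol; have [s1' _ _] := sol'.
split; last 2 first.
- by rewrite derive1E (derive_val (is_derive := D1)).
- have : y'^`()%classic 1 = - (f'^`()%classic 1 + (b + a + 2) * y' 1) / (2 * (b + 1) + 2).
    by rewrite derive1E (derive_val (is_derive := D1')).
  rewrite y'E (f'E 1).2 /y' => /eqP; rewrite eqr_oppLR => /eqP ->.
  by rewrite [b + a]addrC; field; lra.
split; first exact: solves_right_deriv s1.1 _.
have := solves_right_deriv b1 a1 s1'.1 (fun t _ => (f'E t).1).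
move/(solves_right_affine (-1) 0 (ltac:(lra) : -1 < b + 1)).
congr solves_right; apply/funext => t.
  by rewrite (f'E t).2 /y' [b + a]addrC; ring.
by rewrite y'E; ring.
Qed.

(** The derivative solves the equation with parameters a + 1 and b + 1 and a
right-hand side of Lipschitz constant S + (a + b + 2) * stein_cst a b * K. *)
Definition stein_cst2 a b : R :=
  stein_cst (a + 1) (b + 1) * (1 + (a + b + 2) * stein_cst a b).

Lemma stein_cst_ge0 a b : -1 < a -> -1 < b -> 0 <= stein_cst a b.
Proof.
move=> a1 b1; rewrite /stein_cst !addr_ge0 ?near_cst_ge0// divr_ge0//.
by rewrite mulr_ge0// ltW// near_width_gt0.
Qed.

Lemma stein_deriv_rhs_lip a b f y K S : -1 < a -> -1 < b -> stein_solution a b f y ->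
  lip K f -> lip S f^`()%classic ->
  lip (S + (a + b + 2) * (stein_cst a b * K))
    (fun x => f^`()%classic x + (a + b + 2) * y x).
Proof.
move=> a1 b1 sol lf lf' s t.
have ly := stein_solution_lip a1 b1 sol lf.
have -> : f^`()%classic s + (a + b + 2) * y s - (f^`()%classic t + (a + b + 2) * y t) =
  (f^`()%classic s - f^`()%classic t) + (a + b + 2) * (y s - y t) by ring.
apply: le_trans (ler_normD _ _) _; rewrite (mulrDl S); apply: lerD; first exact: lf'.
rewrite normrM ger0_norm; last by lra.
by rewrite -mulrA; apply: ler_wpM2l; [lra|exact: ly].
Qed.

Lemma stein_solution_deriv_lip a b f y K S : -1 < a -> -1 < b -> stein_solution a b f y ->
  lip K f -> (forall x, derivable f x 1) -> lip S f^`()%classic ->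
  lip (stein_cst2 a b * (K + S)) y^`()%classic.
Proof.
move=> a1 b1 sol lf df lf'.
have sol' := stein_solution_deriv a1 b1 sol df (lip_continuous lf').
have := stein_solution_lip (ltac:(lra) : -1 < a + 1) (ltac:(lra) : -1 < b + 1) sol'
  (stein_deriv_rhs_lip a1 b1 sol lf lf').
move=> ly s t; apply: le_trans (ly s t) _; apply: ler_wpM2r => //.
rewrite /stein_cst2 -mulrA; apply: ler_wpM2l.
  by apply: stein_cst_ge0; lra.
have c0 := stein_cst_ge0 a1 b1; have K0 := lip_ge0 lf; have S0 := lip_ge0 lf'.
have : 0 <= (a + b + 2) * stein_cst a b * S by rewrite !mulr_ge0//; lra.
lra.
Qed.

Lemma stein_solution_twice_derivable a b f y x : -1 < a -> -1 < b ->
  stein_solution a b f y -> (forall x, derivable f x 1) -> continuous f^`()%classic ->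
  x != -1 -> x != 1 -> derivable y^`()%classic x 1.
Proof.
move=> a1 b1 sol df cf' xN1 x1.
have [s1 _ _] := stein_solution_deriv a1 b1 sol df cf'.
by have [] := stein_eq s1 xN1 x1.
Qed.
End DifferentiatedEquation.

(** * The convolution identity between Gamma and Beta integrals *)

Section BetaGamma.
Context {R : realType}.
Local Notation mu := (@lebesgue_measure R).

Lemma measurable_affine (c d : R) : measurable_fun setT (fun x : R => d + c * x : measurableTypeR R).
Proof. by apply: measurable_funD => //; apply: measurable_funM. Qed.

Lemma lebesgue_measure_affine (c d : R) (A : set R) : 0 < c -> measurable A ->
  (mu A = c%:E * mu ((fun x => (d + c * x)%R) @^-1` A))%E.
Proof.
move=> c0 mA.
have c0' : 0 <= c by exact: ltW.
pose f : measurableTypeR R -> measurableTypeR R := fun x => d + c * x.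
have mf : measurable_fun setT f := measurable_affine c d.
pose nu : {measure set (measurableTypeR R) -> \bar R} :=
  mscale (NngNum c0') (pushforward mu f).
transitivity (nu mf A) => //.
apply: lebesgue_measure_unique => // _ [[u v]] _ <-.
transitivity (c%:E * mu (f @^-1` `]u, v]%classic))%E; last by [].
have -> : f @^-1` `]u, v]%classic = `](u - d) / c, (v - d) / c]%classic.
  apply/seteqP; split => x /=; rewrite /f !in_itv /= ltr_pdivrMr// ler_pdivlMr// (mulrC x).
    by move=> /andP[? ?]; apply/andP; split; lra.
  by move=> /andP[? ?]; apply/andP; split; lra.
rewrite !lebesgue_measure_itv /= !lte_fin ltr_pM2r ?invr_gt0// ltrD2r.
case: ifP => _; last by rewrite mule0.
by rewrite -!EFinD -EFinM; congr (_%:E); field; rewrite gt_eqF.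
Qed.

Lemma ge0_integral_affine (c d : R) (f : R -> \bar R) : 0 < c ->
  measurable_fun setT f -> (forall x, 0 <= f x)%E ->
  (\int[mu]_x f x = c%:E * \int[mu]_x f (d + c * x)%R)%E.
Proof.
move=> c0 mf f0.
have c0' : 0 <= c by exact: ltW.
pose g : measurableTypeR R -> measurableTypeR R := fun x => d + c * x.
have mg : measurable_fun setT g := measurable_affine c d.
pose nu : {measure set (measurableTypeR R) -> \bar R} :=
  mscale (NngNum c0') (pushforward mu g).
transitivity (\int[nu mg]_x f x)%E.
  by apply: eq_measure_integral => A mA _; exact: lebesgue_measure_affine.
by rewrite ge0_integral_mscale//= ge0_integral_pushforward.
Qed.

(** Extending the integrand by 0 turns the product of two Gamma integrals into
a convolution over the whole line. *)
Definition gamma_kernel (c t : R) : R := t `^ c * expR (- t) * \1_`]0, +oo[ t.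
Definition beta_kernel (a b x : R) : R :=
  (1 - x) `^ a * (1 + x) `^ b * \1_`]-1, 1[ x.

Lemma gamma_kernel_ge0 c t : 0 <= gamma_kernel c t.
Proof. by rewrite /gamma_kernel !mulr_ge0 ?powR_ge0 ?expR_ge0// indicE. Qed.

Lemma beta_kernel_ge0 a b x : 0 <= beta_kernel a b x.
Proof. by rewrite /beta_kernel !mulr_ge0 ?powR_ge0// indicE. Qed.

Lemma measurable_gamma_kernel c : measurable_fun setT (gamma_kernel c).
Proof.
apply: measurable_funM; last by apply: measurable_indic.
apply: measurable_funM; first exact: measurable_powR.
by apply: measurableT_comp => //; exact: measurable_expR.
Qed.

Lemma measurable_beta_kernel a b : measurable_fun setT (beta_kernel a b).
Proof.
apply: measurable_funM; last by apply: measurable_indic.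
apply: measurable_funM.
  by apply: (measurableT_comp (@measurable_powR R a)); exact: measurable_funB.
by apply: (measurableT_comp (@measurable_powR R b)); exact: measurable_funD.
Qed.

Definition gamma_int c : \bar R := (\int[mu]_t (gamma_kernel c t)%:E)%E.
Definition beta_int a b : \bar R := (\int[mu]_x (beta_kernel a b x)%:E)%E.

(** Parametrising the segment [0, w] by [-1, 1] separates the dependence on w
from the Beta kernel. *)
Lemma gamma_kernel_scale a b w x : 0 < w ->
  gamma_kernel b (w / 2 + w / 2 * x) * gamma_kernel a (w - (w / 2 + w / 2 * x)) =
  (w / 2) `^ (a + b) * expR (- w) * beta_kernel a b x.
Proof.
move=> w0; rewrite /gamma_kernel /beta_kernel.
have w2 : 0 < w / 2 by rewrite divr_gt0.
have -> : w / 2 + w / 2 * x = w / 2 * (1 + x) by ring.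
have -> : w - w / 2 * (1 + x) = w / 2 * (1 - x) by field.
rewrite !indicE !mem_setE !in_itv /= !andbT !pmulr_rgt0//.
have [x1|x1] := ltP (-1) x; last first.
  have -> : (0 < 1 + x) = false by apply/negbTE; rewrite -leNgt; lra.
  by rewrite !mulr0 mul0r.
have [x2|x2] := ltP x 1; last first.
  have -> : (0 < 1 - x) = false by apply/negbTE; rewrite -leNgt; lra.
  by rewrite !mulr0.
have -> : 0 < 1 + x by lra.
have -> : 0 < 1 - x by lra.
have -> : - w = - (w / 2 * (1 + x)) - (w / 2 * (1 - x)) by field.
move: (w / 2) w2 => u u0.
rewrite !mulr1 !powRM; try lra.
rewrite powRD; last by rewrite (gt_eqF u0) implybT.
by rewrite expRD; ring.
Qed.

Lemma gamma_kernel_conv a b w :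
  (\int[mu]_s (gamma_kernel b s * gamma_kernel a (w - s))%:E =
   (2 `^ (- (a + b + 1)))%:E * beta_int a b * (gamma_kernel (a + b + 1) w)%:E)%E.
Proof.
have mk c : measurable_fun setT (gamma_kernel c) := measurable_gamma_kernel c.
have mk' : measurable_fun setT (fun s : R => gamma_kernel a (w - s)).
  by apply: (measurableT_comp (mk a)); exact: measurable_funB.
have [w0|w0] := ltP 0 w; last first.
  have -> : gamma_kernel (a + b + 1) w = 0.
    by rewrite /gamma_kernel indicE mem_setE in_itv /= andbT ltNge w0 mulr0.
  rewrite mule0; apply: integral0_eq => s _.
  rewrite /gamma_kernel !indicE !mem_setE !in_itv /= !andbT.
  have [s0|s0] := ltP 0 s; last by rewrite mulr0 mul0r.
  have -> : (0 < w - s) = false by apply/negbTE; rewrite -leNgt; lra.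
  by rewrite !mulr0.
have w2 : 0 < w / 2 by rewrite divr_gt0.
rewrite (ge0_integral_affine (w / 2) w2); last 2 first.
- by apply/measurable_EFinP; exact: measurable_funM.
- by move=> s; rewrite lee_fin mulr_ge0 ?gamma_kernel_ge0.
under eq_integral do rewrite gamma_kernel_scale// EFinM.
rewrite ge0_integralZl//; last 3 first.
- by apply/measurable_EFinP; exact: measurable_beta_kernel.
- by move=> s _; rewrite lee_fin beta_kernel_ge0.
- by rewrite lee_fin mulr_ge0 ?powR_ge0 ?expR_ge0.
rewrite -/(beta_int a b) muleA -EFinM muleAC -EFinM; congr (_%:E * _)%E.
rewrite /gamma_kernel indicE mem_setE in_itv /= andbT w0 mulr1.
have -> : w `^ (a + b + 1) = (2 * (w / 2)) `^ (a + b + 1) by congr (_ `^ _); field.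
move: (w / 2) w2 => u u0.
rewrite powRM ?(ltW u0)// [RHS]mulrA [X in _ = X * _]mulrA -powRD; last first.
  by rewrite pnatr_eq0 implybT.
rewrite addNr powRr0 mul1r [in RHS]powRD ?(gt_eqF u0) ?implybT//.
by rewrite powRr1 ?(ltW u0)//; ring.
Qed.

(** Write the product of the Gamma integrals as a double integral, substitute
w = s + t, and exchange the order of integration. *)
Lemma gamma_int_mul a b :
  (gamma_int b * gamma_int a =
   (2 `^ (- (a + b + 1)))%:E * beta_int a b * gamma_int (a + b + 1))%E.
Proof.
have mk c : measurable_fun setT (gamma_kernel c) := measurable_gamma_kernel c.
transitivity (\int[mu]_s \int[mu]_w (gamma_kernel b s * gamma_kernel a (w - s))%:E)%E.
  rewrite -ge0_integralZr//; last 3 first.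
  - by apply/measurable_EFinP; exact: mk.
  - by move=> s _; rewrite lee_fin gamma_kernel_ge0.
  - by apply: integral_ge0 => s _; rewrite lee_fin gamma_kernel_ge0.
  apply: eq_integral => s _.
  under [RHS]eq_integral do rewrite EFinM.
  rewrite ge0_integralZl//; last 3 first.
  - apply/measurable_EFinP; apply: (measurableT_comp (mk a)); exact: measurable_funB.
  - by move=> t _; rewrite lee_fin gamma_kernel_ge0.
  - by rewrite lee_fin gamma_kernel_ge0.
  congr (_ * _)%E.
  rewrite /gamma_int (ge0_integral_affine (- s) ltr01); last 2 first.
  - by apply/measurable_EFinP; exact: mk.
  - by move=> t; rewrite lee_fin gamma_kernel_ge0.
  rewrite mul1e; apply: eq_integral => t _.
  by rewrite mul1r addrC.
pose F (z : measurableTypeR R * measurableTypeR R) : \bar R :=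
  (gamma_kernel b z.1 * gamma_kernel a (z.2 - z.1))%:E.
have mF : measurable_fun setT F.
  apply/measurable_EFinP; apply: measurable_funM.
    by apply: (measurableT_comp (mk b)); exact: measurable_fst.
  apply: (measurableT_comp (mk a)).
  by apply: measurable_funB; [exact: measurable_snd|exact: measurable_fst].
have F0 z : (0 <= F z)%E by rewrite lee_fin mulr_ge0 ?gamma_kernel_ge0.
transitivity (\int[mu]_w \int[mu]_s F (s, w))%E.
  exact: (@fubini_tonelli _ _ _ _ _ mu mu F mF F0).
rewrite /F /=.
under eq_integral do rewrite gamma_kernel_conv.
rewrite ge0_integralZl//.
- by apply/measurable_EFinP; exact: mk.
- by move=> t _; rewrite lee_fin gamma_kernel_ge0.
- rewrite mule_ge0 ?lee_fin ?powR_ge0//.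
  by apply: integral_ge0 => s _; rewrite lee_fin beta_kernel_ge0.
Qed.
End BetaGamma.

(** * Normalisation of the Beta density *)

Section BetaNormalisation.
Context {R : realType}.
Local Notation mu := (@lebesgue_measure R).

Lemma integral_indicr (A : set R) (f : R -> R) :
  (\int[mu]_(x in A) (f x)%:E = \int[mu]_x (f x * \1_A x)%:E)%E.
Proof.
rewrite [LHS]integral_mkcond; apply: eq_integral => x _.
by rewrite patchE indicE; case: ifP => _; rewrite ?mulr1 ?mulr0.
Qed.

Lemma Rintegral_indicr (A : set R) (f : R -> R) :
  \int[mu]_(x in A) f x = \int[mu]_x (f x * \1_A x).
Proof. by rewrite /Rintegral integral_indicr. Qed.

Lemma powR_integral_segment (c u : R) : -1 < c -> 0 < u < 1 ->
  (\int[mu]_(t in `[u, 1%R]) (t `^ c)%:E <= ((c + 1)^-1)%:E)%E.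
Proof.
move=> c1 /andP[u0 u1].
pose F (t : R) := t `^ (c + 1) / (c + 1).
have c10 : 0 < c + 1 by lra.
have DF (t : R) : 0 < t -> is_derive t 1 F (t `^ c).
  move=> t0; have D := is_derive1_powR (c + 1) t0.
  have := is_deriveZ (c + 1)^-1 D.
  have -> : (c + 1)^-1 \*: (fun x : R => x `^ (c + 1)) = F.
    by apply/funext => x; rewrite /F /= mulrC.
  by move=> H; apply: is_derive_eq H _; rewrite addrK /GRing.scale /= mulKf// gt_eqF.
have cF (t : R) : 0 < t -> {for t, continuous F}.
  move=> t0; apply: differentiable_continuous; apply/derivable1_diffP.
  exact: (ex_derive (is_derive := DF t t0)).
have cp : {within `[u, 1], continuous (fun t : R => t `^ c)}.
  apply: continuous_in_subspaceT => t; rewrite inE /= in_itv /= => /andP[ut _].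
  apply: differentiable_continuous; apply/derivable1_diffP.
  exact: (ex_derive (is_derive := is_derive1_powR c (lt_le_trans u0 ut))).
rewrite (continuous_FTC2 (F := F) u1 cp).
- rewrite -EFinB lee_fin /F powR1 div1r gerBl.
  by rewrite divr_ge0 ?powR_ge0// ltW.
- split.
  + move=> t; rewrite in_itv /= => /andP[ut _].
    exact: (ex_derive (is_derive := DF t (lt_trans u0 ut))).
  + by apply: cvg_at_right_filter; exact: cF.
  + by apply: cvg_at_left_filter; exact: cF.
- move=> t; rewrite in_itv /= => /andP[ut _].
  by rewrite derive1E (derive_val (is_derive := DF t (lt_trans u0 ut))).
Qed.

(** Exhaust ]0, 1] by the segments [1/(n + 2), 1], on which the fundamental
theorem of calculus bounds the integral uniformly. *)
Lemma powR_integral01 (c : R) : -1 < c ->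
  (\int[mu]_(t in `]0%R, 1%R]) (t `^ c)%:E < +oo)%E.
Proof.
move=> c1.
pose F n : set R := `[(n%:R + 2)^-1, 1]%classic.
have Fsub n : F n `<=` `]0, 1]%classic.
  move=> t; rewrite /F /= !in_itv /= => /andP[h1 h2]; rewrite h2 andbT.
  by apply: lt_le_trans h1; rewrite invr_gt0 ltr_wpDl.
have -> : `]0%R, 1%R]%classic = \bigcup_i F i.
  apply/seteqP; split => t; last by move=> [n _ /Fsub].
  rewrite /= in_itv /= => /andP[t0 t1].
  pose n := Num.bound t^-1; exists n => //; rewrite /F /= in_itv /= t1 andbT.
  rewrite invf_ple ?posrE// ?ltr_wpDl//.
  have := archi_boundP (ltW (ltac:(by rewrite invr_gt0) : 0 < t^-1)).
  by rewrite -/n; lra.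
have nd : nondecreasing_seq F.
  move=> m n mn; rewrite subsetEset; apply: subset_itvr.
  by rewrite bnd_simp lef_pV2 ?posrE ?ltr_wpDl// lerD2r ler_nat.
have mp : measurable_fun setT (fun t : R => (t `^ c)%:E).
  by apply/measurable_EFinP; exact: measurable_powR.
have cv : (\int[mu]_(t in F i) (t `^ c)%:E @[i --> \oo] -->
    \int[mu]_(t in \bigcup_i F i) (t `^ c)%:E)%E.
  apply: ge0_nondecreasing_set_cvg_integral => //.
  - by move=> i; exact: measurable_itv.
  - by move=> i; exact: measurable_funTS.
  - by move=> i x _; rewrite lee_fin powR_ge0.
apply: (@le_lt_trans _ _ ((c + 1)^-1)%:E); last by rewrite ltry.
apply: (cvge_to_le cv); apply: nearW => n.
apply: powR_integral_segment => //; rewrite invr_gt0 ltr_wpDl//= invf_lt1//.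
by have : 0 <= n%:R :> R by []; lra.
Qed.

Lemma powR_le_expR (c t : R) (n : nat) : c <= n.+1%:R -> 1 <= t ->
  t `^ c <= 2 ^+ n.+1 * n.+1`!%:R * expR (t / 2).
Proof.
move=> cn t1.
have t0 : 0 <= t / 2 by lra.
apply: (@le_trans _ _ (t ^+ n.+1)).
  by rewrite -powR_mulrn; [exact: ler_powR|lra].
have := expR_ge1Dxn n t0.
have F0 : 0 < n.+1`!%:R :> R by rewrite ltr0n fact_gt0.
have -> : (t / 2) ^+ n.+1 = t ^+ n.+1 / 2 ^+ n.+1 by rewrite expr_div_n.
move=> h; have : t ^+ n.+1 / 2 ^+ n.+1 / n.+1`!%:R <= expR (t / 2) by lra.
rewrite ler_pdivrMr// ler_pdivrMr ?exprn_gt0// => h2.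
apply: le_trans h2 _; rewrite le_eqVlt; apply/orP; left; apply/eqP; ring.
Qed.

(** On ]0, 1] the kernel is at most t^c, and on [1, +oo[ it is at most a
multiple of an exponential density. *)
Lemma gamma_int_lty (c : R) : -1 < c -> (gamma_int c < +oo)%E.
Proof.
move=> c1.
(* An integer exponent above c, to compare with the power series of exp. *)
pose n := Num.bound `|c|.
have cn : c <= n.+1%:R.
  have := archi_boundP (normr_ge0 c); rewrite -/n => h.
  by apply: (le_trans (ler_norm c)); apply: (le_trans (ltW h)); rewrite ler_nat.
(* The last factor 2 undoes the normalisation of the exponential density of
   rate 1/2. *)
pose C : R := 2 ^+ n.+1 * n.+1`!%:R * 2.
have C0 : 0 <= C by rewrite /C mulr_ge0 // mulr_ge0 // exprn_ge0.
have mp : measurable_fun setT (fun t : R => t `^ c) by exact: measurable_powR.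
have h2 : 0 < 2^-1 :> R by rewrite invr_gt0.
have E0 (t : R) : 0 <= exponential_pdf 2^-1 t by exact: (exponential_pdf_ge0 (ltW h2)).
have mi : measurable_fun setT (fun t : R => t `^ c * \1_`]0, 1] t).
  by apply: measurable_funM => //; exact: measurable_indic.
have me : measurable_fun setT (fun t : R => C * exponential_pdf 2^-1 t).
  by apply: measurable_funM => //; exact: measurable_exponential_pdf.
apply: (@le_lt_trans _ _ (\int[mu]_t ((t `^ c * \1_`]0, 1] t)%:E + (C * exponential_pdf 2^-1 t)%:E))%E).
  apply: ge0_le_integral => //.
  - by move=> t _; rewrite lee_fin gamma_kernel_ge0.
  - by apply/measurable_EFinP; exact: measurable_gamma_kernel.
  - by apply: emeasurable_funD; apply/measurable_EFinP.
  move=> t _; rewrite -EFinD lee_fin /gamma_kernel !indicE !mem_setE !in_itv /= andbT.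
  have [t0|t0] := ltP 0 t; last by rewrite /= !mulr0 add0r mulr_ge0.
  rewrite /= mulr1.
  have [t1|t1] := leP t 1.
    rewrite mulr1; apply: (@le_trans _ _ (t `^ c)); last by rewrite lerDl mulr_ge0.
    by rewrite ler_piMr ?powR_ge0// -expR0 ler_expR; lra.
  rewrite mulr0 add0r exponential_pdfE ?(ltW t0)//.
  apply: (@le_trans _ _ (2 ^+ n.+1 * n.+1`!%:R * expR (t / 2) * expR (- t))).
    by rewrite ler_wpM2r ?expR_ge0// powR_le_expR// ltW.
  rewrite /C -mulrA -expRD.
  have -> : t / 2 + - t = - 2^-1 * t by field.
  by rewrite le_eqVlt; apply/orP; left; apply/eqP; field.
rewrite ge0_integralD//; last 4 first.
- by move=> t _; rewrite lee_fin ?mulr_ge0 ?powR_ge0 ?indicE.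
- exact/measurable_EFinP.
- by move=> t _; rewrite lee_fin mulr_ge0.
- exact/measurable_EFinP.
rewrite lte_add_pinfty//.
  by have := powR_integral01 c1; rewrite integral_indicr.
under eq_integral do rewrite EFinM.
rewrite ge0_integralZl//; last 2 first.
- by apply/measurable_EFinP; exact: measurable_exponential_pdf.
- by move=> t _; rewrite lee_fin.
by rewrite integral_exponential_pdf// mule1 ltry.
Qed.

Lemma gamma_int_gt0 (c : R) : (0 < gamma_int c)%E.
Proof.
rewrite lt0e; apply/andP; split; last first.
  by apply: integral_ge0 => t _; rewrite lee_fin gamma_kernel_ge0.
apply/eqP => G0.
have mk : measurable_fun setT (fun t => (@gamma_kernel R c t)%:E).
  by apply/measurable_EFinP; exact: measurable_gamma_kernel.
have : (\int[mu]_t `|(gamma_kernel c t)%:E|)%E = 0%E.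
  rewrite -[RHS]G0; apply: eq_integral => t _.
  by rewrite gee0_abs// lee_fin gamma_kernel_ge0.
move/(ae_eq_integral_abs mu measurableT mk) => ae0.
have {}ae0 : mu.-negligible (`]0, 1[%classic : set R).
  apply: negligibleS ae0 => t; rewrite /= in_itv /= => /andP[t0 _] /(_ I) /eqP.
  rewrite eqe /gamma_kernel indicE mem_setE in_itv /= andbT t0 mulr1.
  by rewrite gt_eqF// mulr_gt0 ?powR_gt0 ?expR_gt0.
have : mu `]0, 1[%classic = 0%E by apply: (measure_negligible _ ae0); exact: measurable_itv.
by rewrite lebesgue_measure_itv /= lte_fin ltr01 oppr0 adde0 => /eqP; rewrite eqe oner_eq0.
Qed.

Lemma GammaE (c : R) : Gamma (c + 1) = fine (gamma_int c).
Proof.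
rewrite /Gamma Rintegral_indicr addrK.
by apply: eq_Rintegral.
Qed.

Lemma Gamma_gt0 (c : R) : -1 < c -> 0 < Gamma (c + 1).
Proof. by move=> c1; rewrite GammaE fine_gt0// gamma_int_gt0 gamma_int_lty. Qed.

Lemma gamma_intE (c : R) : -1 < c -> gamma_int c = (Gamma (c + 1))%:E.
Proof.
move=> c1; rewrite GammaE fineK// ge0_fin_numE ?gamma_int_lty//.
by rewrite ltW// gamma_int_gt0.
Qed.

Lemma beta_int_ge0 (a b : R) : (0 <= beta_int a b)%E.
Proof. by apply: integral_ge0 => x _; rewrite lee_fin beta_kernel_ge0. Qed.

(** The convolution identity determines the Beta integral because the Gamma
integrals are positive and finite. *)
Lemma beta_intE (a b : R) : -1 < a -> -1 < b -> beta_int a b = ((beta_const a b)^-1)%:E.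
Proof.
move=> a1 b1; have := gamma_int_mul a b.
have ab1 : -1 < a + b + 1 by lra.
rewrite !gamma_intE//.
have -> : a + b + 1 + 1 = a + b + 2 by ring.
rewrite /beta_const.
have Ga := Gamma_gt0 a1; have Gb := Gamma_gt0 b1.
have Gab : 0 < Gamma (a + b + 2).
  by have := Gamma_gt0 ab1; have -> : a + b + 1 + 1 = a + b + 2 by ring.
have p2 : 0 < 2 `^ (a + b + 1) :> R by rewrite powR_gt0.
rewrite powRN; move: (beta_int_ge0 a b) Ga Gb Gab p2.
move: (Gamma (a + 1)) (Gamma (b + 1)) (Gamma (a + b + 2)) (2 `^ (a + b + 1)).
move=> x y z p; case: (beta_int a b) => [B| |] //= B0 x0 y0 z0 p0.
  rewrite -!EFinM => /eqP; rewrite eqe => /eqP E; congr (_%:E).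
  have -> : B = p * (p^-1 * B * z) / z by field; rewrite !gt_eqF.
  by rewrite -E invf_div; ring.
by rewrite gt0_muley ?lte_fin ?invr_gt0// gt0_mulye ?lte_fin.
Qed.

Lemma beta_const_gt0 (a b : R) : -1 < a -> -1 < b -> 0 < beta_const a b.
Proof.
move=> a1 b1; rewrite /beta_const divr_gt0//.
  have -> : a + b + 2 = (a + b + 1) + 1 by ring.
  by apply: Gamma_gt0; lra.
by rewrite !mulr_gt0 ?powR_gt0 ?Gamma_gt0.
Qed.

Lemma beta_kernel_integrable (a b : R) : -1 < a -> -1 < b ->
  mu.-integrable setT (EFin \o beta_kernel a b).
Proof.
move=> a1 b1; apply/integrableP; split.
  by apply/measurable_EFinP; exact: measurable_beta_kernel.
have -> : (\int[mu]_x `|(EFin \o beta_kernel a b) x| = beta_int a b)%E.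
  by apply: eq_integral => x _; rewrite /= ger0_norm ?beta_kernel_ge0.
by rewrite beta_intE// ltry.
Qed.

Lemma beta_densityE (a b x : R) : beta_density a b x = beta_const a b * beta_kernel a b x.
Proof. by rewrite /beta_density /beta_kernel; ring. Qed.

Lemma beta_density_integrable (a b : R) : -1 < a -> -1 < b ->
  mu.-integrable setT (EFin \o beta_density a b).
Proof.
move=> a1 b1.
have -> : EFin \o beta_density a b = (fun x => (beta_const a b)%:E * (EFin \o beta_kernel a b) x)%E.
  by apply/funext => x /=; rewrite beta_densityE EFinM.
by apply: integrableZl => //; exact: beta_kernel_integrable.
Qed.

Lemma integral_beta_density (a b : R) : -1 < a -> -1 < b ->
  \int[mu]_x beta_density a b x = 1.
Proof.
move=> a1 b1; under eq_Rintegral do rewrite beta_densityE.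
rewrite RintegralZl//; last exact: beta_kernel_integrable.
rewrite /Rintegral -/(beta_int a b) beta_intE//=.
by rewrite divff// gt_eqF// beta_const_gt0.
Qed.
End BetaNormalisation.

(** * The mean of the Beta law *)

Section BetaMean.
Context {R : realType}.
Local Notation mu := (@lebesgue_measure R).
Import HBNNSimple.

(** The Beta law is defined through its density on sets, hence the formula
holds for simple functions and passes to monotone limits. *)
Lemma ge0_integral_beta_law (a b : R) (f : R -> \bar R) :
  measurable_fun setT f -> (forall x, 0 <= f x)%E ->
  (\int[beta_law a b]_x f x = \int[mu]_x (f x * (beta_density a b x)%:E))%E.
Proof.
move=> mf f0.
have mp : measurable_fun setT (fun x => (beta_density a b x)%:E).
  by apply/measurable_EFinP; exact: measurable_beta_density.
have p0 x : (0 <= (beta_density a b x)%:E)%E by rewrite lee_fin beta_density_ge0.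
have simple (g : {nnsfun R >-> R}) :
    (\int[beta_law a b]_x (g x)%:E = \int[mu]_x ((g x)%:E * (beta_density a b x)%:E))%E.
  rewrite integralT_nnsfun sintegralE.
  under [RHS]eq_integral => x _.
    rewrite fimfunE -fsumEFin// ge0_mule_fsuml; last by move=> y; exact: nnfun_muleindic_ge0.
    over.
  rewrite ge0_integral_fsum//; last 2 first.
  - move=> y; apply: emeasurable_funM => //; apply/measurable_EFinP.
    apply: measurable_funM; [exact: measurable_cst|].
    have mA : measurable (g @^-1` [set y]) by exact: measurable_sfunP.
    exact: measurable_indic.
  - by move=> y x _; rewrite mule_ge0// nnfun_muleindic_ge0.
  apply: eq_fsbigr => y; rewrite inE => -[z _ <-].
  under [RHS]eq_integral do rewrite EFinM -muleA.
  rewrite ge0_integralZl//; last 3 first.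
  - apply: emeasurable_funM => //; apply/measurable_EFinP.
    have mA : measurable (g @^-1` [set g z]) by exact: measurable_sfunP.
    exact: measurable_indic.
  - by move=> x _; rewrite mule_ge0// lee_fin.
  - by rewrite lee_fin.
  congr (_ * _)%E; rewrite /= /beta_law [LHS]integral_mkcond.
  apply: eq_integral => x _; rewrite patchE indicE.
  by case: ifP => _; rewrite ?mul1e ?mul0e.
pose g := nnsfun_approx measurableT mf.
have mg n : measurable_fun setT (fun x => (g n x)%:E).
  by apply/measurable_EFinP.
have gm (x : R) m n : (m <= n)%N -> ((g m x)%:E <= (g n x)%:E)%E.
  by move=> mn; rewrite lee_fin; exact/lefP/nd_nnsfun_approx.
have fE x : f x = limn (fun n => (g n x)%:E).
  by apply/esym/cvg_lim => //; exact: (cvg_nnsfun_approx measurableT mf (fun x _ => f0 x)).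
transitivity (limn (fun n => \int[beta_law a b]_x (g n x)%:E)%E).
  under eq_integral do rewrite fE.
  apply: monotone_convergence => //.
  - by move=> n x _; rewrite lee_fin.
  - by move=> x _ m n; exact: gm.
transitivity (limn (fun n => \int[mu]_x ((g n x)%:E * (beta_density a b x)%:E))%E).
  by congr (limn _); apply/funext => n; exact: simple.
rewrite -monotone_convergence//.
- apply: eq_integral => x _; apply/cvg_lim => //.
  apply: cvgeZr => //.
  exact: (cvg_nnsfun_approx measurableT mf (fun x _ => f0 x)).
- by move=> n; apply: emeasurable_funM; [exact: mg|exact: mp].
- by move=> n x _; rewrite mule_ge0// lee_fin.
- by move=> x _ m n mn; apply: lee_wpmul2r; [exact: p0|exact: gm].
Qed.

Lemma beta_meanE (a b : R) (h : R -> R) : measurable_fun setT h ->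
  beta_mean a b h = \int[mu]_x (h x * beta_density a b x).
Proof.
move=> mh; rewrite /beta_mean /Rintegral; congr fine.
have mh' : measurable_fun setT (EFin \o h) by apply/measurable_EFinP.
have p0 x : 0 <= beta_density a b x := beta_density_ge0 a b x.
rewrite [LHS]integralE [RHS]integralE !ge0_integral_beta_law//; last 2 first.
- exact: measurable_funeneg.
- exact: measurable_funepos.
congr (_ - _)%E; apply: eq_integral => x _.
- rewrite !funeposE -!EFin_max -EFinM; congr (_%:E).
  by rewrite maxr_pMl// mul0r.
- rewrite !funenegE -!EFinN -!EFin_max -EFinM; congr (_%:E).
  by rewrite maxr_pMl// mul0r mulNr.
Qed.

Lemma integral_reflect (f : R -> \bar R) : measurable_fun setT f ->
  (\int[mu]_x f x = \int[mu]_x f (- x)%R)%E.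
Proof.
have pos (g : R -> \bar R) : measurable_fun setT g -> (forall x, 0 <= g x)%E ->
    (\int[mu]_x g x = \int[mu]_x g (- x)%R)%E.
  move=> mg g0.
  rewrite -(@ge0_integral_pushforward _ _ (measurableTypeR R) (measurableTypeR R) _ (-%R) _ mu setT)//.
  by apply: eq_measure_integral => A mA _; apply/esym/lebesgue_measureN.
move=> mf; rewrite [LHS]integralE [RHS]integralE.
rewrite pos; [|exact: measurable_funepos|by move=> x; exact: funepos_ge0].
rewrite [X in (_ - X)%E = _]pos; [|exact: measurable_funeneg|by move=> x; exact: funeneg_ge0].
by congr (_ - _)%E; apply: eq_integral => x _; rewrite ?funeposE ?funenegE.
Qed.

Lemma Rintegral_reflect (f : R -> R) : measurable_fun setT f ->
  \int[mu]_x f x = \int[mu]_x f (- x).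
Proof.
move=> mf; rewrite /Rintegral integral_reflect//.
exact/measurable_EFinP.
Qed.

Lemma beta_constC (a b : R) : beta_const a b = beta_const b a.
Proof.
rewrite /beta_const (addrC b a).
by move: (Gamma (a + 1)) (Gamma (b + 1)) => x y; rewrite mulrAC.
Qed.

Lemma beta_densityN (a b x : R) : beta_density a b (- x) = beta_density b a x.
Proof.
rewrite /beta_density beta_constC !indicE !mem_setE !in_itv /= opprK.
have -> : (-1 < - x < 1) = (-1 < x < 1).
  by rewrite ltrN2 ltrNl andbC.
by congr (_ * _); rewrite mulrAC.
Qed.

Lemma beta_meanN (a b : R) (h : R -> R) : measurable_fun setT h ->
  beta_mean b a (fun x => h (- x)) = beta_mean a b h.
Proof.
move=> mh.
have mh' : measurable_fun setT (fun x : R => h (- x)) by exact: measurableT_comp.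
rewrite (beta_meanE a b mh) (beta_meanE b a mh').
rewrite [RHS]Rintegral_reflect; last first.
  by apply: measurable_funM => //; exact: measurable_beta_density.
by apply: eq_Rintegral => x _; rewrite beta_densityN.
Qed.

Lemma lip_bound (K : R) (h : R -> R) x : lip K h -> `|h x| <= `|h 0| + K * `|x|.
Proof.
move=> lh; have := lh x 0; rewrite subr0 => le1.
by have := ler_normD (h x - h 0) (h 0); rewrite subrK; lra.
Qed.

Lemma lip_measurable (K : R) (h : R -> R) : lip K h -> measurable_fun setT h.
Proof. by move=> /lip_continuous; exact: continuous_measurable_fun. Qed.

Lemma lip_density_integrable (a b K : R) (h : R -> R) : -1 < a -> -1 < b ->
  lip K h -> mu.-integrable setT (EFin \o (fun x => h x * beta_density a b x)).
Proof.
move=> a1 b1 lh; have K0 := lip_ge0 lh.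
apply: (@le_integrable _ _ _ mu setT measurableT _
   (EFin \o (fun x => (`|h 0| + K) * beta_density a b x))).
- apply/measurable_EFinP; apply: measurable_funM; first exact: lip_measurable lh.
  exact: measurable_beta_density.
- move=> x _; rewrite /= lee_fin (normrM (h x)) (normrM (_ + _)).
  have M0 : 0 <= `|h 0| + K by rewrite addr_ge0.
  rewrite (ger0_norm M0) (ger0_norm (beta_density_ge0 a b x)) /beta_density indicE mem_setE in_itv /=.
  have [/andP[x1 x2]|_] := boolP (-1 < x < 1); last by rewrite !mulr0.
  apply: ler_wpM2r.
    rewrite mulr1; apply: mulr_ge0 (powR_ge0 _ _).
    exact: mulr_ge0 (ltW (beta_const_gt0 a1 b1)) (powR_ge0 _ _).
  apply: le_trans (lip_bound x lh) _; rewrite lerD2l ler_piMr//.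
  by rewrite ltW// ltr_norml x1.
- have -> : EFin \o (fun x => (`|h 0| + K) * beta_density a b x) =
      (fun x => (`|h 0| + K)%:E * (EFin \o beta_density a b) x)%E.
    by apply/funext => x /=; rewrite EFinM.
  by apply: integrableZl => //; exact: beta_density_integrable.
Qed.

Lemma lip_center (a b K : R) (h : R -> R) : lip K h -> lip K (beta_center a b h).
Proof.
move=> lh s t; rewrite /beta_center.
by have -> : h s - beta_mean a b h - (h t - beta_mean a b h) = h s - h t by ring.
Qed.

Lemma integral_beta_center (a b K : R) (h : R -> R) : -1 < a -> -1 < b -> lip K h ->
  \int[mu]_x (beta_center a b h x * beta_density a b x) = 0.
Proof.
move=> a1 b1 lh.
under eq_Rintegral do rewrite /beta_center mulrBl.
rewrite RintegralB//; last 2 first.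
- exact: lip_density_integrable lh.
- have -> : EFin \o (fun x => beta_mean a b h * beta_density a b x) =
      (fun x => (beta_mean a b h)%:E * (EFin \o beta_density a b) x)%E.
    by apply/funext => x /=; rewrite EFinM.
  by apply: integrableZl => //; exact: beta_density_integrable.
rewrite RintegralZl//; last exact: beta_density_integrable.
by rewrite integral_beta_density// mulr1 -beta_meanE ?subrr//; exact: lip_measurable lh.
Qed.

End BetaMean.

(** * The explicit solution to the right of -1 *)

Section ExplicitSolutionRight.
Context {R : realType}.
Local Notation mu := (@lebesgue_measure R).
Implicit Types (a b x K : R) (h f : R -> R).

(** The method of variation of constants: y = F / weight solves the equation
when F is a primitive of weight * f / eta. *)
Lemma quotient_ode a b f (F y : R -> R) x : -1 < x -> x != 1 ->
  is_derive x 1 F (f x * weight a b x / stein_eta x) ->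
  (\forall t \near x, y t = F t / weight a b t) ->
  derivable y x 1 /\ stein_eta x * y^`()%classic x + stein_gamma a b x * y x = f x.
Proof.
move=> xN1 x1 DF yE.
have w0 : weight a b x != 0 by rewrite gt_eqF// weight_gt0.
have e0 := stein_eta_neq0 xN1 x1.
have D := is_deriveM DF (is_deriveV w0 (is_derive_weight a b xN1 x1)).
have Dy : is_derive x 1 y ((f x - stein_gamma a b x * y x) / stein_eta x).
  apply: (@near_eq_is_derive _ _ _ (fun t => F t * (weight a b t)^-1)).
    by apply: filterS yE => t ->.
  apply: is_derive_eq D _.
  rewrite (nbhs_singleton yE) /GRing.scale /= ?fctE.
  by field; rewrite e0 w0.
split; first exact: (ex_derive (is_derive := Dy)).
by rewrite derive1E (derive_val (is_derive := Dy)); field.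
Qed.

Lemma near_eq_continuous f (g : R -> R) x :
  (\forall t \near x, f t = g t) -> {for x, continuous f} -> {for x, continuous g}.
Proof.
move=> fg; rewrite /prop_for /continuous_at (nbhs_singleton fg) => cf.
by apply: cvg_trans cf; apply: near_eq_cvg; apply: filterS fg => t ->.
Qed.

Lemma continuous_weighted a b f x : -1 < x -> x != 1 -> continuous f ->
  {for x, continuous (fun t => f t * weight a b t / stein_eta t)}.
Proof.
move=> xN1 x1 cf; apply: continuousM; last first.
  by apply: continuousV; [exact: stein_eta_neq0|exact: continuous_stein_eta].
apply: continuousM; first exact: cf.
apply: differentiable_continuous; apply/derivable1_diffP.
exact: (ex_derive (is_derive := is_derive_weight a b xN1 x1)).
Qed.

(** On ]-1, 1[ the weight is, up to the normalising constant, eta times the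
density, so that the formula for the solution is a quotient by the weight. *)
Lemma weight_inner a b x : -1 < x < 1 ->
  (1 - x ^+ 2) * beta_density a b x = beta_const a b * weight a b x.
Proof.
move=> x1; rewrite beta_densityE /beta_kernel indicE mem_setE in_itv /= x1 /weight.
case/andP: x1 => xN1 x1; rewrite gtr0_norm ?subr_gt0//.
have h1 : 0 < 1 - x by rewrite subr_gt0.
have h2 : 0 < 1 + x by lra.
rewrite !powRD ?(gt_eqF h1) ?(gt_eqF h2) ?implybT// !powRr1 ?ltW//.
by rewrite mulr1; ring.
Qed.

Lemma weight_outer a b x : 1 < x ->
  weight a b x = (x - 1) `^ (a + 1) * (1 + x) `^ (b + 1).
Proof. by move=> x1; rewrite /weight ltr0_norm ?subr_lt0// opprB. Qed.

(** To the right of 1, eta is negative: this is the origin of the minus sign in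
the third formula for the solution. *)
Lemma kernel_outer a b x : 1 < x ->
  (x - 1) `^ a * (1 + x) `^ b = - (weight a b x / stein_eta x).
Proof.
move=> x1; rewrite weight_outer// stein_etaE.
have h1 : 0 < x - 1 by rewrite subr_gt0.
have h2 : 0 < 1 + x by lra.
rewrite !powRD ?(gt_eqF h1) ?(gt_eqF h2) ?implybT// !powRr1 ?(ltW h1) ?(ltW h2)//.
by field; lra.
Qed.

(** The singularity at 1 is that of the Gamma kernel translated to 1, and the
other factors are bounded on [1, X]. *)
Lemma outer_kernel_integrable a b K f (X : R) : -1 < a -> lip K f ->
  mu.-integrable `[1, X] (EFin \o (fun t => f t * (t - 1) `^ a * (1 + t) `^ b)).
Proof.
move=> a1 lf; have K0 := lip_ge0 lf.
have mg : measurable_fun setT (fun t : R => gamma_kernel a (t - 1)).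
  by apply: (measurableT_comp (measurable_gamma_kernel a)); exact: measurable_funB.
have ig : mu.-integrable setT (EFin \o (fun t : R => gamma_kernel a (t - 1))).
  apply/integrableP; split; first exact/measurable_EFinP.
  have := gamma_int_lty a1.
  rewrite /gamma_int (ge0_integral_affine (-1) ltr01); last 2 first.
  - by apply/measurable_EFinP; exact: measurable_gamma_kernel.
  - by move=> t; rewrite lee_fin gamma_kernel_ge0.
  rewrite mul1e; congr (_ < _)%E; apply: eq_integral => t _ /=.
  by rewrite ger0_norm ?gamma_kernel_ge0// mul1r addrC.
(* M bounds the factors that are regular on [1, X].  The term + 1 in the
   dominating function accounts for t = 1, where 0 to a power is 0 or 1 while
   the Gamma kernel vanishes. *)
pose M := (`|f 0| + K * `|X|) * (1 + `|X|) `^ `|b|.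
have M0 : 0 <= M by rewrite mulr_ge0 ?powR_ge0// addr_ge0// mulr_ge0.
apply: (@le_integrable _ _ _ mu _ _ _
   (EFin \o (fun t => M * (expR X * gamma_kernel a (t - 1) + 1)))) => //.
- apply/measurable_EFinP; apply: measurable_funTS.
  apply: measurable_funM.
    apply: measurable_funM; first exact: lip_measurable lf.
    by apply: (measurableT_comp (@measurable_powR R a)); exact: measurable_funB.
  by apply: (measurableT_comp (@measurable_powR R b)); exact: measurable_funD.
- move=> t; rewrite /= in_itv /= => /andP[t1 tX]; rewrite lee_fin.
  have g0 := gamma_kernel_ge0 a (t - 1).
  have B0 : 0 <= expR X * gamma_kernel a (t - 1) + 1.
    by rewrite addr_ge0// mulr_ge0// expR_ge0.
  rewrite (ger0_norm (mulr_ge0 M0 B0)) !normrM.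
  rewrite (ger0_norm (powR_ge0 (t - 1) a)) (ger0_norm (powR_ge0 (1 + t) b)).
  rewrite /M -mulrA [leRHS]mulrAC -mulrA; apply: ler_pM => //.
    by rewrite mulr_ge0 ?powR_ge0.
    apply: le_trans (lip_bound t lf) _; rewrite lerD2l ler_wpM2l//.
    by rewrite !ger0_norm; lra.
  rewrite mulrC [leRHS]mulrC; apply: ler_pM; rewrite ?powR_ge0//.
    apply: (@le_trans _ _ ((1 + t) `^ `|b|)).
      by apply: ler_powR; [lra|exact: ler_norm].
    apply: ge0_ler_powR; rewrite ?nnegrE; try lra.
      by rewrite normr_ge0.
    by rewrite addr_ge0.
    by rewrite ger0_norm; lra.
  have [t1'|t1'] := ltP 1 t; last first.
    have -> : t = 1 by apply/eqP; rewrite eq_le t1' t1.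
    rewrite subrr /powR eqxx /gamma_kernel indicE mem_setE in_itv /= ltxx /= !mulr0 add0r.
    by case: (a == 0).
  rewrite -[leLHS]addr0; apply: lerD => //.
  rewrite /gamma_kernel indicE mem_setE in_itv /= andbT subr_gt0 t1' mulr1.
  rewrite mulrCA -expRD; apply: ler_peMr; first exact: powR_ge0.
  by rewrite -[leLHS]expR0 ler_expR; lra.
- have -> : EFin \o (fun t => M * (expR X * gamma_kernel a (t - 1) + 1)) =
     (fun t => M%:E * ((expR X)%:E * (EFin \o (fun t => gamma_kernel a (t - 1)%R)) t + 1))%E.
    by apply/funext => t /=; rewrite EFinM EFinD EFinM.
  apply: integrableZl => //; apply: integrableD => //.
    by apply: integrableZl => //; apply: integrableS ig.
  apply/integrableP; split => //.
  rewrite integral_cst//= normr1 mul1e lebesgue_measure_itv /=.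
  by case: ifP => _; rewrite -?EFinB ltry.
Qed.

Lemma stein_sol_inner a b h x : -1 < x < 1 -> stein_sol a b h x =
  ((beta_const a b)^-1 *
   \int[mu]_(t in `[-1, x]) (beta_center a b h t * beta_density a b t)) /
  weight a b x.
Proof.
move=> x1; have /andP[xN1 xlt] := x1.
rewrite /stein_sol ltNge (ltW xN1) /= (gt_eqF xN1) xlt weight_inner// invfM.
by rewrite mulrAC mulrC mulrA.
Qed.

Lemma stein_sol_outer a b h x : 1 < x -> stein_sol a b h x =
  - (\int[mu]_(t in `[1, x])
      (beta_center a b h t * (t - 1) `^ a * (1 + t) `^ b)) / weight a b x.
Proof.
move=> x1; have xN1 : -1 < x by lra.
rewrite /stein_sol ltNge (ltW xN1) /= (gt_eqF xN1) ltNge (ltW x1) /= (gt_eqF x1).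
by rewrite weight_outer// mulrC mulNr.
Qed.

Lemma stein_sol_ode_inner a b h K x : -1 < a -> -1 < b -> lip K h -> -1 < x < 1 ->
  derivable (stein_sol a b h) x 1 /\
  stein_eta x * (stein_sol a b h)^`()%classic x +
    stein_gamma a b x * stein_sol a b h x = beta_center a b h x.
Proof.
move=> a1 b1 lh x1; have /andP[xN1 xlt] := x1.
have xn1 : x != 1 by rewrite lt_eqF.
have lf := lip_center a b lh.
have C0 := beta_const_gt0 a1 b1.
have near_in : \forall t \near x, -1 < t < 1.
  have : x \in `]-1, 1[%R by rewrite in_itv.
  by move/near_in_itvoo; apply: filterS => t; rewrite in_itv.
have kE t : -1 < t < 1 -> beta_center a b h t * beta_density a b t =
    beta_const a b * (beta_center a b h t * weight a b t / stein_eta t).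
  move=> t1; have e0 : stein_eta t != 0.
    by apply: stein_eta_neq0; case/andP: t1 => // ? ?; rewrite lt_eqF.
  have := weight_inner a b t1; rewrite -/(stein_eta t) => E.
  have -> : beta_density a b t = beta_const a b * weight a b t / stein_eta t.
    by rewrite -E; field.
  by ring.
have cont : {for x, continuous (fun t => beta_center a b h t * beta_density a b t)}.
  apply: (@near_eq_continuous (fun t => beta_const a b *
    (beta_center a b h t * weight a b t / stein_eta t))).
    by apply: filterS near_in => t /kE ->.
  apply: (@continuousM _ _ (cst (beta_const a b))); first exact: cst_continuous.
  exact: continuous_weighted xN1 xn1 (lip_continuous lf).
have int1 : mu.-integrable `[-1, 1]
    (EFin \o (fun t => beta_center a b h t * beta_density a b t)).
  exact: integrableS (lip_density_integrable a1 b1 lf).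
have [dF F'] := continuous_FTC1_closed xlt int1 xN1 cont.
have DF := derivableP dF; rewrite -derive1E F' in DF.
apply: (@quotient_ode a b (beta_center a b h) (fun u => (beta_const a b)^-1 *
   \int[mu]_(t in `[-1, u]) (beta_center a b h t * beta_density a b t))
   (stein_sol a b h) x xN1 xn1).
  have := is_deriveZ (beta_const a b)^-1 DF => D.
  apply: is_derive_eq D _.
  by rewrite /GRing.scale /= kE// mulKf// gt_eqF.
by apply: filterS near_in => t; exact: stein_sol_inner.
Qed.

Lemma stein_sol_ode_outer a b h K x : -1 < a -> -1 < b -> lip K h -> 1 < x ->
  derivable (stein_sol a b h) x 1 /\
  stein_eta x * (stein_sol a b h)^`()%classic x +
    stein_gamma a b x * stein_sol a b h x = beta_center a b h x.
Proof.
move=> a1 b1 lh xgt.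
have xn1 : x != 1 by rewrite gt_eqF.
have xN1 : -1 < x by lra.
have lf := lip_center a b lh.
have near_in : \forall t \near x, 1 < t by exact: lt_nbhsr.
have kE t : 1 < t -> beta_center a b h t * (t - 1) `^ a * (1 + t) `^ b =
    - 1 * (beta_center a b h t * weight a b t / stein_eta t).
  by move=> t1; rewrite -mulrA kernel_outer//; ring.
have cont : {for x, continuous
    (fun t => beta_center a b h t * (t - 1) `^ a * (1 + t) `^ b)}.
  apply: (@near_eq_continuous (fun t => - 1 *
    (beta_center a b h t * weight a b t / stein_eta t))).
    by apply: filterS near_in => t /kE ->.
  apply: (@continuousM _ _ (cst (- 1 : R))); first exact: cst_continuous.
  exact: continuous_weighted xN1 xn1 (lip_continuous lf).
have int1 : mu.-integrable `[1, x + 1]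
    (EFin \o (fun t => beta_center a b h t * (t - 1) `^ a * (1 + t) `^ b)).
  exact: outer_kernel_integrable lf.
have [dF F'] := continuous_FTC1_closed (ltac:(by rewrite ltrDl) : x < x + 1) int1 xgt cont.
have DF := derivableP dF; rewrite -derive1E F' in DF.
apply: (@quotient_ode a b (beta_center a b h) (fun u => -
   \int[mu]_(t in `[1, u]) (beta_center a b h t * (t - 1) `^ a * (1 + t) `^ b))
   (stein_sol a b h) x xN1 xn1).
  have := is_deriveN DF => D.
  apply: is_derive_eq D _.
  by rewrite kE// mulN1r opprK.
by apply: filterS near_in => t; exact: stein_sol_outer.
Qed.

(** For x > 0 the factor (1 + x)^(b+1) is at least 1 and can be dropped. *)
Lemma cvg0_weight a b (y : R -> R) (F : set_system R) {FF : Filter F} : -1 < b ->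
  (\forall x \near F, 0 < x) -> weight a b x * y x @[x --> F] --> (0 : R) ->
  `|1 - x| `^ (a + 1) * y x @[x --> F] --> (0 : R).
Proof.
move=> b1 pos /cvgr0Pnorm_le lim; apply/cvgr0Pnorm_le => e e0.
near=> x.
have x0 : 0 < x by near: x.
have : `|weight a b x * y x| <= e by near: x; exact: lim.
apply: le_trans; rewrite /weight !normrM ler_wpM2r// ler_peMr//.
rewrite ger0_norm ?powR_ge0//.
rewrite -[leLHS](powRr0 (1 + x)); apply: ler_powR; lra.
Unshelve. all: by end_near.
Qed.

(** On the right of 1 the boundary condition holds because the integral starts
at 1; on the left it holds because the integral of the centred function
against the density over [-1, 1] is 0. *)
Lemma stein_sol_solves_right a b h K : -1 < a -> -1 < b -> lip K h ->
  solves_right a b (beta_center a b h) (stein_sol a b h).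
Proof.
move=> a1 b1 lh; have lf := lip_center a b lh; split.
  move=> x xN1 xn1; have [xlt|xgt|xE] := ltgtP x 1; last by rewrite xE eqxx in xn1.
    by apply: stein_sol_ode_inner lh _ => //; rewrite xN1.
  exact: stein_sol_ode_outer lh xgt.
have C0 := beta_const_gt0 a1 b1.
have ltN11 : (-1 : R) < 1 by lra.
have int1 : mu.-integrable `[-1, 1]
    (EFin \o (fun t => beta_center a b h t * beta_density a b t)).
  exact: integrableS (lip_density_integrable a1 b1 lf).
have int2 : mu.-integrable `[1, 2]
    (EFin \o (fun t => beta_center a b h t * (t - 1) `^ a * (1 + t) `^ b)).
  exact: outer_kernel_integrable lf.
apply: (@cvg_at_right_left_dnbhs _ R^o).
  apply: (@cvg0_weight a b) => //.
    by near=> x; apply: (lt_trans ltr01); near: x; exact: nbhs_right_gt.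
  have := parameterized_integral_cvg_left (ltac:(lra) : (1 : R) < 2) int2.
  move/(cvg_at_right_filter)/cvgN; rewrite oppr0; apply: cvg_trans.
  apply: near_eq_cvg; near=> x.
  have x1 : 1 < x by near: x; exact: nbhs_right_gt.
  rewrite stein_sol_outer// mulrC divfK ?gt_eqF ?weight_gt0 ?gt_eqF//; lra.
apply: (@cvg0_weight a b) => //.
  by near=> x; near: x; exact: nbhs_left_gt.
have := parameterized_integral_cvg_at_left ltN11 int1.
have -> : parameterized_integral mu (-1) 1 (fun t => beta_center a b h t * beta_density a b t) = 0.
  rewrite /parameterized_integral Rintegral_indicr -[RHS](integral_beta_center a1 b1 lh).
  apply: eq_Rintegral => x _; rewrite !beta_densityE /beta_kernel !indicE !mem_setE !in_itv /=.
  have [/andP[? ?]|_] := boolP (-1 < x < 1); last by rewrite !mulr0 mul0r.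
  have -> : -1 <= x <= 1 by apply/andP; split; lra.
  by rewrite mulr1.
move=> lim; have := cvgMl_tmp (a := (beta_const a b)^-1) lim.
move=> /(_ _); rewrite mulr0; apply: cvg_trans; apply: near_eq_cvg; near=> x.
have x1 : -1 < x < 1.
  by apply/andP; split; near: x; [exact: nbhs_left_gt|exact: nbhs_left_lt].
have /andP[xN1 xlt] := x1.
by rewrite stein_sol_inner// [RHS]mulrC divfK ?gt_eqF ?weight_gt0 ?lt_eqF.
Unshelve. all: by end_near.
Qed.
End ExplicitSolutionRight.

(** * Reflection of the explicit solution *)

Section ExplicitSolution.
Context {R : realType}.
Local Notation mu := (@lebesgue_measure R).
Implicit Types (a b x K : R) (h f : R -> R).

Lemma Rintegral_itv_reflect f (u v : R) : measurable_fun setT f ->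
  \int[mu]_(t in `[u, v]) f t = \int[mu]_(t in `[- v, - u]) f (- t).
Proof.
move=> mf; rewrite [LHS]Rintegral_indicr Rintegral_reflect; last first.
  by apply: measurable_funM => //; apply: measurable_indic; exact: measurable_itv.
rewrite [RHS]Rintegral_indicr; apply: eq_Rintegral => t _.
by rewrite !indicE !mem_setE !in_itv /= lerNr (lerNl t v) andbC.
Qed.

Lemma lip_opp K h : lip K h -> lip K (fun t => h (- t)).
Proof.
by move=> lh s t; rewrite (le_trans (lh _ _))// -opprD normrN.
Qed.

Lemma beta_centerN a b h K x : lip K h ->
  beta_center b a (fun t => h (- t)) x = beta_center a b h (- x).
Proof.
by move=> lh; rewrite /beta_center beta_meanN//; exact: lip_measurable lh.
Qed.

Lemma weight_innerN a b x : -1 < x < 1 -> weight a b (- x) = weight b a x.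
Proof.
move=> /andP[? ?]; rewrite /weight opprK mulrC; congr (_ * _).
  by rewrite gtr0_norm//; lra.
by rewrite gtr0_norm//; lra.
Qed.

Lemma stein_sol_reflect_outer a b h K x : lip K h -> 1 < x ->
  stein_sol a b h (- x) = - stein_sol b a (fun t => h (- t)) x.
Proof.
move=> lh x1; have lf := lip_center a b lh.
have E : \int[mu]_(t in `[- x, -1])
      (beta_center a b h t * (1 - t) `^ a * (-1 - t) `^ b) =
    \int[mu]_(t in `[1, x])
      (beta_center b a (fun u => h (- u)) t * (t - 1) `^ b * (1 + t) `^ a).
  rewrite Rintegral_itv_reflect ?opprK; last first.
    apply: measurable_funM.
      apply: measurable_funM; first exact: lip_measurable lf.
      by apply: (measurableT_comp (@measurable_powR R a)); exact: measurable_funB.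
    by apply: (measurableT_comp (@measurable_powR R b)); exact: measurable_funB.
  apply: eq_Rintegral => t _.
  by rewrite (beta_centerN a b _ lh) !opprK mulrAC [- 1 + t]addrC.
rewrite (stein_sol_outer b a _ x1) (weight_outer b a x1).
rewrite /stein_sol ltrN2 x1 !opprK E mulNr opprK mulrC [- 1 + x]addrC.
by rewrite (mulrC ((x - 1) `^ (b + 1)) ((1 + x) `^ (a + 1))).
Qed.

(** Reflection replaces the integral over [-1, x] by one over [- x, 1], which
is the opposite of the integral over [-1, - x] by centring. *)
Lemma stein_sol_reflect_inner a b h K x : -1 < a -> -1 < b -> lip K h -> -1 < x < 1 ->
  stein_sol a b h (- x) = - stein_sol b a (fun t => h (- t)) x.
Proof.
move=> a1 b1 lh x1; have lf := lip_center a b lh.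
have x1' : -1 < - x < 1 by case/andP: x1 => ? ?; apply/andP; split; lra.
rewrite !stein_sol_inner// weight_innerN// beta_constC -mulNr -mulrN.
congr (_ * _ / _).
set F := fun t => beta_center a b h t * beta_density a b t.
have iF : mu.-integrable setT (EFin \o F) by exact: lip_density_integrable lf.
have mF : measurable_fun setT F.
  by apply/measurable_EFinP; exact: measurable_int iF.
have -> : \int[mu]_(t in `[-1, x]) (beta_center b a (fun u => h (- u)) t * beta_density b a t)
   = \int[mu]_(t in `[- x, 1]) F t.
  rewrite [RHS]Rintegral_itv_reflect// opprK; apply: eq_Rintegral => t _.
  by rewrite (beta_centerN a b _ lh) /F beta_densityN.
have -> : \int[mu]_(t in `[- x, 1]) F t = \int[mu]_(t in `]- x, 1]) F t.
  by rewrite Rintegral_itv_obnd_cbnd//; exact: integrableS iF.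
have iF' : mu.-integrable `[-1, 1] (EFin \o F) by exact: integrableS iF.
have := @Rintegral_itvB R F (BLeft (-1)) (BRight 1) (- x) iF'.
rewrite !bnd_simp; case/andP: x1' => h1 h2 /(_ (ltW h1) (ltW h2)) <-.
have -> : \int[mu]_(t in `[-1, 1]) F t = 0.
  rewrite Rintegral_indicr -[RHS](integral_beta_center a1 b1 lh).
  apply: eq_Rintegral => t _; rewrite /F !beta_densityE /beta_kernel !indicE !mem_setE !in_itv /=.
  have [/andP[? ?]|_] := boolP (-1 < t < 1); last by rewrite !mulr0 mul0r.
  have -> : -1 <= t <= 1 by apply/andP; split; lra.
  by rewrite mulr1.
by rewrite sub0r opprK.
Qed.

Lemma stein_sol1 a b h : stein_sol a b h 1 = - beta_center a b h 1 / (2 * a + 2).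
Proof.
rewrite /stein_sol; have -> : (1 : R) < -1 = false by apply/negbTE; rewrite -leNgt; lra.
have -> : (1 : R) == -1 = false by rewrite gt_eqF//; lra.
by rewrite ltxx eqxx mulNr.
Qed.

Lemma stein_solN1 a b h : stein_sol a b h (-1) = beta_center a b h (-1) / (2 * b + 2).
Proof. by rewrite /stein_sol ltxx eqxx. Qed.

Lemma stein_sol_reflect a b h K x : -1 < a -> -1 < b -> lip K h ->
  stein_sol a b h (- x) = - stein_sol b a (fun t => h (- t)) x.
Proof.
move=> a1 b1 lh.
have [xgt|xlt|->] := ltgtP x 1; last 2 first.
- exact: stein_sol_reflect_outer lh xlt.
- by rewrite stein_sol1 stein_solN1 (beta_centerN a b _ lh) mulNr opprK.
have [xlt|xgt'|->] := ltgtP x (-1); last 2 first.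
- by apply: stein_sol_reflect_inner lh _ => //; rewrite xgt'.
- rewrite opprK stein_sol1 stein_solN1 (beta_centerN a b _ lh) opprK.
  by rewrite mulNr.
have x1 : 1 < - x by lra.
have := stein_sol_reflect_outer b a (lip_opp lh) x1.
have -> : (fun t => h (- - t)) = h by apply/funext => t; rewrite opprK.
by rewrite opprK => ->; rewrite opprK.
Qed.

Theorem stein_solP a b h K : -1 < a -> -1 < b -> lip K h ->
  stein_solution a b (beta_center a b h) (stein_sol a b h).
Proof.
move=> a1 b1 lh; split; [|exact: stein_sol1|exact: stein_solN1].
split; first exact: stein_sol_solves_right lh.
have := solves_right_affine (-1) 0 b1 (stein_sol_solves_right b1 a1 (lip_opp lh)).
congr solves_right; apply/funext => x.
  by rewrite (beta_centerN a b _ lh); ring.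
by rewrite (stein_sol_reflect _ a1 b1 lh); ring.
Qed.
End ExplicitSolution.

(** * Essential suprema and Lipschitz constants *)

Section EssentialBounds.
Context {R : realType}.
Local Notation mu := (@lebesgue_measure R).
Implicit Types (f F : R -> R) (K S : R).

Lemma parameterized_integral_nonpos f (x : R) : x <= 0 ->
  \int[mu]_(t in `[0, x]) f t = 0.
Proof.
rewrite le_eqVlt => /predU1P[->|x0]; first by rewrite set_itv1 Rintegral_set1.
by rewrite set_itv_ge ?Rintegral_set0// bnd_simp -ltNge.
Qed.

(** The integral from 0 to x, where for negative x the integral of the
reflected function over [0, - x] is used. *)
Lemma continuous_primitive f : continuous f ->
  exists F : R -> R, forall x : R, is_derive x 1 F (f x).
Proof.
move=> cf.
pose I (g : R -> R) x : R := \int[mu]_(t in `[0, x]) g t.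
have ig (g : R -> R) x : continuous g -> mu.-integrable `[0, x] (EFin \o g).
  move=> cg; apply: continuous_compact_integrable; first exact: segment_compact.
  exact: continuous_subspaceT.
have DI (g : R -> R) (x : R) : continuous g -> 0 < x -> is_derive x 1 (I g) (g x).
  move=> cg x0.
  have [d e] := continuous_FTC1_closed (ltac:(by rewrite ltrDl) : x < x + 1)
    (ig g (x + 1) cg) x0 (cg x).
  by have := derivableP d; rewrite -derive1E e.
have DIneg (g : R -> R) (x : R) : x < 0 -> is_derive x 1 (I g) 0.
  move=> x0; have D0 := is_derive_cst (0 : R) x (1 : R).
  apply: near_eq_is_derive D0.
  have : \forall t \near x, t < 0 by exact: lt_nbhsl.
  by apply: filterS => t t0; rewrite /I parameterized_integral_nonpos// ltW.
pose fN := fun t => f (- t).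
have cfN : continuous fN.
  by move=> t; apply: continuous_comp; [exact: continuousN|exact: cf].
pose G x := I f x - I fN (- x).
have DIN (x : R) : x != 0 -> is_derive x 1 (fun t => I fN (- t)) (- (if x < 0 then fN (- x) else 0)).
  move=> x0; rewrite -mulrN1; apply: is_derive1_comp.
  have [xlt|xge] := ltP x 0; first by apply: DI => //; rewrite oppr_gt0.
  by apply: DIneg; rewrite oppr_lt0 lt_neqAle eq_sym x0.
have DG (x : R) : x != 0 -> is_derive x 1 G (f x).
  move=> x0; have [xlt|xgt|xE] := ltgtP x 0; last by rewrite xE eqxx in x0.
    have := is_deriveB (DIneg f x xlt) (DIN x x0).
    by rewrite xlt sub0r opprK /fN opprK.
  have := is_deriveB (DI f x cf xgt) (DIN x x0).
  by rewrite ltNge (ltW xgt) /= oppr0 subr0.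
exists G => x; have [->|x0] := eqVneq x 0; last exact: DG.
have I0 (g : R -> R) : continuous g -> I g t @[t --> (0 : R)] --> (0 : R).
  by move=> cg; exact: parameterized_integral_cvg_left ltr01 (ig g 1 cg).
apply: is_derive_limit.
- rewrite /prop_for /continuous_at.
  have G0 : G 0 = 0 - 0 :> R.
    by rewrite /G oppr0 /I !(parameterized_integral_nonpos _ (lexx 0)) subr0 addr0.
  rewrite G0.
  apply: cvgB; first exact: I0.
  have N0 : - t @[t --> (0 : R)] --> (0 : R).
    by rewrite -[X in _ --> X]oppr0; apply: cvgN; exact: cvg_id.
  exact: (cvg_comp _ _ N0 (I0 fN cfN)).
- near=> t; apply: ex_derive; apply: DG; near: t; exact: nbhs_dnbhs_neq.
- have : f t @[t --> (0 : R)^'] --> f 0 by apply/continuous_withinNx; exact: cf.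
  apply: cvg_trans; apply: near_eq_cvg; near=> t.
  have t0 : t != 0 by near: t; exact: nbhs_dnbhs_neq.
  by rewrite derive1E (derive_val (is_derive := DG t t0)).
Unshelve. all: by end_near.
Qed.

(** Lebesgue measure of the line is not 0, which is the condition under which
the L-infinity norm is the essential supremum. *)
Lemma supnormE f : supnorm f = ess_sup mu (fun x => `|(f x)%:E|%E).
Proof.
rewrite /supnorm unlock.
have mu0 : (0 < mu setT)%E by rewrite -set_itvNyy lebesgue_measure_itv lt0y.
by rewrite ifT.
Qed.

Lemma ae_imp d (T : measurableType d) (m : {measure set T -> \bar R})
    (P Q : T -> Prop) : (forall x, P x -> Q x) ->
  {ae m, forall x, P x} -> {ae m, forall x, Q x}.
Proof. by move=> PQ; apply: (@filterS _ _ (ae_filter_ringOfSetsType m)). Qed.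

Lemma supnorm_leP f S : (supnorm f <= S%:E)%E <-> {ae mu, forall x, `|f x| <= S}.
Proof.
rewrite supnormE; split => [/ess_supP|h].
  by apply: ae_imp => x /=; rewrite lee_fin.
by apply/ess_supP; apply: ae_imp h => x h /=; rewrite lee_fin.
Qed.

Lemma supnorm_ge0 f : (0 <= supnorm f)%E.
Proof. exact: Lnorm_ge0. Qed.

(** Difference quotients are bounded by K, hence so is their limit. *)
Lemma lip_derive1_le K F (x : R) : lip K F -> derivable F x 1 -> `|F^`()%classic x| <= K.
Proof.
move=> lF dF; have K0 := lip_ge0 lF.
have : `|h^-1 *: (F (h *: 1 + x) - F x)| @[h --> (0 : R)^'] --> `|F^`()%classic x|.
  by apply: cvg_norm; rewrite derive1E; exact: dF.
move/cvgr_to_le; apply.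
near=> h.
have h0 : h != 0 by near: h; exact: nbhs_dnbhs_neq.
rewrite /GRing.scale /= mulr1 normrM normfV.
rewrite mulrC ler_pdivrMr ?normr_gt0//.
by have := lF (h + x) x; rewrite addrK.
Unshelve. all: by end_near.
Qed.

(** A countable sequence of increments is what dominated convergence can use. *)
Lemma derive_harmonic F (t l : R) : is_derive t 1 F l ->
  (F (t + harmonic n) - F t) / harmonic n @[n --> \oo] --> l.
Proof.
move=> D.
have dF : derivable F t 1 by exact: (ex_derive (is_derive := D)).
have : h^-1 *: (F (h *: 1 + t) - F t) @[h --> (0 : R)^'] --> l.
  by rewrite -(derive_val (is_derive := D)); exact: dF.
have un : (forall n, (harmonic n : R) != 0) /\ (harmonic n : R) @[n --> \oo] --> (0 : R).
  by split; [move=> n; rewrite /= invr_neq0|exact: cvg_harmonic].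
move/cvgr_dnbhsP/(_ _ un); apply: cvg_trans; apply: near_eq_cvg; near=> n.
have -> : (harmonic n)%:A = harmonic n :> R by exact: mulr1.
by rewrite [harmonic n + t]addrC; exact: mulrC.
Unshelve. all: by end_near.
Qed.

(** The difference quotients D n of F are bounded by K and converge a.e. to a
function bounded by S, so the excess of their absolute value over S has
integral tending to 0.  The integral of D n over [x, y] is the increment of
the difference quotient Q n of a primitive of F, which tends to F y - F x.
Only continuous functions are integrated on the way. *)
Lemma ae_deriv_le_lip F K S : lip K F ->
  {ae mu, forall x, derivable F x 1} -> {ae mu, forall x, `|F^`()%classic x| <= S} ->
  lip S F.
Proof.
move=> lF dF F'S; have K0 := lip_ge0 lF.
have cF := lip_continuous lF.
have [P DP] := continuous_primitive cF.
suff main x y : x < y -> `|F y - F x| <= S * (y - x).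
  move=> s t; have [st|ts|->] := ltgtP s t; last by rewrite !subrr !normr0 mulr0.
    by rewrite distrC (distrC s) (gtr0_norm (x := t - s)) ?subr_gt0// main.
  by rewrite (gtr0_norm (x := s - t)) ?subr_gt0// main.
move=> xy.
pose u n : R := harmonic n.
have u0 n : 0 < u n by rewrite /u /harmonic invr_gt0.
pose D n (t : R) : R := (F (t + u n) - F t) / u n.
have cshift n : continuous (fun t : R => F (t + u n)).
  move=> t; apply: (@continuous_comp _ _ _ (fun t => t + u n) F); last exact: cF.
  by apply: continuousD; [exact: cvg_id|exact: cst_continuous].
have cD n : continuous (D n).
  move=> t; apply: (@continuousM _ _ (fun t => F (t + u n) - F t) (cst (u n)^-1)); last exact: cst_continuous.
  by apply: continuousB; [exact: cshift|exact: cF].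
have DK n t : `|D n t| <= K.
  rewrite /D normrM normfV (gtr0_norm (u0 n)) ler_pdivrMr//.
  by apply: le_trans (lF _ _) _; rewrite addrC addKr gtr0_norm.
pose E n (t : R) : R := Num.max (`|D n t| - S) 0.
have cE n : continuous (E n).
  move=> t; apply: (@continuous_max _ _ (fun t => `|D n t| - S) (cst 0)); last exact: cst_continuous.
  apply: continuousB; last exact: cst_continuous.
  by apply: continuous_comp; [exact: cD|exact: norm_continuous].
have E0 n t : 0 <= E n t by rewrite le_max lexx orbT.
have EK n t : E n t <= K + `|S|.
  rewrite ge_max addr_ge0// andbT.
  by have := DK n t; have := ler_norm (- S); rewrite normrN; lra.
have Elim : {ae mu, forall t, `[x, y]%classic t -> (E n t)%:E @[n --> \oo] --> 0%E}.
  apply: (@filterS2 _ _ (ae_filter_ringOfSetsType mu) _ _ _ _ dF F'S) => t dFt Ft _.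
  have D1 : is_derive t 1 F (F^`()%classic t) by rewrite derive1E; exact/derivableP.
  apply: cvg_EFin; first exact: nearW.
  apply/cvgr0Pnorm_le => e e0.
  move/cvgrPdist_le/(_ _ e0) : (derive_harmonic D1); apply: filterS => n Dn.
  rewrite /= ger0_norm// ge_max (ltW e0) andbT.
  have := ler_normB (F^`()%classic t) (F^`()%classic t - D n t).
  by rewrite opprB addrCA subrr addr0; rewrite /D /u in Dn *; lra.
have mE n : measurable_fun setT (fun t => (E n t)%:E).
  by apply/measurable_EFinP; exact: continuous_measurable_fun.
have ic (c : R) : mu.-integrable `[x, y] (cst c%:E).
  have := continuous_compact_integrable (f := cst c) (segment_compact (a := x) (b := y)).
  by apply; apply: continuous_subspaceT => t; exact: cst_continuous.
have [_ _ EintE] : [/\ mu.-integrable `[x, y] (cst 0%E),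
    (\int[mu]_(t in `[x, y]) `|(E n t)%:E - 0|)%E @[n --> \oo] --> 0%E &
    (\int[mu]_(t in `[x, y]) (E n t)%:E)%E @[n --> \oo] --> (\int[mu]_(t in `[x, y]) 0)%E].
  apply: (@dominated_convergence _ _ _ mu _ _ _ _ (cst (K + `|S|)%:E)) => //.
  - by move=> n; exact: (measurable_funS measurableT (@subsetT _ _) (mE n)).
  - by apply/aeW => t n _ /=; rewrite lee_fin ger0_norm.
rewrite integral0 in EintE.
pose Q n (t : R) : R := (P (t + u n) - P t) / u n.
have DQ n (t : R) : is_derive t 1 (Q n) (D n t).
  have Dsh : is_derive t 1 (fun s => P (s + u n)) (F (t + u n)).
    have Ds : is_derive t 1 (fun s : R => s + u n) 1.
      have -> : (fun s : R => s + u n) = (@id R) + cst (u n) by apply/funext.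
      by apply: is_derive_eq; rewrite addr0.
    have := @is_derive1_comp _ P (fun s => s + u n) t _ _ (DP (t + u n)) Ds.
    by rewrite mulr1.
  have := is_deriveZ (u n)^-1 (is_deriveB Dsh (DP t)).
  have -> : (u n)^-1 \*: ((fun s => P (s + u n)) - P) = Q n.
    by apply/funext => s; rewrite /Q mulrC.
  by move=> H; apply: is_derive_eq H _; rewrite /GRing.scale /= /D mulrC.
have bound n : (`|Q n y - Q n x|%:E <=
    \int[mu]_(t in `[x, y]) (E n t)%:E + (S * (y - x))%:E)%E.
  have iD : mu.-integrable `[x, y] (EFin \o D n).
    apply: continuous_compact_integrable; first exact: segment_compact.
    exact: continuous_subspaceT.
  have iE : mu.-integrable `[x, y] (EFin \o E n).
    apply: continuous_compact_integrable; first exact: segment_compact.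
    exact: continuous_subspaceT.
  have -> : (`|Q n y - Q n x|%:E = `|\int[mu]_(t in `[x, y]) (D n t)%:E|)%E.
    rewrite (continuous_FTC2 (F := Q n) xy).
    - by rewrite -EFinB.
    - exact: continuous_subspaceT.
    - have cQ (t : R) : {for t, continuous (Q n)}.
        apply: differentiable_continuous; apply/derivable1_diffP.
        exact: (ex_derive (is_derive := DQ n t)).
      split; first by move=> t _; exact: (ex_derive (is_derive := DQ n t)).
        by apply: cvg_at_right_filter; exact: cQ.
      by apply: cvg_at_left_filter; exact: cQ.
    - by move=> t _; rewrite derive1E (derive_val (is_derive := DQ n t)).
  apply: (le_trans (le_abse_integral mu (measurable_itv _) (measurable_int mu iD))).
  have -> : ((S * (y - x))%:E = \int[mu]_(t in `[x, y]) (cst S%:E t))%E.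
    by rewrite integral_cst//= lebesgue_measure_itv /= lte_fin xy -EFinB -EFinM.
  rewrite -integralD//.
  apply: ge0_le_integral => //.
  - by apply: measurableT_comp => //; exact: measurable_int iD.
  - by apply: emeasurable_funD; [exact: measurable_int iE|exact: measurable_cst].
  - move=> t _; rewrite /= -EFinD lee_fin.
    by rewrite -lerBlDr /E le_max lexx.
have lim1 : `|Q n y - Q n x|%:E @[n --> \oo] --> `|F y - F x|%:E.
  apply: cvg_EFin; first exact: nearW.
  apply: cvg_norm; apply: cvgB; exact: derive_harmonic.
have lim2 : (\int[mu]_(t in `[x, y]) (E n t)%:E + (S * (y - x))%:E)%E @[n --> \oo]
    --> (0 + (S * (y - x))%:E)%E.
  by apply: cvgeD => //; exact: cvg_cst.
have := lee_cvg_to lim1 lim2 => /(_ _ (nearW _ bound)).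
by rewrite add0e lee_fin.
Qed.

Lemma lipschitzP K f : K.-lipschitz f <-> lip K f.
Proof.
split => [lf s t|lf [s t] _ /=]; last exact: lf.
by have := lf (s, t) (conj I I).
Qed.

Lemma lipschitz_ex_lip f : lipschitz f -> exists K, lip K f.
Proof.
move=> [M [_ MP]]; exists (M + 1); apply/lipschitzP; apply: MP.
by rewrite ltrDl.
Qed.

Lemma lip_lipschitz K f : lip K f -> lipschitz f.
Proof.
move=> lf; exists K; split; first exact: num_real.
move=> M KM; apply/lipschitzP => s t; apply: le_trans (lf s t) _.
by rewrite ler_wpM2r// ltW.
Qed.

(** For two fixed points the Lipschitz inequality is closed in the constant, so
it passes to the infimum. *)
Lemma lipnormP K f : lip K f -> exists2 k : R, lipnorm f = k%:E & lip k f.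
Proof.
move=> lf; pose A := [set k%:E | k in [set k : R | k.-lipschitz f]].
have A0 : (0 <= lipnorm f)%E.
  apply: le_ereal_inf_tmp => _ [k /lipschitzP kf <-].
  by rewrite lee_fin; exact: lip_ge0 kf.
have AK : (lipnorm f <= K%:E)%E.
  by apply: ereal_inf_lbound; exists K => //; apply/lipschitzP.
have fin : lipnorm f \is a fin_num by rewrite ge0_fin_numE// (le_lt_trans AK)// ltry.
exists (fine (lipnorm f)); first by rewrite fineK.
move=> s t; have [->|st] := eqVneq s t; first by rewrite !subrr normr0 mulr0.
have d0 : 0 < `|s - t| by rewrite normr_gt0 subr_eq0.
rewrite -ler_pdivrMr// -lee_fin fineK//.
apply: le_ereal_inf_tmp => _ [k /lipschitzP kf <-].
by rewrite lee_fin ler_pdivrMr.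
Qed.

Lemma ae_off_pm1 (P : R -> Prop) : (forall x, x != -1 -> x != 1 -> P x) ->
  {ae mu, forall x, P x}.
Proof.
move=> Px; exists ([set -1] `|` [set 1]); split.
- by apply: measurableU; exact: measurable_set1.
- apply: null_set_setU; [exact: measurable_set1|exact: measurable_set1| |];
    exact: lebesgue_measure_set1.
- move=> x /= nPx; have [->|x1] := eqVneq x (-1); first by left.
  have [->|x2] := eqVneq x 1; first by right.
  by exfalso; apply: nPx; exact: Px.
Qed.

Lemma derivable_bounded_lip f : (forall x, derivable f x 1) -> bounded_fun f^`()%classic ->
  exists K, lip K f.
Proof.
move=> df [M [_ bM]]; exists (M + 1).
have cf : continuous f.
  by move=> x; apply: differentiable_continuous; apply/derivable1_diffP.
apply: punctured_lip => // x _ _; split => //.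
by apply: bM => //; rewrite ltrDl.
Qed.
End EssentialBounds.

(** * Bounds for the explicit solution *)

Section SteinFactors.
Context {R : realType}.
Local Notation mu := (@lebesgue_measure R).
Implicit Types (a b x K : R) (h f : R -> R).

(** The real numbers k and S in terms of which all later estimates are stated. *)
Lemma bounded_D2_lip h : bounded_D2 h -> exists k S : R,
  [/\ lipnorm h = k%:E, supnorm h^`(2)%classic = S%:E, lip k h,
      (forall x : R, derivable h x 1) & lip S h^`()%classic].
Proof.
move=> [h2 bh' bh''].
have dh (x : R) : derivable h x 1 by have [/nbhs_singleton] := h2 x.
have dh' (x : R) : derivable h^`()%classic x 1 by have [] := h2 x.
have [K lK] := derivable_bounded_lip dh bh'.
have [k kE lk] := lipnormP lK.
have [M lM] := derivable_bounded_lip dh' bh''.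
have SM : (supnorm h^`(2)%classic <= M%:E)%E.
  by apply/supnorm_leP; apply/aeW => x; exact: lip_derive1_le lM (dh' x).
have fin : supnorm h^`(2)%classic \is a fin_num.
  by rewrite ge0_fin_numE ?supnorm_ge0// (le_lt_trans SM)// ltry.
exists k, (fine (supnorm h^`(2)%classic)); split; rewrite ?fineK//.
apply: ae_deriv_le_lip lM _ _; first exact/aeW.
by apply/supnorm_leP; rewrite fineK.
Qed.

Lemma beta_center_deriv1 a b h : (forall x : R, derivable h x 1) ->
  (forall x : R, derivable (beta_center a b h) x 1) /\
  (beta_center a b h)^`()%classic = h^`()%classic.
Proof.
move=> dh; have D (x : R) : is_derive x 1 (beta_center a b h) (h^`()%classic x).
  have Dh : is_derive x 1 h (h^`()%classic x) by rewrite derive1E; exact/derivableP.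
  have := is_deriveB Dh (is_derive_cst (beta_mean a b h) x (1 : R)).
  by rewrite subr0.
split=> [x|]; first exact: (ex_derive (is_derive := D x)).
by apply/funext => x; rewrite derive1E (derive_val (is_derive := D x)).
Qed.

Lemma stein_sol_regular a b h (k S : R) : -1 < a -> -1 < b ->
  lip k h -> (forall x : R, derivable h x 1) -> lip S h^`()%classic ->
  let g := stein_sol a b h in
  [/\ (forall x : R, derivable g x 1),
      lip (stein_cst2 a b * (k + S)) g^`()%classic &
      (forall x : R, x != -1 -> x != 1 -> derivable g^`()%classic x 1)].
Proof.
move=> a1 b1 lk dh lS g.
have sol := stein_solP a1 b1 lk.
have [df f'E] := beta_center_deriv1 a b dh.
have lf := lip_center a b lk.
have lf' : lip S (beta_center a b h)^`()%classic by rewrite f'E.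
have cf' := lip_continuous lf'.
split.
- by move=> x; exact: stein_solution_derivable sol df cf'.
- exact: stein_solution_deriv_lip sol lf df lf'.
- by move=> x; exact: stein_solution_twice_derivable sol df cf'.
Qed.

Lemma stein_bounds_ex a b : -1 < a -> -1 < b ->
  stein_bounds a b (stein_cst a b) (stein_cst2 a b).
Proof.
move=> a1 b1; split => h.
  move=> /lipschitz_ex_lip[K /lipnormP[k kE lk]].
  have [sol _ _] := stein_solP a1 b1 lk.
  have lf := lip_center a b lk.
  split; first by apply: ae_off_pm1 => x xN1 x1; have [] := stein_eq sol xN1 x1.
  rewrite kE -EFinM; apply/supnorm_leP; apply: ae_off_pm1 => x xN1 x1.
  exact: solves_deriv_bound sol lf xN1 x1.
move=> /bounded_D2_lip[k [S [kE SE lk dh lS]]].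
have [dg lg' dg'] := stein_sol_regular a1 b1 lk dh lS.
split.
  apply: ae_off_pm1 => x xN1 x1; split; last exact: dg'.
  by near=> t; exact: dg.
rewrite kE [X in (_ + X)%E]SE.
apply/(supnorm_leP _ (stein_cst2 a b * (k + S))); apply: ae_off_pm1 => x xN1 x1.
exact: lip_derive1_le lg' (dg' x xN1 x1).
Unshelve. all: by end_near.
Qed.

(** The constants K1 and K2 only control essential suprema; regularity of the
solution, known from the explicit constants, makes these bounds pointwise.
The second derivative is only available off -1 and 1, so its bound is stated
as a Lipschitz constant of g'. *)
Lemma stein_sol_bounds a b K1 K2 h (k S : R) : -1 < a -> -1 < b ->
  stein_bounds a b K1 K2 -> bounded_D2 h ->
  lipnorm h = k%:E -> supnorm h^`(2)%classic = S%:E ->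
  let g := stein_sol a b h in
  [/\ (forall x : R, is_derive x 1 g (g^`()%classic x)),
      (forall x : R, `|g x| <= k / (a + b + 2)),
      (forall x : R, `|g^`()%classic x| <= K1 * k),
      lip (K2 * (k + S)) g^`()%classic &
      (forall x : R, stein_eta x * g^`()%classic x + stein_gamma a b x * g x =
         beta_center a b h x)].
Proof.
move=> a1 b1 [B1 B2] hD2 kE SE g.
have [k' [S' [kE' SE' lk dh lS]]] := bounded_D2_lip hD2.
have kk : k' = k by apply/eqP; rewrite -eqe -kE' kE.
have SS : S' = S by apply/eqP; rewrite -eqe -SE' SE.
rewrite {}kk {}SS {kE' SE'} in lk lS *.
have [dg lg' dg'] := stein_sol_regular a1 b1 lk dh lS.
have sol := stein_solP a1 b1 lk.
have lf := lip_center a b lk.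
have lg := stein_solution_lip a1 b1 sol lf.
split.
- by move=> x; rewrite derive1E; apply/derivableP; exact: dg.
- by move=> x; exact: stein_solution_le sol lf.
- have [_] := B1 h (lip_lipschitz lk); rewrite kE -EFinM => /supnorm_leP g'K.
  have lgK : lip (K1 * k) g by apply: ae_deriv_le_lip lg _ g'K; exact/aeW.
  by move=> x; exact: lip_derive1_le lgK (dg x).
- have [tw] := B2 h hD2; rewrite kE [X in (_ + X)%E]SE => /(supnorm_leP _ (K2 * (k + S))) g''K.
  apply: ae_deriv_le_lip lg' _ g''K.
  by apply: ae_imp tw => x [].
- by move=> x; exact: stein_solution_eq sol.
Qed.

(** * Second order Taylor estimate *)

Lemma deriv_ge0_le (w w' : R -> R) (x y : R) : x <= y ->
  (forall t : R, is_derive t 1 w (w' t)) -> (forall t, x <= t -> 0 <= w' t) -> w x <= w y.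
Proof.
move=> xy Dw w'0; apply: (@ger0_derive1_le_cc _ w x y).
- by move=> t _; exact: (ex_derive (is_derive := Dw t)).
- move=> t; rewrite in_itv /= => /andP[/ltW xt _].
  by rewrite derive1E (derive_val (is_derive := Dw t)) w'0.
- apply: derivable_within_continuous => t _.
  exact: (ex_derive (is_derive := Dw t)).
- by rewrite in_itv /= lexx.
- by rewrite in_itv /= xy lexx.
- by [].
Qed.

(** Compare u and - u with the primitive of the bound on u'. *)
Lemma deriv_le_pow (u u' : R -> R) (c x y : R) (n : nat) : x <= y ->
  (forall t : R, is_derive t 1 u (u' t)) -> u x = 0 ->
  (forall t, x <= t -> `|u' t| <= c * (t - x) ^+ n) ->
  `|u y| <= c * (y - x) ^+ n.+1 / n.+1%:R.
Proof.
move=> xy Du ux u'c.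
pose v (t : R) : R := c * (t - x) ^+ n.+1 / n.+1%:R.
have Dv (t : R) : is_derive t 1 v (c * (t - x) ^+ n).
  have Ds : is_derive t 1 (fun t : R => t - x) 1.
    have -> : (fun t : R => t - x) = (@id R) - cst x by apply/funext.
    by apply: is_derive_eq; rewrite subr0.
  have := is_deriveZ (c / n.+1%:R) (is_deriveX n.+1 Ds).
  have -> : (c / n.+1%:R) \*: ((fun t : R => t - x) ^+ n.+1) = v.
    by apply/funext => s; rewrite /v /= fctE /GRing.scale /=; ring.
  move=> D; apply: is_derive_eq D _; rewrite /GRing.scale /= mulr1.
  have n0 : n.+1%:R != 0 :> R by rewrite pnatr_eq0.
  by move: (n.+1%:R : R) n0 => m m0; field.
have vx : v x = 0 by rewrite /v subrr expr0n /= mulr0 mul0r.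
have key (s : R) : `|s| = 1 -> s * u y <= v y.
  move=> s1.
  have Dw (t : R) : is_derive t 1 (v - s \*: u) (c * (t - x) ^+ n - s * u' t).
    exact: is_deriveB (Dv t) (is_deriveZ s (Du t)).
  have w'0 t : x <= t -> 0 <= c * (t - x) ^+ n - s * u' t.
    move=> xt; rewrite subr_ge0; apply: le_trans (ler_norm _) _.
    by rewrite normrM s1 mul1r u'c.
  have le : v x - s * u x <= v y - s * u y := deriv_ge0_le xy Dw w'0.
  by move: le; rewrite vx ux mulr0 subrr subr_ge0.
rewrite ler_norml -/(v y); apply/andP; split.
  by have := key (-1) ltac:(by rewrite normrN1); lra.
by have := key 1 ltac:(by rewrite normr1); lra.
Qed.

(** Two integrations of the bound L |t - x| on g' t - g' x. *)
Lemma taylor2_right (G g g' : R -> R) (L x y : R) : x <= y ->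
  (forall t : R, is_derive t 1 G (g t)) -> (forall t : R, is_derive t 1 g (g' t)) ->
  lip L g' ->
  `|G y - G x - g x * (y - x) - g' x * (y - x) ^+ 2 / 2| <= L * `|y - x| ^+ 3 / 6.
Proof.
move=> xy DG Dg lg'.
pose u1 (t : R) := g t - g x - g' x * (t - x).
have Ds (t : R) : is_derive t 1 (fun t : R => t - x) 1.
  have -> : (fun t : R => t - x) = (@id R) - cst x by apply/funext.
  by apply: is_derive_eq; rewrite subr0.
have D1 (t : R) : is_derive t 1 u1 (g' t - g' x).
  have := is_deriveB (is_deriveB (Dg t) (is_derive_cst (g x) t (1 : R))) (is_deriveZ (g' x) (Ds t)).
  by move=> D; apply: is_derive_eq D _; rewrite subr0 /GRing.scale /= mulr1.
pose u2 (t : R) := G t - G x - g x * (t - x) - g' x * (t - x) ^+ 2 / 2.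
have D2 (t : R) : is_derive t 1 u2 (u1 t).
  have := is_deriveB (is_deriveB (is_deriveB (DG t) (is_derive_cst (G x) t (1 : R)))
    (is_deriveZ (g x) (Ds t))) (is_deriveZ (g' x / 2) (is_deriveX 2 (Ds t))).
  have -> : G - cst (G x) - g x \*: (fun t : R => t - x) -
      (g' x / 2) \*: ((fun t : R => t - x) ^+ 2) = u2.
    apply/funext => s.
    change (G s - G x - g x * (s - x) - (g' x / 2) * (s - x) ^+ 2 = u2 s).
    by rewrite /u2; ring.
  move=> D; apply: is_derive_eq D _.
  by rewrite /u1 subr0 /GRing.scale /= !mulr1 expr1; field.
have b1 t : x <= t -> `|u1 t| <= L / 2 * (t - x) ^+ 2.
  move=> xt.
  have := deriv_le_pow (n := 1) (c := L) xt D1.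
  rewrite /u1 !subrr mulr0 subr0 => /(_ erefl) h.
  apply: le_trans (h _) _; last by rewrite mulrAC.
  by move=> s xs; apply: le_trans (lg' _ _) _; rewrite expr1 ger0_norm// subr_ge0.
have := deriv_le_pow (n := 2) (c := L / 2) xy D2.
rewrite /u2 !subrr !mulr0 expr0n /= mulr0 mul0r !subr0 => /(_ erefl b1) h.
apply: le_trans h _; rewrite (ger0_norm (x := y - x)) ?subr_ge0//.
by rewrite le_eqVlt; apply/orP; left; apply/eqP; field.
Qed.

(** For y < x the estimate is applied to the reflected functions. *)
Lemma taylor2 (G g g' : R -> R) (L x y : R) :
  (forall t : R, is_derive t 1 G (g t)) -> (forall t : R, is_derive t 1 g (g' t)) ->
  lip L g' ->
  `|G y - G x - g x * (y - x) - g' x * (y - x) ^+ 2 / 2| <= L * `|y - x| ^+ 3 / 6.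
Proof.
move=> DG Dg lg'; have [xy|yx] := leP x y; first exact: taylor2_right.
have yx' : - x <= - y by rewrite lerN2 ltW.
have DNeg (F F' : R -> R) : (forall t : R, is_derive t 1 F (F' t)) ->
    forall t : R, is_derive t 1 (fun s => F (- s)) (- F' (- t)).
  move=> DF t; have dF : derivable F (- t) 1 by exact: (ex_derive (is_derive := DF (- t))).
  have [d e] := derive1_opp_arg dF.
  have := derivableP d; rewrite -derive1E e derive1E.
  by rewrite (derive_val (is_derive := DF (- t))).
have DgN (t : R) : is_derive t 1 (fun s => - g (- s)) (g' (- t)).
  by rewrite -[g' (- t)]opprK; apply: is_deriveN; exact: DNeg.
have lN : lip L (fun s => g' (- s)) by exact: lip_opp.
have := taylor2_right yx' (DNeg _ _ DG) DgN lN.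
rewrite !opprK.
have -> : - y + x = - (y - x) by ring.
rewrite normrN sqrrN mulrNN.
by [].
Qed.
End SteinFactors.

(** * Conditional expectations given a real random variable *)

Section RealIntegrable.
Context {d} {T : measurableType d} {R : realType} (mu : {measure set T -> \bar R}).
Implicit Types (f g : T -> R).

Lemma integrable_scale c f : mu.-integrable setT (EFin \o f) ->
  mu.-integrable setT (EFin \o (fun w => c * f w)).
Proof. exact: integrableZl. Qed.

Lemma integrable_add f g : mu.-integrable setT (EFin \o f) ->
  mu.-integrable setT (EFin \o g) ->
  mu.-integrable setT (EFin \o (fun w => f w + g w)).
Proof. exact: integrableD. Qed.

Lemma integrable_sub f g : mu.-integrable setT (EFin \o f) ->
  mu.-integrable setT (EFin \o g) ->
  mu.-integrable setT (EFin \o (fun w => f w - g w)).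
Proof. exact: integrableB. Qed.

Lemma integrable_le f g : measurable_fun setT f ->
  (forall w, `|f w| <= g w) -> mu.-integrable setT (EFin \o g) ->
  mu.-integrable setT (EFin \o f).
Proof.
move=> mf fg; apply: le_integrable => //; first exact: measurableT_comp.
by move=> w _ /=; rewrite lee_fin (le_trans (fg w))// ler_norm.
Qed.
End RealIntegrable.

Section ConditionalExpectation.
Context {d} {T : measurableType d} {R : realType} (P : probability T R).
Variable W : {RV P >-> R}.

Lemma preimage_measurable A : g_sigma_algebra_preimage W A -> measurable A.
Proof. by move=> [B mB <-]; exact: measurable_funP. Qed.

Lemma cond_exp_measurable X Z : is_cond_exp P X W Z -> measurable_fun setT Z.
Proof.
move=> [mZ _] _ B mB; apply: preimage_measurable.
by have := mZ measurableT B mB.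
Qed.

(** On the sets where Z is nonnegative, respectively negative, the integral of
|Z| is that of X up to sign, and both sets belong to the sigma-algebra of W. *)
Lemma cond_exp_integrable (X Z : T -> \bar R) : P.-integrable setT X ->
  is_cond_exp P X W Z -> P.-integrable setT Z.
Proof.
move=> iX ce; have mZ := cond_exp_measurable ce.
have [mWZ ZX] := ce.
pose A : set T := setT `&` Z @^-1` `[0%E, +oo[%classic.
have sA : g_sigma_algebra_preimage W A.
  by apply: (mWZ measurableT); exact: emeasurable_itv.
have sAC : g_sigma_algebra_preimage W (~` A) by exact: (@measurableC _ (g_sigma_algebra_preimageType W) A sA).
have mA := preimage_measurable sA.
have mAC : measurable (~` A) := measurableC mA.
have Zlty B : measurable B -> g_sigma_algebra_preimage W B ->
    (`|\int[P]_(w in B) Z w| < +oo)%E.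
  move=> mB sB; rewrite (ZX B sB) -ge0_fin_numE// abse_fin_num.
  exact/integrable_fin_num/(integrableS measurableT).
have Z0 x : A x -> (0 <= Z x)%E by rewrite /A /= in_itv /= andbT => -[].
have Z0C x : (~` A) x -> (Z x <= 0)%E.
  rewrite /A /= in_itv /= andbT => /not_andP[//|/negP].
  by rewrite -ltNge => /ltW.
apply/integrableP; split=> //.
rewrite -(setUv A) ge0_integral_setU//=; last 2 first.
- by rewrite setUv; exact: measurableT_comp.
- by apply/disj_setPCl.
apply: lte_add_pinfty.
  rewrite (eq_integral Z) => [|x /set_mem/Z0 z0]; last by rewrite gee0_abs.
  by apply: le_lt_trans (Zlty _ mA sA); exact: lee_abs.
rewrite (eq_integral (fun x => - Z x)%E) => [|x /set_mem/Z0C z0]; last first.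
  by rewrite lee0_abs.
rewrite integralN.
  by apply: le_lt_trans (Zlty _ mAC sAC); rewrite -abseN; exact: lee_abs.
rewrite [X in (X +? _)%E](_ : _ = 0%E) ?fin_num_adde_defr//.
rewrite -[RHS](integral0 P (~` A)); apply: eq_integral => x /set_mem/Z0C z0.
by rewrite unlock /=; exact: max_r.
Qed.

Lemma integrable_comp_bounded (phi : R -> R) (M : R) (D : T -> R) :
  measurable_fun setT phi -> (forall x, `|phi x| <= M) ->
  P.-integrable setT (EFin \o D) ->
  P.-integrable setT (EFin \o (fun w => phi (W w) * D w)).
Proof.
move=> mphi phiM iD.
have -> : EFin \o (fun w => phi (W w) * D w) =
    ((EFin \o (phi \o W)) \* (EFin \o D))%E by apply/funext => w.
apply: integrableMr => //; first exact: measurableT_comp.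
exists M; split; first exact: num_real.
by move=> N MN w _ /=; apply: le_trans (phiM _) (ltW MN).
Qed.

(** Let B be the set where phi is at least 1/2.  Then phi = (1_B + g) / 2 with
g again valued in [0, 1], and the indicator contributes 0, so the integral for
phi is half of the integral for g.  Iterating, it is at most 2^-n times the
integral of |D| for every n. *)
Lemma integral_comp_eq0_unit (D : T -> R) (phi : R -> R) :
  P.-integrable setT (EFin \o D) ->
  (forall B, measurable B -> \int[P]_(w in W @^-1` B) D w = 0) ->
  measurable_fun setT phi -> (forall x, 0 <= phi x <= 1) ->
  \int[P]_w (phi (W w) * D w) = 0.
Proof.
move=> iD D0.
pose C := \int[P]_w `|D w|.
have b1 (f : R -> R) (x : R) : 0 <= f x <= 1 -> `|f x| <= 1.
  by move=> /andP[f0 f1]; rewrite ger0_norm.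
have key n (f : R -> R) : measurable_fun setT f -> (forall x, 0 <= f x <= 1) ->
    `|\int[P]_w (f (W w) * D w)| <= 2^-1 ^+ n * C.
  elim: n f => [|n IH] f mf f01.
    have ifD := integrable_comp_bounded mf (fun x => b1 f x (f01 x)) iD.
    rewrite expr0 mul1r; apply: le_trans (le_normr_Rintegral measurableT ifD) _.
    apply: le_Rintegral => //; [exact: integrable_abse ifD|exact: integrable_abse iD|].
    by move=> w _; rewrite normrM ler_piMl// b1.
  pose B := f @^-1` `[2^-1, +oo[%classic.
  have mB : measurable B by rewrite -[B]setTI; exact: mf.
  pose g x := 2 * f x - \1_B x.
  have mg : measurable_fun setT g.
    by apply: measurable_funB; [exact: measurable_funM|exact: measurable_indic].
  have g01 x : 0 <= g x <= 1.
    rewrite /g indicE; have /andP[f0 f1] := f01 x.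
    case: (boolP (x \in B)) => /= [/set_mem|/negP xB].
      by rewrite /B /= in_itv /= andbT => f2; apply/andP; split; lra.
    have : ~~ (2^-1 <= f x).
      by apply/negP => f2; apply: xB; rewrite inE /B /= in_itv /= andbT.
    by rewrite -ltNge => f2; apply/andP; split; lra.
  have igD := integrable_comp_bounded mg (fun x => b1 g x (g01 x)) iD.
  have mWB : measurable (W @^-1` B) by exact: measurable_funPTI.
  have iBD : P.-integrable setT (EFin \o (fun w => \1_B (W w) * D w)).
    apply: (integrable_comp_bounded (M := 1)) iD; first exact: measurable_indic.
    by move=> x; rewrite indicE; case: (x \in B); rewrite /= ?normr1 ?normr0.
  have -> : \int[P]_w (f (W w) * D w) = 2^-1 * \int[P]_w (g (W w) * D w).
    have -> : (fun w => f (W w) * D w) =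
        (fun w => 2^-1 * (g (W w) * D w) + 2^-1 * (\1_B (W w) * D w)).
      by apply/funext => w; rewrite /g; field.
    rewrite RintegralD//; last 2 first.
    - exact: integrable_scale igD.
    - exact: integrable_scale iBD.
    rewrite !RintegralZl//.
    have -> : \int[P]_w (\1_B (W w) * D w) = 0; last by rewrite mulr0 addr0.
    rewrite -(D0 B mB) [RHS]Rintegral_mkcond; apply: eq_Rintegral => w _.
    have memB : (w \in W @^-1` B) = (W w \in B).
      by apply/idP/idP => /set_mem wB; exact/mem_set.
    by rewrite patchE indicE memB; case: (W w \in B); rewrite ?mul1r ?mul0r.
  rewrite normrM ger0_norm// exprS -mulrA ler_pM2l ?invr_gt0//.
  exact: IH.
move=> mphi phi01; apply/eqP; rewrite -normr_le0.
have l0 : (fun n : nat => 2^-1 ^+ n * C) @ \oo --> (0 : R).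
  rewrite -[0](mul0r C); apply: cvgMl; apply: cvg_expr.
  by rewrite ger0_norm//; lra.
by apply: (ler_cvg_to (cvg_cst _) l0); near=> n; exact: key.
Unshelve. all: by end_near.
Qed.

Lemma integral_comp_eq0 (D : T -> R) (phi : R -> R) (M : R) :
  P.-integrable setT (EFin \o D) ->
  (forall B, measurable B -> \int[P]_(w in W @^-1` B) D w = 0) ->
  measurable_fun setT phi -> (forall x, `|phi x| <= M) ->
  \int[P]_w (phi (W w) * D w) = 0.
Proof.
move=> iD D0 mphi phiM.
have M0 : 0 <= M := le_trans (normr_ge0 _) (phiM 0).
(* Rescale phi from [- N, N] to [0, 1]; the constant part is handled by the
   event that is the whole space. *)
pose N := M + 1; have N0 : N != 0 by rewrite /N; lra.
pose psi x := (phi x + N) / (2 * N).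
have mpsi : measurable_fun setT psi.
  by apply: measurable_funM => //; exact: measurable_funD.
have psi01 x : 0 <= psi x <= 1.
  have := phiM x; rewrite ler_norml => /andP[p1 p2].
  rewrite /psi; apply/andP; split.
    by rewrite divr_ge0// /N; lra.
  by rewrite ler_pdivrMr /N; lra.
have psi1 x : `|psi x| <= 1 by have /andP[p0 p1] := psi01 x; rewrite ger0_norm.
have ipD := integrable_comp_bounded mpsi psi1 iD.
have -> : (fun w => phi (W w) * D w) =
    (fun w => 2 * N * (psi (W w) * D w) - N * D w).
  by apply/funext => w; rewrite /psi; field.
rewrite RintegralB//; last 2 first.
- exact: integrable_scale ipD.
- exact: integrable_scale iD.
rewrite !RintegralZl// integral_comp_eq0_unit//.
have := D0 setT measurableT; rewrite preimage_setT => ->.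
by rewrite !mulr0 subrr.
Qed.

Lemma integrable_ae_fine (Z : T -> \bar R) : P.-integrable setT Z ->
  {ae P, forall w, Z w = (fine (Z w))%:E} /\
  P.-integrable setT (EFin \o (fine \o Z)).
Proof.
move=> iZ; have aeZ : {ae P, forall w, Z w = (fine (Z w))%:E}.
  by apply: ae_imp (integrable_ae measurableT iZ) => w /(_ I) /fineK.
split=> //; have mZ := measurable_int _ iZ.
have mf : measurable_fun setT (EFin \o (fine \o Z)).
  by apply: measurableT_comp => //; exact: measurableT_comp.
have [_ Zoo] := integrableP _ _ _ iZ.
apply/integrableP; split => //; apply: le_lt_trans Zoo.
apply: ge0_le_integral => //; [exact: measurableT_comp|exact: measurableT_comp|].
by move=> w _ /=; case: (Z w) => [r| |] //=; rewrite ?lexx// normr0 leey.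
Qed.

(** The difference of X and Z integrates to 0 on every event of W, hence
against every bounded function of W. *)
Lemma cond_exp_pull_out (X : T -> R) (Z : T -> \bar R) (phi : R -> R) (M : R) :
  P.-integrable setT (EFin \o X) -> is_cond_exp P (EFin \o X) W Z ->
  measurable_fun setT phi -> (forall x, `|phi x| <= M) ->
  \int[P]_w (phi (W w) * X w) = \int[P]_w (phi (W w) * fine (Z w)).
Proof.
move=> iX ce mphi phiM.
have iZ := cond_exp_integrable iX ce.
have [aeZ iz] := integrable_ae_fine iZ.
have D0 B : measurable B ->
    \int[P]_(w in W @^-1` B) (X w - fine (Z w)) = 0.
  move=> mB; have mWB : measurable (W @^-1` B) by exact: measurable_funPTI.
  rewrite RintegralB//; [|exact: integrableS iX|exact: integrableS iz].
  apply/eqP; rewrite subr_eq0; apply/eqP; rewrite /Rintegral; congr fine.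
  have [_ ZX] := ce; rewrite -[LHS]ZX; last by exists B => //; rewrite setTI.
  apply: ae_eq_integral => //.
  - exact: measurable_funTS (measurable_int _ iZ).
  - exact: measurable_funTS (measurable_int _ iz).
  - by apply: ae_imp aeZ => w Zw _; exact: Zw.
have iXZ := integrable_sub iX iz.
have := integral_comp_eq0 iXZ D0 mphi phiM.
have -> : (fun w => phi (W w) * (X w - fine (Z w))) =
    (fun w => phi (W w) * X w - phi (W w) * fine (Z w)).
  by apply/funext => w; rewrite mulrBr.
rewrite RintegralB//; last 2 first.
- exact: integrable_comp_bounded mphi phiM iX.
- exact: integrable_comp_bounded mphi phiM iz.
by move=> /eqP; rewrite subr_eq0 => /eqP.
Qed.

End ConditionalExpectation.

(** * Pairs of identically distributed random variables *)

Section EqualLaw.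
Context {d} {T : measurableType d} {R : realType} (P : probability T R).

Lemma integrable_const (x : R) : P.-integrable setT (EFin \o (fun=> x)).
Proof. exact: finite_measure_integrable_cst. Qed.

Lemma Rintegral_const (x : R) : \int[P]_w x = x.
Proof.
rewrite Rintegral_cst//; have := @probability_setT _ _ _ P => /(congr1 fine).
by move=> e; transitivity (x * 1); [congr (x * _); exact: e|rewrite mulr1].
Qed.

Lemma integrable_ae_eq (f g : T -> R) : measurable_fun setT g ->
  {ae P, forall w, f w = g w} -> P.-integrable setT (EFin \o f) ->
  P.-integrable setT (EFin \o g).
Proof.
move=> mg fg iF; have [mf foo] := integrableP _ _ _ iF.
have mEg : measurable_fun setT (EFin \o g) by exact: measurableT_comp.
apply/integrableP; split=> //; apply: le_lt_trans foo.
rewrite (ge0_ae_eq_integral (g := abse \o (EFin \o f)))//.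
- exact: measurableT_comp.
- exact: measurableT_comp.
- by move=> x _; exact: abse_ge0.
- by apply: ae_imp fg => w /= ->.
Qed.

(** The dominating function may have an infinite integral; this is how the
possibly infinite expectations of the final bound enter. *)
Lemma abs_Rintegral_le (k : R) (f : T -> R) (F : T -> \bar R) :
  0 <= k -> P.-integrable setT (EFin \o f) ->
  measurable_fun setT F -> (forall w, 0 <= F w)%E ->
  {ae P, forall w, (`|f w|%:E <= k%:E * F w)%E} ->
  (`|\int[P]_w f w|%:E <= k%:E * \int[P]_w F w)%E.
Proof.
move=> k0 iF mF F0 fF.
have ifn : P.-integrable setT (EFin \o (fun w => `|f w|)) by exact: integrable_norm.
rewrite -ge0_integralZl_EFin//.
apply: (@le_trans _ _ (\int[P]_w `|f w|%:E)%E).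
  have fin : (\int[P]_w `|f w|%:E)%E \is a fin_num.
    by exact: integrable_fin_num ifn.
  by rewrite -(fineK fin) lee_fin; exact: le_normr_Rintegral.
apply: ae_ge0_le_integral => //.
- exact: measurable_int ifn.
- by move=> w _; rewrite mule_ge0.
- exact: measurable_funeM.
- by apply: ae_imp fF => w le _.
Qed.

(** Both integrals are that of F against the common law, which also carries
integrability from one variable to the other. *)
Lemma equal_law_integral (X Y : {RV P >-> R}) (F : R -> R) :
  measurable_fun setT F ->
  (forall B, measurable B -> distribution P X B = distribution P Y B) ->
  P.-integrable setT (EFin \o (fun w => F (X w))) ->
  P.-integrable setT (EFin \o (fun w => F (Y w))) /\
  \int[P]_w F (X w) = \int[P]_w F (Y w).
Proof.
move=> mF XY iFX.
have mEF : measurable_fun setT (EFin \o F) by exact: measurableT_comp.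
have iFY : P.-integrable setT (EFin \o (fun w => F (Y w))).
  have [_ foo] := integrableP _ _ _ iFX.
  apply/integrableP; split.
    by apply: measurableT_comp => //; exact: measurableT_comp.
  have mabs : measurable_fun setT (abse \o (EFin \o F)) by exact: measurableT_comp.
  have := ge0_integral_distribution Y mabs (fun=> abse_ge0 _).
  rewrite /comp /= => <-.
  rewrite (_ : (\int[distribution P Y]_y _)%E =
      (\int[distribution P X]_y `|F y|%:E)%E); last first.
    by apply: eq_measure_integral => A mA _; exact/esym/XY.
  have := ge0_integral_distribution X mabs (fun=> abse_ge0 _).
  by rewrite /comp /= => ->.
split=> //; rewrite /Rintegral; congr fine.
have := integral_distribution mEF iFX; rewrite /comp /= => <-.
have := integral_distribution mEF iFY; rewrite /comp /= => <-.
by apply: eq_measure_integral => A mA _; exact: XY.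
Qed.

End EqualLaw.

(** A function with constant derivative is affine, and a bounded affine
function is constant. *)
Lemma lip0_bounded_deriv0 {R : realType} (g g' : R -> R) (c : R) :
  (forall x : R, is_derive x 1 g (g' x)) -> (forall x, `|g x| <= c) ->
  lip 0 g' -> forall x, g' x = 0.
Proof.
move=> Dg gc lg'.
have g'E x : g' x = g' 0.
  by apply/eqP; rewrite -subr_eq0 -normr_le0; have := lg' x 0; rewrite mul0r.
have gE x : g x = g 0 + g' 0 * x.
  have D (t : R) : is_derive t 1 (g - g' 0 \*: @id R) 0.
    have := is_deriveB (Dg t) (is_deriveZ (g' 0) (is_derive_id t (1 : R))).
    by move=> D; apply: is_derive_eq D _; rewrite (g'E t) /GRing.scale /= mulr1 subrr.
  have : g x - g' 0 * x = g 0 - g' 0 * 0 := is_derive_0_is_cst x 0 D.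
  lra.
move=> x; rewrite g'E; apply/eqP; apply: contraT => g0.
have := gc ((2 * c + 1) / g' 0); have := gc 0; rewrite [g (_ / _)]gE.
rewrite mulrCA divff// mulr1 !ler_norml => /andP[h1 h2] /andP[h3 h4].
by exfalso; lra.
Qed.

Section RegressionPair.
Context {d} {T : measurableType d} {R : realType} (P : probability T R).
Variables (W W' Rem : {RV P >-> R}) (s t lam m c L1 L2 : R).
Variables (Z V : T -> \bar R) (h g g' : R -> R).
Hypothesis WW' : forall B, measurable B -> distribution P W B = distribution P W' B.
Hypothesis iDelta : P.-integrable setT (EFin \o (fun w => W' w - W w)).
Hypothesis lam0 : 0 < lam.
Hypothesis s0 : 0 < s.
Hypothesis ceZ : is_cond_exp P (fun w => (W' w - W w)%:E) W Z.
Hypothesis ZE : {ae P, forall w, Z w = (lam * (t - s * W w) + Rem w)%:E}.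
Hypothesis ceV : is_cond_exp P (fun w => ((W' w - W w) ^+ 2)%:E) W V.
Hypothesis ih : P.-integrable setT (EFin \o (fun w => h (W w))).
Hypothesis Dg : forall x : R, is_derive x 1 g (g' x).
Hypothesis gc : forall x, `|g x| <= c.
Hypothesis g'L1 : forall x, `|g' x| <= L1.
Hypothesis lg' : lip L2 g'.
Hypothesis steinE : forall x, (1 - x ^+ 2) * g' x + (t - s * x) * g x = h x - m.
Hypothesis iRem : P.-integrable setT (EFin \o Rem).

Let mg : measurable_fun setT g.
Proof.
apply: continuous_measurable_fun => x; apply: differentiable_continuous.
by apply/derivable1_diffP; exact: (ex_derive (is_derive := Dg x)).
Qed.

Let mg' : measurable_fun setT g'.
Proof. by apply: continuous_measurable_fun; exact: lip_continuous lg'. Qed.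

(** The regression identity expresses W through integrable random variables. *)
Let iW : P.-integrable setT (EFin \o W).
Proof.
have iZ := cond_exp_integrable iDelta ceZ.
have [aeZ iz] := integrable_ae_fine iZ.
have iY : P.-integrable setT (EFin \o (fun w => lam * (t - s * W w) + Rem w)).
  apply: integrable_ae_eq iz.
    apply: measurable_funD => //; apply: measurable_funM => //.
    by apply: measurable_funB => //; exact: measurable_funM.
  by apply: ae_imp ZE => w /= ->.
have := integrable_scale (- (lam * s)^-1) (integrable_sub (integrable_sub iY iRem)
  (integrable_const P (lam * t))).
congr (_.-integrable _ _); apply/funext => w /=; congr EFin.
by field; rewrite !gt_eqF.
Qed.

Let igamma : P.-integrable setT (EFin \o (fun w => t - s * W w)).
Proof.
apply: integrable_sub; first exact: integrable_const.
exact: integrable_scale iW.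
Qed.

Let ibd (phi : R -> R) M D := @integrable_comp_bounded _ _ _ P W phi M D.

(** The regression identity tested against g(W). *)
Lemma integral_stein_g : \int[P]_w (g (W w) * (W' w - W w)) =
  lam * \int[P]_w (g (W w) * (t - s * W w)) + \int[P]_w (g (W w) * Rem w).
Proof.
rewrite (cond_exp_pull_out iDelta ceZ mg gc).
have i1 := ibd mg gc igamma; have i2 := ibd mg gc iRem.
rewrite -RintegralZl// -RintegralD//; last exact: integrable_scale i1.
rewrite /Rintegral; congr fine; apply: ae_eq_integral => //.
- have iZ := cond_exp_integrable iDelta ceZ.
  have [_ iz] := integrable_ae_fine iZ.
  exact: measurable_int (ibd mg gc iz).
- exact: measurable_int (integrable_add (integrable_scale lam i1) i2).
- by apply: ae_imp ZE => w /= -> _ /=; congr EFin; ring.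
Qed.

(** The Stein equation at W; integrability of the term with g' follows from
that of the other terms. *)
Lemma integral_stein_h :
  P.-integrable setT (EFin \o (fun w => g' (W w) * (1 - W w ^+ 2))) /\
  \int[P]_w h (W w) - m = \int[P]_w (g' (W w) * (1 - W w ^+ 2)) +
    \int[P]_w (g (W w) * (t - s * W w)).
Proof.
have i1 := ibd mg gc igamma.
have im := integrable_const P m.
have i2 : P.-integrable setT (EFin \o (fun w => g' (W w) * (1 - W w ^+ 2))).
  have := integrable_sub (integrable_sub ih im) i1.
  congr (_.-integrable _ _); apply/funext => w /=; congr EFin.
  by rewrite -steinE; ring.
split=> //; rewrite -RintegralD//.
have -> : (fun w => g' (W w) * (1 - W w ^+ 2) + g (W w) * (t - s * W w)) =
    (fun w => h (W w) - m) by apply/funext => w; rewrite -steinE; ring.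
by rewrite RintegralB// Rintegral_const.
Qed.

Let remainder_le :
  (`|lam^-1 * \int[P]_w (g (W w) * Rem w)|%:E
   <= (c / lam)%:E * \int[P]_w `|Rem w|%:E)%E.
Proof.
have igR := ibd mg gc iRem.
rewrite -RintegralZl//; apply: abs_Rintegral_le => //.
- by rewrite divr_ge0 ?(ltW lam0)// (le_trans (normr_ge0 _) (gc 0)).
- exact: integrable_scale.
- by apply: measurableT_comp => //; exact: measurableT_comp.
- apply/aeW => w; rewrite -EFinM lee_fin !normrM gtr0_norm ?invr_gt0//.
  by rewrite mulrA (mulrC c) ler_wpM2r// ler_pM2l ?invr_gt0.
Qed.

(** A primitive of the bounded function g grows at most linearly, and W is
integrable. *)
Lemma pair_primitive : exists G : R -> R,
  [/\ (forall x : R, is_derive x 1 G (g x)),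
      P.-integrable setT (EFin \o (fun w => G (W w))),
      P.-integrable setT (EFin \o (fun w => G (W' w))) &
      \int[P]_w (G (W' w) - G (W w)) = 0].
Proof.
have cg : continuous g.
  move=> x; apply: differentiable_continuous.
  by apply/derivable1_diffP; exact: (ex_derive (is_derive := Dg x)).
have [G DG] := continuous_primitive cg; exists G.
have G'E : G^`()%classic = g.
  by apply/funext => x; rewrite derive1E (derive_val (is_derive := DG x)).
have [K lG] : exists K, lip K G.
  apply: derivable_bounded_lip; first by move=> x; exact: (ex_derive (is_derive := DG x)).
  rewrite G'E; exists c; split; first exact: num_real.
  by move=> N cN x _ /=; exact: le_trans (gc x) (ltW cN).
have iGW : P.-integrable setT (EFin \o (fun w => G (W w))).
  apply: (integrable_le (g := fun w => `|G 0| + K * `|W w|)).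
  - by apply: measurableT_comp => //; exact: lip_measurable lG.
  - by move=> w; exact: lip_bound lG.
  - apply: integrable_add; first exact: integrable_const.
    by apply: integrable_scale; exact: integrable_norm.
have mG : measurable_fun setT G by exact: lip_measurable lG.
have [iGW' GE] := equal_law_integral mG WW' iGW.
by split=> //; rewrite RintegralB// GE subrr.
Qed.

(** When g' is constant the Taylor expansion of G stops after the linear term,
so only the term with Rem remains. *)
Lemma pair_bound_affine : L2 = 0 ->
  (`|\int[P]_w h (W w) - m|%:E <= (c / lam)%:E * \int[P]_w `|Rem w|%:E)%E.
Proof.
move=> L20; have g'0 : forall x, g' x = 0.
  by apply: lip0_bounded_deriv0 Dg gc _; rewrite -L20.
have [G [DG iGW iGW' G0]] := pair_primitive.
have exact w : G (W' w) - G (W w) = g (W w) * (W' w - W w).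
  have := taylor2 (W w) (W' w) DG Dg lg'; rewrite L20 g'0 !mul0r subr0 normr_le0.
  by rewrite subr_eq0 => /eqP.
have gD0 : \int[P]_w (g (W w) * (W' w - W w)) = 0.
  by rewrite -G0; apply: eq_Rintegral => w _; rewrite exact.
have := integral_stein_g; rewrite gD0.
have [_ ->] := integral_stein_h.
have -> : \int[P]_w (g' (W w) * (1 - W w ^+ 2)) = 0.
  rewrite -[RHS](Rintegral_const P 0).
  by apply: eq_Rintegral => w _; rewrite g'0 mul0r.
rewrite add0r => e.
have -> : \int[P]_w (g (W w) * (t - s * W w)) =
    - (lam^-1 * \int[P]_w (g (W w) * Rem w)).
  by apply: (mulfI (lt0r_neq0 lam0)); rewrite mulrN mulrA divff ?lt0r_neq0//; lra.
by rewrite normrN remainder_le.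
Qed.

(** With D := W' - W the identity 0 = E[g(W) D] + E[g'(W) D^2] / 2 + E[rem],
the regression identity and the Stein equation combine into
E[h(W)] - m = E[g'(W) (eta(W) - V / (2 lam))] - E[rem] / lam - E[g(W) Rem] / lam. *)
Lemma pair_bound_smooth :
  P.-integrable setT (EFin \o (fun w => `|W' w - W w| ^+ 3)) ->
  (`|\int[P]_w h (W w) - m|%:E <=
   L1%:E * (\int[P]_w `|(1 - W w ^+ 2)%:E - (2 * lam)^-1%:E * V w|)
   + (L2 / (6 * lam))%:E * \int[P]_w (`|W' w - W w| ^+ 3)%:E
   + (c / lam)%:E * \int[P]_w `|Rem w|%:E)%E.
Proof.
move=> i3.
have [G [DG iGW iGW' G0]] := pair_primitive.
pose D w := W' w - W w.
have mD : measurable_fun setT D by exact: measurable_funB.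
have i2 : P.-integrable setT (EFin \o (fun w => D w ^+ 2)).
  apply: (integrable_le (g := fun w => 1 + `|D w| ^+ 3)).
  - exact: measurable_funX.
  - move=> w; rewrite normrX; have := normr_ge0 (D w).
    move: `|D w| => x x0.
    have := mulr_ge0 (addr_ge0 x0 ler01) (sqr_ge0 (x - 1)).
    by rewrite !exprS !expr0; lra.
  - by apply: integrable_add => //; exact: integrable_const.
have iV := cond_exp_integrable i2 ceV.
have [aeV iv] := integrable_ae_fine iV.
have pull := cond_exp_pull_out i2 ceV mg' g'L1.
have ig'v := ibd mg' g'L1 iv.
have ig'D := ibd mg' g'L1 i2.
have igD := ibd mg gc iDelta.
have igR := ibd mg gc iRem.
have [ig'e hE] := integral_stein_h.
pose rem w := G (W' w) - G (W w) - g (W w) * D w - 2^-1 * (g' (W w) * D w ^+ 2).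
have irem : P.-integrable setT (EFin \o rem).
  apply: integrable_sub; last exact: integrable_scale.
  by apply: integrable_sub => //; exact: integrable_sub.
have remE : \int[P]_w rem w =
    - (\int[P]_w (g (W w) * D w)) - 2^-1 * \int[P]_w (g' (W w) * fine (V w)).
  rewrite /rem RintegralB//; last 2 first.
  - by apply: integrable_sub => //; exact: integrable_sub.
  - exact: integrable_scale.
  rewrite RintegralB//; last exact: integrable_sub.
  by rewrite G0 sub0r RintegralZl//; congr (_ - _ * _); exact: pull.
pose main w := g' (W w) * (1 - W w ^+ 2) - (2 * lam)^-1 * (g' (W w) * fine (V w)).
have imain : P.-integrable setT (EFin \o main).
  by apply: integrable_sub => //; exact: integrable_scale.
have mainE : \int[P]_w main w = \int[P]_w (g' (W w) * (1 - W w ^+ 2)) -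
    (2 * lam)^-1 * \int[P]_w (g' (W w) * fine (V w)).
  by rewrite /main RintegralB//; [rewrite RintegralZl|exact: integrable_scale].
have -> : \int[P]_w h (W w) - m = \int[P]_w main w
    - lam^-1 * \int[P]_w rem w - lam^-1 * \int[P]_w (g (W w) * Rem w).
  rewrite hE mainE remE; have := integral_stein_g.
  rewrite -/D => ->; field; exact: lt0r_neq0.
apply: (@le_trans _ _ (`|\int[P]_w main w| + `|lam^-1 * \int[P]_w rem w|
    + `|lam^-1 * \int[P]_w (g (W w) * Rem w)|)%:E).
  by rewrite lee_fin (le_trans (ler_normB _ _))// lerD2r ler_normB.
rewrite !EFinD; apply: leeD; last exact: remainder_le.
apply: leeD.
  apply: abs_Rintegral_le => //.
  - exact: le_trans (normr_ge0 _) (g'L1 0).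
  - apply: measurableT_comp => //; apply: emeasurable_funB.
      apply: measurableT_comp => //; apply: measurable_funB => //.
      exact: measurable_funX.
    by apply: measurable_funeM; exact: measurable_int iV.
  - apply: ae_imp aeV => w Vw; rewrite Vw /=.
    have -> : main w = g' (W w) * (1 - W w ^+ 2 - (2 * lam)^-1 * fine (V w)).
      by rewrite /main; ring.
    by rewrite lee_fin normrM ler_wpM2r.
rewrite -RintegralZl//; apply: abs_Rintegral_le => //.
- by rewrite divr_ge0 ?(lip_ge0 lg')// mulr_ge0// ltW.
- exact: integrable_scale.
- exact: measurable_int i3.
- apply/aeW => w; rewrite -EFinM lee_fin normrM gtr0_norm ?invr_gt0//.
  have := taylor2 (W w) (W' w) DG Dg lg'; rewrite -/(D w).
  have -> : G (W' w) - G (W w) - g (W w) * D w - g' (W w) * D w ^+ 2 / 2 = rem w.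
    by rewrite /rem; ring.
  move=> b; have -> : L2 / (6 * lam) * `|D w| ^+ 3 = lam^-1 * (L2 * `|D w| ^+ 3 / 6).
    by field; exact: lt0r_neq0.
  by rewrite ler_wpM2l// ltW// invr_gt0.
Qed.

End RegressionPair.

(** * The bound for Beta approximation *)

Section BetaApproximation.
Context {d} {T : measurableType d} {R : realType} (P : probability T R).

(** A term on the right with a positive factor may be assumed finite, since
otherwise the right-hand side is infinite.  A
factor 0 occurs when k = 0, in which case g = 0 and h = m, or when L2 = 0,
which is the case of constant g'.  The first term is handled with values in the extended reals. *)
Lemma pair_bound (W W' Rem : {RV P >-> R}) (s t lam m k L1 L2 : R)
    (Z V : T -> \bar R) (h g g' : R -> R) :
  (forall B, measurable B -> distribution P W B = distribution P W' B) ->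
  P.-integrable setT (EFin \o (fun w => W' w - W w)) ->
  0 < lam -> 0 < s ->
  is_cond_exp P (fun w => (W' w - W w)%:E) W Z ->
  {ae P, forall w, Z w = (lam * (t - s * W w) + Rem w)%:E} ->
  is_cond_exp P (fun w => ((W' w - W w) ^+ 2)%:E) W V ->
  P.-integrable setT (EFin \o (fun w => h (W w))) ->
  (forall x : R, is_derive x 1 g (g' x)) ->
  (forall x, `|g x| <= k / s) -> (forall x, `|g' x| <= L1) -> lip L2 g' ->
  (forall x, (1 - x ^+ 2) * g' x + (t - s * x) * g x = h x - m) ->
  (`|\int[P]_w h (W w) - m|%:E <=
   L1%:E * (\int[P]_w `|(1 - W w ^+ 2)%:E - (2 * lam)^-1%:E * V w|)
   + (L2 / (6 * lam))%:E * \int[P]_w (`|W' w - W w| ^+ 3)%:E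
   + (k / (s * lam))%:E * \int[P]_w `|Rem w|%:E)%E.
Proof.
move=> WW' iD lam0 s0 ceZ ZE ceV ih Dg gk g'L1 lg' steinE.
have k0 : 0 <= k.
  have := le_trans (normr_ge0 _) (gk 0).
  by rewrite pmulr_lge0// invr_gt0.
have L10 : 0 <= L1 := le_trans (normr_ge0 _) (g'L1 0).
have L20 : 0 <= L2 := lip_ge0 lg'.
set IV := (\int[P]_w `|_ - _|)%E; set I3 := (\int[P]_w (_ ^+ 3)%:E)%E.
set IR := (\int[P]_w `|Rem w|%:E)%E.
have IV0 : (0 <= IV)%E by apply: integral_ge0.
have I30 : (0 <= I3)%E by apply: integral_ge0 => w _; rewrite lee_fin exprn_ge0.
have IR0 : (0 <= IR)%E by apply: integral_ge0.
have T10 : (0 <= L1%:E * IV)%E by exact: mule_ge0.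
have c20 : 0 <= L2 / (6 * lam) by rewrite divr_ge0// mulr_ge0// ltW.
have T20 : (0 <= (L2 / (6 * lam))%:E * I3)%E by exact: mule_ge0.
have c30 : 0 <= k / (s * lam) by rewrite divr_ge0// mulr_ge0// ltW.
have T30 : (0 <= (k / (s * lam))%:E * IR)%E by exact: mule_ge0.
have [kE0|k_neq0] := eqVneq k 0.
  have g0 x : g x = 0.
    by apply/eqP; rewrite -normr_le0; have := gk x; rewrite kE0 mul0r.
  have g'0 x : g' x = 0.
    have gE : g = cst 0 by apply/funext.
    by have := derive_val (is_derive := Dg x); rewrite gE derive_val.
  have -> : \int[P]_w h (W w) = m.
    rewrite -[RHS](Rintegral_const P m); apply: eq_Rintegral => w _.
    by apply/eqP; rewrite -subr_eq0 -steinE g0 g'0 !mulr0 addr0.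
  by rewrite subrr normr0 adde_ge0// adde_ge0.
have kgt0 : 0 < k by rewrite lt_neqAle eq_sym k_neq0.
have [IRoo|IRoo] := leP +oo%E IR.
  have -> : IR = +oo%E by apply/eqP; rewrite eq_le IRoo leey.
  rewrite gt0_muley ?lte_fin ?divr_gt0 ?mulr_gt0//.
  by rewrite addey ?leey// gt_eqF// (lt_le_trans (ltNyr 0))// adde_ge0.
have iRem : P.-integrable setT (EFin \o Rem).
  by apply/integrableP; split => //; apply: measurableT_comp.
have csE : k / (s * lam) = (k / s) / lam by rewrite invfM mulrA.
have [L2E0|L2_neq0] := eqVneq L2 0.
  apply: le_trans (pair_bound_affine WW' iD lam0 s0 ceZ ZE ih Dg gk lg' steinE iRem L2E0) _.
  by rewrite -/IR -csE leeDr// adde_ge0.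
have L2gt0 : 0 < L2 by rewrite lt_neqAle eq_sym L2_neq0.
have [I3oo|I3oo] := leP +oo%E I3.
  have -> : I3 = +oo%E by apply/eqP; rewrite eq_le I3oo leey.
  rewrite gt0_muley ?lte_fin ?divr_gt0 ?mulr_gt0//.
  rewrite [X in (X + _)%E]addey ?addye ?leey// gt_eqF// (lt_le_trans (ltNyr 0))//.
have i3 : P.-integrable setT (EFin \o (fun w => `|W' w - W w| ^+ 3)).
  apply/integrableP; split.
    apply: measurableT_comp => //; apply: measurable_funX.
    by apply: measurableT_comp => //; exact: measurable_funB.
  apply: le_lt_trans I3oo; rewrite le_eqVlt; apply/orP; left; apply/eqP.
  by apply: eq_integral => w _ /=; rewrite ger0_norm// exprn_ge0.
rewrite csE.
exact: (pair_bound_smooth WW' iD lam0 s0 ceZ ZE ceV ih Dg gk g'L1 lg' steinE iRem i3).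
Qed.

End BetaApproximation.

Theorem theorem3p7 (R : realType) (alpha beta : R)
    (alpha_gtN1 : -1 < alpha) (beta_gtN1 : -1 < beta) :
  (exists K1 K2 : R, stein_bounds alpha beta K1 K2) /\
  (forall K1 K2 : R, stein_bounds alpha beta K1 K2 ->
   forall (d : measure_display) (T : measurableType d) (P : probability T R)
     (W W' Rem : {RV P >-> R}) (lambda : R) (Z V : T -> \bar R),
   (forall B : set R, measurable B ->
      distribution P W B = distribution P W' B) ->
   P.-integrable setT (EFin \o (fun w => W' w - W w)) ->
   0 < lambda ->
   is_cond_exp P (fun w => (W' w - W w)%:E) W Z ->
   {ae P, forall w,
      Z w = (lambda * stein_gamma alpha beta (W w) + Rem w)%:E} ->
   is_cond_exp P (fun w => ((W' w - W w) ^+ 2)%:E) W V ->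
   forall h : R -> R, bounded_D2 h ->
   ('E_P[(fun w => `|h (W w)|)%R] < +oo)%E ->
   (`|'E_P[(fun w => h (W w))%R] - (beta_mean alpha beta h)%:E|
    <= K1%:E * lipnorm h *
         (\int[P]_w `|(stein_eta (W w))%:E - (2 * lambda)^-1%:E * V w|)
       + K2%:E * (lipnorm h + supnorm h^`(2)%classic) * (6 * lambda)^-1%:E *
         'E_P[(fun w => `|W' w - W w| ^+ 3)%R]
       + lipnorm h * ((alpha + beta + 2) * lambda)^-1%:E *
         'E_P[(fun w => `|Rem w|)%R])%E).
Proof.
split.
  exists (stein_cst alpha beta), (stein_cst2 alpha beta).
  exact: stein_bounds_ex.
move=> K1 K2 BK d T P W W' Rem lam Z V WW' iD lam0 ceZ ZE ceV h hD2 hW.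
have [k [S [kE SE lk dh lS]]] := bounded_D2_lip hD2.
have [Dg gk g'k lg' steinE] := stein_sol_bounds alpha_gtN1 beta_gtN1 BK hD2 kE SE.
rewrite unlock in hW.
have ih : P.-integrable setT (EFin \o (fun w => h (W w))).
  apply/integrableP; split => //.
  apply: measurableT_comp => //; apply: measurableT_comp => //.
  exact: lip_measurable lk.
have ab0 : 0 < alpha + beta + 2 by lra.
have ZE' : {ae P, forall w,
    Z w = (lam * ((beta - alpha) - (alpha + beta + 2) * W w) + Rem w)%:E}.
  by apply: ae_imp ZE => w ->; rewrite /stein_gamma; congr (_ * _ + _)%:E; ring.
have steinE' x : (1 - x ^+ 2) * (stein_sol alpha beta h)^`()%classic x +
    ((beta - alpha) - (alpha + beta + 2) * x) * stein_sol alpha beta h x =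
    h x - beta_mean alpha beta h.
  have := steinE x; rewrite /stein_eta /stein_gamma /beta_center => <-; ring.
have := pair_bound WW' iD lam0 ab0 ceZ ZE' ceV ih Dg gk g'k lg' steinE'.
rewrite !unlock kE [X in (k%:E + X)%E]SE.
rewrite -(fineK (integrable_fin_num measurableT ih)).
by rewrite -!EFinD -!EFinM.
Qed.
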